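(* Let $L$ be an integro-differential operator in the class $\mathcal L_1$ with $\sigma\ge\sigma_0>1$. Suppose $u$ belongs to the weighted space $L^1(\mathbb R^n,\frac1{1+|y|^\sigma})$ and solves $Lu=f$ in $B_1$ for some $f\in L^2$. Let $L'$ be an operator in $\mathcal L_0$. Then $L'u\in L^2(B_{1/2})$ and \[\|L'u\|_{L^2(B_{1/2})}\le C\Big(\|u\|_{L^1(\mathbb R^n,\frac1{1+|y|^\sigma})}+\|f\|_{L^2(B_1)}\Big)\] for a constant $C$ depending on $n,\lambda,\Lambda$ and $\sigma_0$.
   Context: Fix $n\ge1$, $\sigma\in(0,2)$, $0<\lambda\le\Lambda$. For $u$ on $\mathbb R^n$, $\delta u(x,y)=u(x+y)+u(x-y)-2u(x)$. A linear operator $Lu(x)=\int_{\mathbb R^n}\delta u(x,y)K(y)\,dy$ belongs to $\mathcal L_0$ if $(2-\sigma)\lambda|y|^{-n-\sigma}\le K(y)\le(2-\sigma)\Lambda|y|^{-n-\sigma}$ for $y\ne0$, and to $\mathcal L_1$ if moreover $K$ is $C^1$ away from $0$ with $|\nabla K(y)|\le C_1|y|^{-n-1-\sigma}$ for a fixed constant $C_1$. The weighted norm is $\|u\|_{L^1(\mathbb R^n,\frac1{1+|y|^\sigma})}=\int_{\mathbb R^n}\frac{|u(y)|}{1+|y|^\sigma}dy$. $B_r$ is the ball of radius $r$ centered at $0$. *)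

(* Defs.v *)
From HB Require Import structures.
From mathcomp Require Import all_boot all_order all_algebra.
From mathcomp Require Import all_classical all_reals all_analysis.
Set Implicit Arguments. Unset Strict Implicit. Unset Printing Implicit Defensive.
Import Order.TTheory GRing.Theory Num.Theory.
Import numFieldNormedType.Exports.
Local Open Scope classical_set_scope.
Local Open Scope ring_scope.

Section RnDefs.
Variable R : realType.

Definition enorm (n : nat) (y : 'rV[R]_n) : R :=
  Num.sqrt (\sum_(i < n) (y ord0 i) ^+ 2).

Definition ballE (n : nat) (r : R) : set 'rV[R]_n := [set x | enorm x < r].

Definition borel_meas (n : nat) (f : 'rV[R]_n -> R) : Prop :=
  forall B : set R, measurable B ->
    (<<s [set U : set 'rV[R]_n | open U] >>) (f @^-1` B).

(* Lebesgue integral over R^n of an extended-real function, computed as the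
   iterated one-dimensional Lebesgue integral over the coordinates
   (Tonelli/Fubini). *)
Fixpoint intRn (n : nat) : ('rV[R]_n -> \bar R) -> \bar R :=
  match n return ('rV[R]_n -> \bar R) -> \bar R with
  | 0 => fun f => f 0
  | n'.+1 => fun f =>
      (\int[@lebesgue_measure R]_t
          intRn (fun v : 'rV[R]_n' => f (row_mx (\row_(j < 1) t) v)))%E
  end.

(* Signed Lebesgue integral of a real function (meaningful for integrable
   functions): integral of the positive part minus that of the negative part. *)
Definition Rint (n : nat) (h : 'rV[R]_n -> R) : R :=
  fine (intRn (fun x => (Num.max (h x) 0)%:E)) -
  fine (intRn (fun x => (Num.max (- h x) 0)%:E)).

Definition L2ball_norm (n : nat) (r : R) (g : 'rV[R]_n -> R) : R :=
  Num.sqrt (fine (intRn (fun x => (\1_(@ballE n r) x * (g x) ^+ 2)%:E))).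

Definition L2ball (n : nat) (r : R) (g : 'rV[R]_n -> R) : Prop :=
  borel_meas g /\
  (intRn (fun x => (\1_(@ballE n r) x * (g x) ^+ 2)%:E) < +oo)%E.

Definition wL1_integrand (n : nat) (sigma : R) (u : 'rV[R]_n -> R) :=
  fun y => (`|u y| / (1 + enorm y `^ sigma))%:E.

Definition wL1 (n : nat) (sigma : R) (u : 'rV[R]_n -> R) : Prop :=
  borel_meas u /\ (intRn (wL1_integrand sigma u) < +oo)%E.

Definition wL1_norm (n : nat) (sigma : R) (u : 'rV[R]_n -> R) : R :=
  fine (intRn (wL1_integrand sigma u)).

Definition delta2 (n : nat) (u : 'rV[R]_n -> R) (x y : 'rV[R]_n) : R :=
  u (x + y) + u (x - y) - 2 * u x.

Definition Lop (n : nat) (K : 'rV[R]_n -> R) (u : 'rV[R]_n -> R) (x : 'rV[R]_n) : R :=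
  Rint (fun y => delta2 u x y * K y).

Definition classL0 (n : nat) (lambda Lambda sigma : R) (K : 'rV[R]_n -> R) : Prop :=
  borel_meas K /\
  forall y : 'rV[R]_n, y != 0 ->
    (2 - sigma) * lambda * enorm y `^ (- (n%:R + sigma)) <= K y /\
    K y <= (2 - sigma) * Lambda * enorm y `^ (- (n%:R + sigma)).

Definition grad (n : nat) (K : 'rV[R]_n -> R) (y : 'rV[R]_n) : 'rV[R]_n :=
  \row_(i < n) derive K y (delta_mx ord0 i : 'rV[R]_n).

Definition classL1 (n : nat) (lambda Lambda sigma C1 : R) (K : 'rV[R]_n -> R) : Prop :=
  classL0 lambda Lambda sigma K /\
  (forall y : 'rV[R]_n, y != 0 ->
     differentiable K y /\ {for y, continuous (grad K)} /\
     enorm (grad K y) <= C1 * enorm y `^ (- (n%:R + 1 + sigma))).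

Fixpoint iterD (n : nat) (vs : seq 'rV[R]_n) (f : 'rV[R]_n -> R) : 'rV[R]_n -> R :=
  match vs with
  | [::] => f
  | v :: vs' => fun x => derive (iterD vs' f) x v
  end.

Definition smooth (n : nat) (f : 'rV[R]_n -> R) : Prop :=
  forall (vs : seq 'rV[R]_n) (x : 'rV[R]_n), differentiable (iterD vs f) x.

Definition test_fun (n : nat) (r : R) (phi : 'rV[R]_n -> R) : Prop :=
  smooth phi /\ exists rho : R, rho < r /\
    forall x : 'rV[R]_n, rho < enorm x -> phi x = 0.

Definition weak_sol (n : nat) (r : R) (K u f : 'rV[R]_n -> R) : Prop :=
  forall phi : 'rV[R]_n -> R, test_fun r phi ->
    Rint (fun x => u x * Lop K phi x) = Rint (fun x => f x * phi x).

(* the distribution L_K u restricted to B_r is represented by g *)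
Definition represents (n : nat) (r : R) (K u g : 'rV[R]_n -> R) : Prop :=
  forall phi : 'rV[R]_n -> R, test_fun r phi ->
    Rint (fun x => u x * Lop K phi x) = Rint (fun x => g x * phi x).

End RnDefs.

(* Main.v *)
(** Write Lw(x) for the integral of (w(x+y) + w(x-y) - 2w(x)) K(y) dy.
    The second difference operators commute and factor as D_y = (D'_y)^2 with
    D'_y antisymmetric, so <D_y w, D_z w> = |D'_y D'_z w|^2 >= 0.  Integrating
    against two nonnegative kernels gives <L_1 w, L_2 w> >= 0, and then
    K_2 <= a K_1 gives |L_2 w| <= a |L_1 w| in L^2 of the whole space.  This
    replaces the Fourier transform and needs no smoothness of K.

    For a smooth u one localises with cutoffs eta_k on balls shrinking from
    B_3/4 to B_1/2.  With Q_k = |L(eta_k u)|^2, the commutator of L and eta_k is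
    bounded by the energy -<Lw, w> of w = eta_(k+1) u, which is absorbed by
    Q_(k+1) and |w|^2, and |w|^2 by Q_(k+1) and |u|_1^2 through a Nash inequality.
    The resulting recursion Q_k <= theta Q_(k+1) + A mu^k closes because Q_k grows
    at most geometrically a priori.

    A weak solution is truncated to B_4 and mollified; the truncation error is
    controlled by the weighted norm because L phi decays like |x|^(-n-s).
    Letting the mollification parameter tend to 0 shows that
    phi |-> int u L'phi is bounded in L^2 on test functions of B_1/2, and its
    representative is the limit of a minimising sequence of
    |phi|^2 - 2 int u L'phi. *)

Require Import Defs.
From HB Require Import structures.
From mathcomp Require Import all_boot all_order all_algebra.
From mathcomp Require Import all_classical all_reals all_analysis.
From mathcomp Require Import ring lra measurable_realfun.
Import Order.TTheory GRing.Theory Num.Theory.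
Import numFieldNormedType.Exports.
Local Open Scope classical_set_scope.
Local Open Scope ring_scope.

Set Implicit Arguments.
Unset Strict Implicit.
Unset Printing Implicit Defensive.

(** * Lebesgue measure and integration on R^n *)

(** The constant may not depend on sigma, although the kernels degenerate as sigma tends to 2: the
    normalisation 2 - sigma vanishes while |y|^2 |y|^(-n-sigma) stops being integrable at 0. So 2 -
    sigma is never divided out alone. It is always played against 1 - 2^(sigma-2), the defect of
    self-similarity between two dyadic scales, which is comparable to it. This bounds the mass of
    min(1, |y|^2) K, and also the share of the energy lying on one dyadic annulus, from which a Nash
    inequality uniform in sigma follows. A second obstacle is that positivity of <L_1 w, L_2 w>
    holds on the whole space only, while the data and the conclusion are local. The comparison of
    operators thus applies to a truncation of u alone, and the error of truncating is measured by a
    slightly larger truncation, hence a chain of cutoffs instead of a single one. Each link loses a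
    power of the inverse width of its transition layer, so every estimate keeps that width explicit,
    and theta is chosen small against the growth mu of these losses. *)

Notation bT R n := (g_sigma_algebraType [set U : set 'rV[R]_n | open U]).

Lemma sigma_finite_prod d1 d2 (T1 : measurableType d1) (T2 : measurableType d2)
    (R : realType) (m1 : {sigma_finite_measure set T1 -> \bar R})
    (m2 : {sigma_finite_measure set T2 -> \bar R}) :
  sigma_finite setT (m1 \x m2)%E.
Proof.
have /sigma_finiteP[F [TF ndF Foo]] := sigma_finiteT m1.
have /sigma_finiteP[G [TG ndG Goo]] := sigma_finiteT m2.
exists (fun k => F k `*` G k) => [|k].
  apply/seteqP; split=> // -[x y] _.
  have [i _ Fx] : (\bigcup_i F i) x by rewrite -TF.
  have [j _ Gy] : (\bigcup_i G i) y by rewrite -TG.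
  exists (maxn i j) => //; split=> /=.
    by move: Fx; exact/subsetPset/ndF/leq_maxl.
  by move: Gy; exact/subsetPset/ndG/leq_maxr.
have [[mF Fk] [mG Gk]] := (Foo k, Goo k); split; first exact: measurableX.
by rewrite product_measure1E // lte_mul_pinfty // ge0_fin_numE.
Qed.

Section BorelRn.
Variable R : realType.

Lemma borel_measP n (f : 'rV[R]_n -> R) :
  borel_meas f <-> measurable_fun setT (f : bT R n -> R).
Proof.
split=> [h _ B mB|h B mB]; first by rewrite setTI; exact: h.
by have := h measurableT B mB; rewrite setTI.
Qed.

Lemma continuous_measurable n (f : 'rV[R]_n -> R) :
  continuous f -> measurable_fun setT (f : bT R n -> R).
Proof.
move=> cf; apply: (measurability _ (@RGenOpens.measurableE R)).
move=> _ [_ [a [b ->]] <-]; rewrite setTI; apply: sub_sigma_algebra.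
by move/continuousP : cf; apply; exact: interval_open.
Qed.

Lemma measurable_coord n (i : 'I_n) :
  measurable_fun setT ((fun x => x ord0 i) : bT R n -> R).
Proof. by apply: continuous_measurable; exact: coord_continuous. Qed.

(* Every open set is a countable union of rational boxes, so the Borel sets
   are generated by the coordinates. *)
Lemma measurable_rV d (S : measurableType d) n (f : S -> 'rV[R]_n) :
  (forall i, measurable_fun setT (fun s => f s ord0 i)) ->
  measurable_fun setT (f : S -> bT R n).
Proof.
move=> mf; apply: (@measurability _ _ S (bT R n) setT f [set U : set 'rV[R]_n | open U] erefl).
move=> _ [U oU <-]; rewrite setTI.
pose box (c : 'rV[rat]_n) (k : nat) : set 'rV[R]_n :=
  [set y | forall i, `|y ord0 i - ratr (c ord0 i)| < k.+1%:R^-1].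
pose I := [set ck : 'rV[rat]_n * nat | box ck.1 ck.2 `<=` U].
have -> : f @^-1` U = \bigcup_(ck in I) (f @^-1` (box ck.1 ck.2)).
  apply/seteqP; split=> s /=; last first.
    by move=> [ck Ick fs]; exact: Ick.
  move=> Us; have := oU; rewrite openE => /(_ _ Us).
  rewrite /interior -nbhs_ballE => -[e /= e0 eU].
  (* The topology of row vectors is that of the maximum norm, so balls are boxes. With [k.+1%:R^-1]
     below [e / 2], a box around a rational point that contains [f s] stays in the ball of radius
     [e] around [f s]. *)
  have [k ke] : exists k : nat, k.+1%:R^-1 *+ 2 < e.
    exists (Num.truncn (e / 2)^-1).
    have h := truncnS_gt (e / 2)^-1; have e2 : 0 < e / 2 by lra.
    have : (Num.truncn (e / 2)^-1).+1%:R^-1 < e / 2.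
      by rewrite -[ltRHS]invrK ltf_pV2 // posrE // invr_gt0.
    by rewrite ltr_pdivlMr // mulr_natr.
  have k0 : 0 < k.+1%:R^-1 :> R by rewrite invr_gt0.
  move Ez : (k.+1%:R^-1) k0 ke => z z0 ze; rewrite mulr2n in ze.
  have /choice[c cP] : forall i, exists q : rat, `|f s ord0 i - ratr q| < z.
    move=> i.
    have lt1 : f s ord0 i - z < f s ord0 i + z by lra.
    have [q /=] := rat_in_itvoo lt1.
    rewrite in_itv /= => /andP[q1 q2]; exists q.
    by rewrite ltr_norml; apply/andP; split; lra.
  exists (\row_i c i, k) => /=; last by move=> i; rewrite mxE Ez.
  move=> y /= yb; apply: eU => /=; split => // i j.
  rewrite (ord1 i) /ball /=.
  have := yb j; rewrite mxE Ez => y1; have y2 := cP j.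
  by rewrite ltr_norml; move: y1 y2; rewrite !ltr_norml => /andP[? ?] /andP[? ?];
    apply/andP; split; lra.
rewrite bigcup_mkcond; apply: countable_bigcupT_measurable => [|[c k]].
  exact: countableP.
case: ifPn => // _ /=.
have -> : f @^-1` box c k = \bigcap_(i in [set: 'I_n])
    (fun s => `|f s ord0 i - ratr (c ord0 i)|) @^-1` (`]-oo, k.+1%:R^-1[%classic).
  apply/seteqP; split=> s /=.
    by move=> h i _ /=; rewrite in_itv /=; exact: h.
  by move=> h i; have := h i Logic.I; rewrite /= in_itv.
apply: fin_bigcap_measurable => // i _; rewrite -[X in measurable X]setTI.
have mg : measurable_fun setT (fun s => `|f s ord0 i - ratr (c ord0 i)|).
  apply: measurableT_comp => //; apply: measurable_funB => //.
exact: mg.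
Qed.

Lemma measurable_row_mx n :
  measurable_fun setT ((fun p => row_mx (\row_(j < 1) p.1) p.2 : 'rV[R]_n.+1) :
    measurableTypeR R * bT R n -> bT R n.+1).
Proof.
apply: measurable_rV => i.
have [j ->|j ->] := split_ordP (i : 'I_(1 + n)).
  apply: (eq_measurable_fun fst) => // s _.
  by apply/esym; apply: etrans; [exact: row_mxEl|exact: mxE].
apply: (eq_measurable_fun
    (fun p : measurableTypeR R * bT R n => p.2 ord0 j : R)) => [s _|].
  by apply/esym; apply: etrans; [exact: row_mxEr|].
exact: (measurableT_comp (measurable_coord j) measurable_snd).
Qed.

Lemma row_mx_bij n (x : 'rV[R]_n.+1) :
  row_mx (\row_(j < 1) x ord0 ord0) (\row_(j < n) x ord0 (lift ord0 j)) = x.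
Proof.
apply/rowP => i.
have [j ->|j ->] := split_ordP (i : 'I_(1 + n)).
  by rewrite row_mxEl mxE; congr (x _ _); apply/val_inj; rewrite (ord1 j).
by rewrite row_mxEr mxE; congr (x _ _); apply/val_inj.
Qed.

Lemma row_mx_ord0 n (t : R) (v : 'rV[R]_n) :
  (row_mx (\row_(j < 1) t) v : 'rV[R]_n.+1) ord0 ord0 = t.
Proof.
transitivity (row_mx (\row_(j < 1) t) v ord0 (lshift n ord0)).
  by congr (fun_of_matrix _ _ _); exact/val_inj.
by rewrite row_mxEl mxE.
Qed.

Lemma row_mx_lift0 n (t : R) (v : 'rV[R]_n) (j : 'I_n) :
  (row_mx (\row_(j < 1) t) v : 'rV[R]_n.+1) ord0 (lift ord0 j) = v ord0 j.
Proof.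
transitivity (row_mx (\row_(j < 1) t) v ord0 (rshift 1 j)).
  by congr (fun_of_matrix _ _ _); exact/val_inj.
by rewrite row_mxEr.
Qed.

(** [intRn] is a bare iterated integral; to use Fubini, Fatou and dominated convergence it must come
    from a measure. By induction, the product of Lebesgue measure on the line with the measure in
    dimension n is pushed forward along the gluing of coordinates, starting from the Dirac mass on
    the one-point space. Sigma-finiteness is carried along because Tonelli needs it at the next
    step. *)
Lemma lebesgue_Rn_exists n :
  exists mu : {sigma_finite_measure set (bT R n) -> \bar R},
  forall F : bT R n -> \bar R, measurable_fun setT F -> (forall x, 0 <= F x)%E ->
    intRn F = (\int[mu]_x F x)%E.
Proof.
elim: n => [|n [mu IH]].
  exists (@dirac _ (bT R 0) 0 R) => F mF F0 /=.
  by rewrite integral_dirac // diracT mul1e.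
pose phi : measurableTypeR R * bT R n -> bT R n.+1 :=
  fun p => row_mx (\row_(j < 1) p.1) p.2 : 'rV[R]_n.+1.
have mphi : measurable_fun setT phi := @measurable_row_mx n.
pose m := ((@lebesgue_measure R) \x mu)%E.
pose m0 : {measure set (bT R n.+1) -> \bar R} := pushforward m phi.
pose m1 := m0 mphi.
pose psi : bT R n.+1 -> measurableTypeR R * bT R n :=
  fun x => (x ord0 ord0, \row_(j < n) x ord0 (lift ord0 j) : 'rV[R]_n).
have mpsi : measurable_fun setT psi.
  apply: measurable_fun_pair; first exact: measurable_coord.
  apply: measurable_rV => i.
  apply: (eq_measurable_fun (fun x : bT R n.+1 => x ord0 (lift ord0 i) : R)).
    by move=> x _; rewrite mxE.
  exact: measurable_coord.
have psiK p : psi (phi p) = p.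
  case: p => t v; rewrite /psi /phi /= row_mx_ord0; congr pair.
  by apply/matrixP => i j; rewrite mxE row_mx_lift0 (ord1 i).
have sf : sigma_finite setT m1.
  have [F TF Foo] : sigma_finite setT m by exact: sigma_finite_prod.
  exists (fun k => psi @^-1` (F k)).
    by rewrite -preimage_bigcup -TF preimage_setT.
  move=> k; have [mF Fk] := Foo k; split.
    by rewrite -[X in measurable X]setTI; exact: mpsi.
  rewrite /m1 /m0 /= /pushforward (_ : _ @^-1` _ = F k) //.
  by apply/seteqP; split=> p /=; rewrite psiK.
(* The pushforward is so far a mere measure; the fact [sf] is packed with it to form the structure
   demanded by the existential. *)
pose H2 := isSFinite.Build _ _ _ _ (sfinite_measure_sigma_finite sf).
pose H3 := isSigmaFinite.Build _ _ _ _ sf.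
pose m2 := HB.pack_for (SigmaFiniteMeasure.type (bT R n.+1) R)
  (Measure.sort m1) H2 H3.
exists m2 => F mF F0.
transitivity (\int[pushforward m phi]_x F x)%E; last by [].
rewrite ge0_integral_pushforward // preimage_setT fubini_tonelli1 //=; last first.
  exact: measurableT_comp.
apply: eq_integral => t _; rewrite IH //.
exact: (measurableT_comp mF (measurableT_comp mphi (pair1_measurable _))).
Qed.

(** Lebesgue measure in dimension n, accessible only through its characterisation [intRnE]. *)
Definition leb n := projT1 (cid (lebesgue_Rn_exists n)).

Lemma intRnE n (F : bT R n -> \bar R) :
  measurable_fun setT F -> (forall x, 0 <= F x)%E ->
  intRn F = (\int[leb n]_x F x)%E.
Proof. exact: (projT2 (cid (lebesgue_Rn_exists n))). Qed.

(** Uniqueness of Lebesgue measure: its image under [phi], divided by [c], has the right value on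
    half-open intervals, hence equals it. Translations, the reflection and dilations are
    instances. *)
Lemma lebesgue_pushforward (phi : R -> R) (c : R) :
  0 < c -> measurable_fun setT phi ->
  (forall a b : R, a < b ->
    lebesgue_measure (phi @^-1` `]a, b]%classic) = (c * (b - a))%:E) ->
  forall F : R -> \bar R, measurable_fun setT F -> (forall x, 0 <= F x)%E ->
  (\int[@lebesgue_measure R]_x F (phi x) =
   c%:E * \int[@lebesgue_measure R]_x F x)%E.
Proof.
move=> c0 mphi phiE F mF F0.
have ci0 : 0 <= c^-1 by rewrite invr_ge0 ltW.
pose push0 : {measure set (measurableTypeR R) -> \bar R} :=
  pushforward (@lebesgue_measure R) (phi : measurableTypeR R -> measurableTypeR R).
pose push := push0 mphi.
pose m : {measure set (measurableTypeR R) -> \bar R} := mscale (NngNum ci0) push.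
have mE A : measurable A -> lebesgue_measure A = m A.
  apply: lebesgue_measure_unique => X [[a b] _ <-] /=.
  rewrite /m /mscale /= /pushforward lebesgue_measure_itv /=.
  case: ifPn; rewrite lte_fin => ab.
    by rewrite phiE // -EFinM mulrA mulVf ?gt_eqF // mul1r.
  rewrite (_ : [set` _] = set0) ?preimage_set0 ?measure0 ?mule0 //.
  by rewrite set_itv_ge // bnd_simp.
transitivity (c%:E * \int[m]_x F x)%E; last first.
  by congr *%E; apply: eq_measure_integral => A mA _; exact/esym/mE.
rewrite ge0_integral_mscale //= muleA -EFinM divff ?gt_eqF // mul1e.
by rewrite ge0_integral_pushforward // preimage_setT.
Qed.

Lemma lebesgue_shift (F : R -> \bar R) (a : R) :
  measurable_fun setT F -> (forall x, 0 <= F x)%E ->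
  (\int[@lebesgue_measure R]_x F (x + a)%R = \int[@lebesgue_measure R]_x F x)%E.
Proof.
move=> mF F0; rewrite (@lebesgue_pushforward (fun x => x + a) 1) ?mul1e //.
  exact: measurable_funD.
move=> b c bc; rewrite (_ : _ @^-1` _ = `]b - a, c - a]%classic).
  rewrite lebesgue_measure_itv /= lte_fin ltrD2r bc -EFinD; congr EFin; ring.
by apply/seteqP; split=> x /=; rewrite !in_itv /= => /andP[? ?];
  apply/andP; split; lra.
Qed.

Lemma lebesgue_opp (F : R -> \bar R) :
  measurable_fun setT F -> (forall x, 0 <= F x)%E ->
  (\int[@lebesgue_measure R]_x F (- x)%R = \int[@lebesgue_measure R]_x F x)%E.
Proof.
move=> mF F0; rewrite (@lebesgue_pushforward (fun x => - x) 1) ?mul1e //.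
  exact: measurableT_comp.
move=> b c bc; rewrite (_ : _ @^-1` _ = `[- c, - b[%classic).
  rewrite lebesgue_measure_itv /= lte_fin ltrN2 bc -EFinD; congr EFin; ring.
by apply/seteqP; split=> x /=; rewrite !in_itv /= => /andP[? ?];
  apply/andP; split; lra.
Qed.

Lemma lebesgue_scale (F : R -> \bar R) (a : R) : 0 < a ->
  measurable_fun setT F -> (forall x, 0 <= F x)%E ->
  (\int[@lebesgue_measure R]_x F (a * x)%R =
   (a^-1)%:E * \int[@lebesgue_measure R]_x F x)%E.
Proof.
move=> a0 mF F0; rewrite (@lebesgue_pushforward (fun x => a * x) a^-1) ?invr_gt0 //.
  exact: measurable_funM.
move=> b c bc; rewrite (_ : _ @^-1` _ = `]b / a, c / a]%classic).
  rewrite lebesgue_measure_itv /= lte_fin ltr_pM2r ?invr_gt0 // bc -EFinD.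
  by congr EFin; ring.
by apply/seteqP; split=> x /=; rewrite !in_itv /= ltr_pdivrMr // ler_pdivlMr //
  [x * a]mulrC.
Qed.

Definition emb n (t : R) (v : 'rV[R]_n) : 'rV[R]_n.+1 := row_mx (\row_(j < 1) t) v.

Lemma measurable_emb n t : measurable_fun setT (emb t : bT R n -> bT R n.+1).
Proof.
exact: (measurableT_comp (@measurable_row_mx n) (pair1_measurable t)).
Qed.

Lemma intRnS n (F : 'rV[R]_n.+1 -> \bar R) :
  intRn F = (\int[@lebesgue_measure R]_t intRn (fun v => F (emb t v)))%E.
Proof. by []. Qed.

Lemma intRn_eq n (F G : 'rV[R]_n -> \bar R) : F =1 G -> intRn F = intRn G.
Proof. by move=> FG; congr intRn; exact/funext. Qed.

Lemma intRn_ge0 n (F : 'rV[R]_n -> \bar R) :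
  (forall x, 0 <= F x)%E -> (0 <= intRn F)%E.
Proof.
by elim: n F => [|n IH] F F0 //=; apply: integral_ge0 => t _; exact: IH.
Qed.

Lemma measurable_intRn n (F : bT R n.+1 -> \bar R) :
  measurable_fun setT F -> (forall x, 0 <= F x)%E ->
  measurable_fun setT (fun t : R => intRn (fun v : 'rV[R]_n => F (emb t v))).
Proof.
move=> mF F0.
rewrite (_ : (fun _ => _) =
    (fun t => \int[leb n]_v F (emb t v))%E); last first.
  apply/funext => t; rewrite intRnE //.
  exact: (measurableT_comp mF (measurable_emb t)).
apply: (@measurable_fun_fubini_tonelli_F _ _ (measurableTypeR R) (bT R n) R
  (leb n) (fun p => F (emb p.1 p.2))) => //.
exact: (measurableT_comp mF (@measurable_row_mx n)).
Qed.

Lemma measurable_addr n (a : 'rV[R]_n) :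
  measurable_fun setT ((fun x => x + a) : bT R n -> bT R n).
Proof.
apply: measurable_rV => i.
apply: (eq_measurable_fun (fun x : bT R n => x ord0 i + a ord0 i : R)).
  by move=> x _; rewrite mxE.
by apply: measurable_funD => //; exact: measurable_coord.
Qed.

Lemma measurable_scale n (c : R) :
  measurable_fun setT ((fun x => c *: x) : bT R n -> bT R n).
Proof.
apply: measurable_rV => i.
apply: (eq_measurable_fun (fun x : bT R n => c * x ord0 i : R)).
  by move=> x _; rewrite mxE.
by apply: measurable_funM => //; exact: measurable_coord.
Qed.

Lemma embD n s t (v w : 'rV[R]_n) : emb s v + emb t w = emb (s + t) (v + w).
Proof.
apply/rowP => i; case: (unliftP ord0 i) => [j|] ->.
  by rewrite [LHS]mxE /emb !row_mx_lift0 mxE.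
by rewrite [LHS]mxE /emb !row_mx_ord0.
Qed.

Lemma embZ n c t (v : 'rV[R]_n) : c *: emb t v = emb (c * t) (c *: v).
Proof.
apply/rowP => i; case: (unliftP ord0 i) => [j|] ->.
  by rewrite [LHS]mxE /emb !row_mx_lift0 mxE.
by rewrite [LHS]mxE /emb !row_mx_ord0.
Qed.

Lemma emb_eta n (x : 'rV[R]_n.+1) :
  x = emb (x ord0 ord0) (\row_(j < n) x ord0 (lift ord0 j)).
Proof. by rewrite /emb row_mx_bij. Qed.

Lemma intRn_shift n (F : bT R n -> \bar R) (a : 'rV[R]_n) :
  measurable_fun setT F -> (forall x, 0 <= F x)%E ->
  intRn (fun x => F (x + a)) = intRn F.
Proof.
elim: n F a => [|n IH] F a mF F0.
  by rewrite /= (_ : 0 + a = 0) //; apply/rowP => -[].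
rewrite !intRnS (emb_eta a); move: (a ord0 ord0) (\row__ _) => s v.
transitivity (\int[@lebesgue_measure R]_t
    (fun t => intRn (fun w : 'rV[R]_n => F (emb t w))) (t + s)%R)%E.
  apply: eq_integral => t _ /=.
  rewrite -(IH (fun w => F (emb (t + s) w)) v) //; last first.
    exact: (measurableT_comp mF (measurable_emb _)).
  by apply: intRn_eq => w; rewrite embD.
apply: (@lebesgue_shift (fun t => intRn (fun w : 'rV[R]_n => F (emb t w))) s) => [|t]; first exact: measurable_intRn.
exact: intRn_ge0.
Qed.

Lemma intRn_opp n (F : bT R n -> \bar R) :
  measurable_fun setT F -> (forall x, 0 <= F x)%E ->
  intRn (fun x => F (- x)) = intRn F.
Proof.
elim: n F => [|n IH] F mF F0.
  by rewrite /= oppr0.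
rewrite !intRnS.
transitivity (\int[@lebesgue_measure R]_t
    (fun t => intRn (fun w : 'rV[R]_n => F (emb t w))) (- t)%R)%E.
  apply: eq_integral => t _ /=.
  rewrite -(IH (fun w => F (emb (- t) w))) //; last first.
    exact: (measurableT_comp mF (measurable_emb _)).
  by apply: intRn_eq => w; rewrite -scaleN1r embZ scaleN1r mulN1r.
apply: (@lebesgue_opp (fun t => intRn (fun w : 'rV[R]_n => F (emb t w)))) => [|t]; first exact: measurable_intRn.
exact: intRn_ge0.
Qed.

Lemma intRn_scale n (F : bT R n -> \bar R) (c : R) : 0 < c ->
  measurable_fun setT F -> (forall x, 0 <= F x)%E ->
  intRn (fun x => F (c *: x)) = ((c^-1 ^+ n)%:E * intRn F)%E.
Proof.
move=> c0; have ci : 0 <= c^-1 by rewrite invr_ge0 ltW.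
elim: n F => [|n IH] F mF F0.
  by rewrite /= scaler0 expr0 mul1e.
rewrite !intRnS.
transitivity (\int[@lebesgue_measure R]_t ((c^-1 ^+ n)%:E *
    (fun t => intRn (fun w : 'rV[R]_n => F (emb t w))) (c * t)%R))%E.
  apply: eq_integral => t _ /=.
  rewrite -(IH (fun w => F (emb (c * t) w))) //; last first.
    exact: (measurableT_comp mF (measurable_emb _)).
  by apply: intRn_eq => w; rewrite embZ.
rewrite ge0_integralZl_EFin ?exprn_ge0 //; last 2 first.
- by move=> t _; exact: intRn_ge0.
- apply: (measurableT_comp (measurable_intRn mF F0)).
  exact: measurable_funM.
rewrite (@lebesgue_scale (fun t => intRn (fun w : 'rV[R]_n => F (emb t w))) c c0) //.
- by rewrite muleA -EFinM -exprSr.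
- exact: measurable_intRn.
- by move=> t; exact: intRn_ge0.
Qed.

End BorelRn.

(** * Calculus of the real-valued integral *)

Section Integral.
Variables (R : realType) (n : nat).
Local Notation V := 'rV[R]_n.
Implicit Types (f g h : V -> R) (F : V -> V -> R).

Definition mf f := measurable_fun setT (f : bT R n -> R).
Definition mf2 F :=
  measurable_fun setT (fun p : (bT R n * bT R n)%type => F p.1 p.2).
Definition ig f := (leb R n).-integrable setT (fun x => (f x)%:E).
Definition RI f : R := Rintegral (leb R n) setT f.

Lemma ig_mf f : ig f -> mf f.
Proof. by move=> /measurable_int /measurable_EFinP. Qed.

Lemma mf_shift f a : mf f -> mf (fun x => f (x + a)).
Proof. by move=> h; exact: (measurableT_comp h (measurable_addr a)). Qed.

Lemma ig_le f g : mf f -> ig g -> (forall x, `|f x| <= g x) -> ig f.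
Proof.
move=> f1 g1 fg; apply: (le_integrable measurableT _ _ g1).
  exact/measurable_EFinP.
by move=> x _ /=; rewrite lee_fin (le_trans (fg x)) // ler_norm.
Qed.

Lemma ig0 : ig (fun=> 0).
Proof. exact: integrable0. Qed.

Lemma eq_ig f g : f =1 g -> ig f -> ig g.
Proof. by move=> /funext ->. Qed.

Lemma eq_RI f g : f =1 g -> RI f = RI g.
Proof. by move=> /funext ->. Qed.

Lemma igD f g : ig f -> ig g -> ig (fun x => f x + g x).
Proof. by move=> f1 g1; exact: (integrableD measurableT f1 g1). Qed.

Lemma igZ c f : ig f -> ig (fun x => c * f x).
Proof. by move=> f1; exact: (integrableZl measurableT c f1). Qed.

Lemma igN f : ig f -> ig (fun x => - f x).
Proof. by move=> /(igZ (-1)); apply: eq_ig => x; rewrite mulN1r. Qed.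

Lemma igB f g : ig f -> ig g -> ig (fun x => f x - g x).
Proof. by move=> f1 /igN; exact: igD. Qed.

Lemma ig_abs f : ig f -> ig (fun x => `|f x|).
Proof. exact: integrable_norm. Qed.

Lemma RID f g : ig f -> ig g -> RI (fun x => f x + g x) = RI f + RI g.
Proof. by move=> f1 g1; exact: RintegralD. Qed.

Lemma RIZ c f : ig f -> RI (fun x => c * f x) = c * RI f.
Proof. by move=> f1; exact: RintegralZl. Qed.

Lemma RIN f : ig f -> RI (fun x => - f x) = - RI f.
Proof.
by move=> /(RIZ (-1)); rewrite mulN1r => <-; apply: eq_RI => x; rewrite mulN1r.
Qed.

Lemma RIB f g : ig f -> ig g -> RI (fun x => f x - g x) = RI f - RI g.
Proof. by move=> f1 g1; exact: RintegralB. Qed.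

Lemma RI0 : RI (fun=> 0) = 0.
Proof. by rewrite /RI Rintegral_cst // mul0r. Qed.

Lemma RI_ge0 f : (forall x, 0 <= f x) -> 0 <= RI f.
Proof. by move=> f0; apply: Rintegral_ge0 => x _; exact: f0. Qed.

Lemma RI_le f g : ig f -> ig g -> (forall x, f x <= g x) -> RI f <= RI g.
Proof. by move=> f1 g1 fg; apply: le_Rintegral. Qed.

Lemma RI_abs f : ig f -> `|RI f| <= RI (fun x => `|f x|).
Proof. by move=> f1; exact: le_normr_Rintegral. Qed.

Lemma RI_absle f g : ig f -> ig g -> (forall x, `|f x| <= g x) -> `|RI f| <= RI g.
Proof.
by move=> f1 g1 fg; apply: le_trans (RI_abs f1) _; apply: RI_le => //; exact: ig_abs.
Qed.

Lemma EFin_RI f : ig f -> (RI f)%:E = (\int[leb R n]_x (f x)%:E)%E.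
Proof. by move=> f1; rewrite /RI /Rintegral fineK //; exact: integrable_fin_num. Qed.

Lemma igP f : mf f -> (\int[leb R n]_x `|f x|%:E < +oo)%E -> ig f.
Proof. by move=> f1 foo; apply/integrableP; split; [exact/measurable_EFinP|]. Qed.

Lemma ig_intRn f : mf f -> (forall x, 0 <= f x) ->
  (intRn (fun x => (f x)%:E) < +oo)%E -> ig f.
Proof.
move=> f1 f0; rewrite intRnE.
- move=> h; apply: igP => //.
  by under eq_integral => x _ do rewrite ger0_norm //.
- exact/measurable_EFinP.
- by move=> x; rewrite lee_fin.
Qed.

Lemma intRn_RI f : ig f -> (forall x, 0 <= f x) ->
  intRn (fun x => (f x)%:E) = (RI f)%:E.
Proof.
by move=> f1 f0; rewrite EFin_RI // intRnE //; exact: measurable_int f1.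
Qed.

Lemma Rint_RI f : ig f -> Defs.Rint f = RI f.
Proof.
move=> f1; have m1 := ig_mf f1.
have mp : mf (fun x => Num.max (f x) 0) by apply: measurable_maxr.
have mn : mf (fun x => Num.max (- f x) 0).
  by apply: measurable_maxr => //; exact: measurableT_comp.
have ip : ig (fun x => Num.max (f x) 0).
  by apply: ig_le mp (ig_abs f1) _ => x;
    rewrite ger0_norm ?le_max ?lexx ?orbT // ge_max ler_norm normr_ge0.
have in_ : ig (fun x => Num.max (- f x) 0).
  by apply: ig_le mn (ig_abs f1) _ => x;
    rewrite ger0_norm ?le_max ?lexx ?orbT // ge_max -normrN ler_norm normr_ge0.
rewrite /Defs.Rint !intRn_RI //= -?RIB // => [|x|x]; rewrite ?le_max ?lexx ?orbT //.
apply: eq_RI => x; have [h|h] := leP 0 (f x).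
  by rewrite (max_idPr _) ?oppr_le0 // subr0.
by rewrite (max_idPl _) ?oppr_ge0 ?ltW // sub0r opprK.
Qed.

Lemma measurable_normE f : mf f ->
  measurable_fun setT ((fun x => `|f x|%:E) : bT R n -> \bar R).
Proof. by move=> f1; apply/measurable_EFinP; exact: measurableT_comp. Qed.

(** Lifts a change of variables with constant Jacobian from nonnegative to signed functions: the
    absolute value gives integrability, the positive and negative parts give the identity. *)
Lemma RI_change (phi : V -> V) (c : R) : 0 <= c ->
  measurable_fun setT (phi : bT R n -> bT R n) ->
  (forall G : bT R n -> \bar R, measurable_fun setT G ->
    (forall x, 0 <= G x)%E -> intRn (fun x => G (phi x)) = (c%:E * intRn G)%E) ->
  forall f, ig f -> ig (fun x => f (phi x)) /\ RI (fun x => f (phi x)) = c * RI f.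
Proof.
move=> c0 mphi H f f1; have m1 := ig_mf f1.
have mphi' g : mf g -> mf (fun x => g (phi x)).
  by move=> mg; exact: (measurableT_comp mg mphi).
have i1 : ig (fun x => f (phi x)).
  apply: igP; first exact: mphi'.
  rewrite -(@intRnE _ _ (fun x => `|f (phi x)|%:E)) //; last first.
    by apply: measurable_normE; exact: mphi'.
  rewrite (H (fun x => `|f x|%:E)) //; last exact: measurable_normE.
  rewrite intRnE //; last exact: measurable_normE.
  apply: lte_mul_pinfty => //.
  by move: f1 => /integrableP[].
split => //; rewrite -!Rint_RI // /Defs.Rint.
have mp : mf (fun x => Num.max (f x) 0) by apply: measurable_maxr.
have mn : mf (fun x => Num.max (- f x) 0).
  by apply: measurable_maxr => //; exact: measurableT_comp.
rewrite (H (fun x => (Num.max (f x) 0)%:E)) //; last 2 first.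
- exact/measurable_EFinP.
- by move=> x; rewrite lee_fin le_max lexx orbT.
rewrite (H (fun x => (Num.max (- f x) 0)%:E)) //; last 2 first.
- exact/measurable_EFinP.
- by move=> x; rewrite lee_fin le_max lexx orbT.
(* [fine] sends infinite values to 0, so it commutes with the factor [c] without any finiteness
   assumption. *)
have fm (z : \bar R) : fine (c%:E * z)%E = c * fine z.
  have [->|c1] := eqVneq c 0; first by rewrite mul0e mul0r.
  have cp : 0 < c by rewrite lt_def c1.
  case: z => [z||] //=; rewrite ?mulr0.
    by rewrite gt0_muley ?lte_fin.
  by rewrite gt0_muleNy ?lte_fin.
by rewrite !fm mulrBr.
Qed.

Lemma ig_shift f (a : V) : ig f -> ig (fun x => f (x + a)).
Proof.
move=> f1; apply: (RI_change ler01 (measurable_addr a) _ f1).1 => G mG G0.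
by rewrite mul1e intRn_shift.
Qed.

Lemma RI_shift f (a : V) : ig f -> RI (fun x => f (x + a)) = RI f.
Proof.
move=> f1; rewrite (RI_change ler01 (measurable_addr a) _ f1).2 ?mul1r // => G mG G0.
by rewrite mul1e intRn_shift.
Qed.

Lemma measurable_oppV : measurable_fun setT ((fun x : V => - x) : bT R n -> bT R n).
Proof.
apply: measurable_rV => i.
apply: (eq_measurable_fun (fun x : bT R n => - x ord0 i : R)).
  by move=> x _; rewrite mxE.
by apply: measurableT_comp => //; exact: measurable_coord.
Qed.

Lemma ig_opp f : ig f -> ig (fun x => f (- x)).
Proof.
move=> f1; apply: (RI_change ler01 measurable_oppV _ f1).1 => G mG G0.
by rewrite mul1e intRn_opp.
Qed.

Lemma RI_opp f : ig f -> RI (fun x => f (- x)) = RI f.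
Proof.
move=> f1; rewrite (RI_change ler01 measurable_oppV _ f1).2 ?mul1r // => G mG G0.
by rewrite mul1e intRn_opp.
Qed.

Lemma ig_scale f c : 0 < c -> ig f -> ig (fun x => f (c *: x)).
Proof.
move=> c0 f1; have ci : 0 <= c^-1 ^+ n by rewrite exprn_ge0 // invr_ge0 ltW.
apply: (RI_change ci (measurable_scale c) _ f1).1 => G mG G0.
by rewrite intRn_scale.
Qed.

Lemma RI_scale f c : 0 < c -> ig f -> RI (fun x => f (c *: x)) = c^-1 ^+ n * RI f.
Proof.
move=> c0 f1; have ci : 0 <= c^-1 ^+ n by rewrite exprn_ge0 // invr_ge0 ltW.
apply: (RI_change ci (measurable_scale c) _ f1).2 => G mG G0.
by rewrite intRn_scale.
Qed.

Lemma ig_reflect f (a : V) : ig f -> ig (fun x => f (a - x)).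
Proof.
by move=> /(ig_shift a) /ig_opp; apply: eq_ig => x; rewrite addrC.
Qed.

Lemma RI_reflect f (a : V) : ig f -> RI (fun x => f (a - x)) = RI f.
Proof.
move=> f1; rewrite -(RI_shift a f1) -(RI_opp (ig_shift a f1)).
by apply: eq_RI => x; rewrite addrC.
Qed.

Lemma mf2_sect F x : mf2 F -> mf (F x).
Proof.
by move=> mF; exact: (measurableT_comp mF (pair1_measurable (x : bT R n))).
Qed.

Lemma mf2_swap F : mf2 F -> mf2 (fun x y => F y x).
Proof. by move=> mF; exact: (measurableT_comp mF (@measurable_swap _ _ _ _)). Qed.

Lemma mf_RI F : mf2 F -> mf (fun x => RI (F x)).
Proof.
move=> mF.
have mF' : measurable_fun setT (fun p : (bT R n * bT R n)%type => (F p.1 p.2)%:E).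
  exact/measurable_EFinP.
suff : measurable_fun setT ((fun x => (\int[leb R n]_y (F x y)%:E)%E) : bT R n -> _).
  by move=> h; exact: (measurableT_comp (fine_measurable measurableT) h).
rewrite (_ : (fun x => _) = (fun x =>
  (\int[leb R n]_y (fun p : (bT R n * bT R n)%type => (F p.1 p.2)%:E)^\+%E (x, y)) -
  (\int[leb R n]_y (fun p : (bT R n * bT R n)%type => (F p.1 p.2)%:E)^\-%E (x, y))))%E.
  apply: emeasurable_funB.
    apply: measurable_fun_fubini_tonelli_F; first exact: measurable_funepos.
    by move=> p; exact: funepos_ge0.
  apply: measurable_fun_fubini_tonelli_F; first exact: measurable_funeneg.
  by move=> p; exact: funeneg_ge0.
apply/funext => x; rewrite [LHS]integralE; congr (_ - _)%E.
  by apply: eq_integral => y _; rewrite !funeposE.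
by apply: eq_integral => y _; rewrite !funenegE.
Qed.

(** Integrability on the product is replaced by an integrable majorant [g] of the inner absolute
    integrals, which is the form in which the kernel estimates produce it. Nothing is assumed of the
    sections in the other variable. *)
Lemma Fubini_RI F g : mf2 F -> (forall x, ig (F x)) ->
  (forall x, RI (fun y => `|F x y|) <= g x) -> ig g ->
  [/\ ig (fun x => RI (F x)), ig (fun y => RI (fun x => F x y)) &
      RI (fun x => RI (F x)) = RI (fun y => RI (fun x => F x y))].
Proof.
move=> mF iF Fg ig_.
pose f := fun p : (bT R n * bT R n)%type => (F p.1 p.2)%:E.
have mF' : measurable_fun setT f by exact/measurable_EFinP.
have fi : (leb R n \x leb R n)%E.-integrable setT f.
  apply/integrable12ltyP => //.
  have mabs : mf (fun x => RI (fun y => `|F x y|)).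
    by apply: mf_RI; exact: measurableT_comp.
  have ia : ig (fun x => RI (fun y => `|F x y|)).
    by apply: ig_le mabs ig_ _ => x; rewrite ger0_norm ?RI_ge0.
  under eq_integral => x _ do rewrite -(EFin_RI (ig_abs (iF x))).
  by rewrite -EFin_RI // ltry.
have E1 x : (\int[leb R n]_y f (x, y) = (RI (F x))%:E)%E by rewrite EFin_RI.
have i1 : ig (fun x => RI (F x)).
  have := integrable_fubini_F fi; rewrite /ig; congr (_.-integrable _ _).
  by apply/funext => x; rewrite -E1.

pose f' := fun p : (bT R n * bT R n)%type => (F p.2 p.1)%:E.
have mf' : measurable_fun setT f' by apply/measurable_EFinP; exact: mf2_swap.
have fi' : (leb R n \x leb R n)%E.-integrable setT f'.
  have h : (\int[leb R n]_x \int[leb R n]_y `|f (x, y)| < +oo)%E.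
    by apply/integrable12ltyP.
  apply/integrable12ltyP; first exact: mf'.
  have := @fubini_tonelli _ _ _ _ R (leb R n) (leb R n) (fun p => `|f p|)%E.
  by move=> <- //; exact: measurableT_comp.
have i2' := integrable_fubini_F fi'.
have le_fine (z : \bar R) : (`|(fine z)%:E| <= `|z|)%E.
  by case: z => [r||] //=; rewrite normr0 leey.
have i2 : ig (fun y => RI (fun x => F x y)).
  apply: (le_integrable measurableT _ _ i2').
    by apply/measurable_EFinP; exact: (mf_RI (mf2_swap mF)).
  by move=> y _; exact: le_fine.
split; [exact: i1|exact: i2|].
transitivity (fine (\int[leb R n]_x \int[leb R n]_y f (x, y))%E).
  by rewrite /RI /Rintegral; congr fine; apply: eq_integral => x _; rewrite E1.
rewrite (Fubini fi) [RHS]/RI /Rintegral.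
(* The integrals over the other sections are finite only almost everywhere; elsewhere [fine]
   replaces them by 0, so the two integrands agree up to a null set. *)
congr fine; apply: ae_eq_integral; first exact: measurableT.
- exact: measurable_int i2'.
- exact: measurable_int i2.
have := integrable_ae measurableT i2'; apply: filterS => y /(_ Logic.I) h _.
by rewrite /RI /Rintegral fineK.
Qed.

Lemma RI_fatou (f_ : nat -> V -> R) f B : (forall k, ig (f_ k)) ->
  (forall k x, 0 <= f_ k x) -> (forall x, f_ ^~ x @ \oo --> f x) ->
  (forall k, RI (f_ k) <= B) -> ig f /\ RI f <= B.
Proof.
move=> fi f0 fc fB.
have f_0 x : 0 <= f x.
  rewrite -(cvg_lim _ (fc x)) //; apply: limr_ge; last exact: nearW.
  by apply/cvg_ex; exists (f x); exact: fc.
have mf_ : mf f.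
  apply: (@measurable_fun_cvg _ (bT R n) R setT f_) => [k|x _]; last exact: fc.
  exact: ig_mf.
have h : (\int[leb R n]_x (f x)%:E <= B%:E)%E.
  have := fatou (leb R n) measurableT (f := fun k x => (f_ k x)%:E).
  have -> : (fun x : bT R n => limn_einf (fun k => (f_ k x)%:E)) = (fun x => (f x)%:E).
    apply/funext => x.
    have h : (f_ k x)%:E @[k --> \oo] --> (f x)%:E.
      by apply/fine_cvgP; split; [exact: nearW|exact: fc].
    by rewrite is_cvg_limn_einfE ?(cvg_lim _ h) //; apply/cvg_ex; exists (f x)%:E.
  move=> h; apply: le_trans (h _ _) _.
  - by move=> k; exact: measurable_int (fi k).
  - by move=> k x _; rewrite lee_fin.
  rewrite limn_einf_lim; apply: lime_le; first exact: is_cvg_einfs.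
  apply: nearW => k; apply: (le_trans (y := (RI (f_ k))%:E)); last by rewrite lee_fin.
  by apply: ereal_inf_lbound; exists k => //=; rewrite EFin_RI.
have fi' : ig f.
  apply: igP => //; apply: le_lt_trans (ltry B).
  by under eq_integral => x _ do rewrite ger0_norm //.
by split => //; rewrite -lee_fin EFin_RI.
Qed.

Lemma RI_CS f g : mf f -> mf g -> ig (fun x => f x ^+ 2) -> ig (fun x => g x ^+ 2) ->
  ig (fun x => f x * g x) /\
  (RI (fun x => f x * g x)) ^+ 2 <= RI (fun x => f x ^+ 2) * RI (fun x => g x ^+ 2).
Proof.
move=> mf_ mg f2 g2.
have fg : ig (fun x => f x * g x).
  apply: (@ig_le _ (fun x => f x ^+ 2 + g x ^+ 2)); last 2 first.
  - exact: igD.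
  - move=> x; rewrite normrM; have := sqr_ge0 (`|f x| - `|g x|).
    rewrite -(real_normK (num_real (f x))) -(real_normK (num_real (g x))).
    have := normr_ge0 (f x); have := normr_ge0 (g x).
    move: `|f x| `|g x| => a b; nra.
  exact: measurable_funM.
split => //; set A := RI _; set B := RI (fun x => f x ^+ 2); set C := RI _.
have A0 : 0 <= B by apply: RI_ge0 => x; exact: sqr_ge0.
have C0 : 0 <= C by apply: RI_ge0 => x; exact: sqr_ge0.
have H (t : R) : 0 <= t ^+ 2 * B + 2 * t * A + C.
  have -> : t ^+ 2 * B + 2 * t * A + C =
      RI (fun x => (t * f x + g x) ^+ 2).
    rewrite -(RIZ _ f2) -(RIZ _ fg) -RID; try exact: igZ.
    rewrite -RID //; last by apply: igD; exact: igZ.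
    by apply: eq_RI => x; ring.
  by apply: RI_ge0 => x; exact: sqr_ge0.
have [B0|B0] := eqVneq B 0.
  (* If [B] is 0 the polynomial in t is affine, and this t gives it the value -1 unless [A] is 0. *)
  have H1 := H (- (C + 1) / (2 * A)); have [->|A1] := eqVneq A 0.
    by rewrite expr0n /= B0 mul0r.
  by move: H1; rewrite B0 mulr0 add0r (_ : 2 * _ * A = - (C + 1)); [lra|field].
have Bp : 0 < B by rewrite lt_def B0.
have := H (- A / B); rewrite (_ : _ + C = C - A ^+ 2 / B); last by field.
by rewrite subr_ge0 ler_pdivrMr // mulrC.
Qed.

End Integral.

(** * Measurability of composite expressions *)

Section MeasTac.
Context {R : realType} {n : nat} {d : measure_display} {S : measurableType d}.
Local Notation V := 'rV[R]_n.

Lemma mm_comp (w : V -> R) (g : S -> V) : mf w ->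
  measurable_fun setT (g : S -> bT R n) -> measurable_fun setT (fun s => w (g s)).
Proof. by move=> mw mg; exact: (measurableT_comp mw mg). Qed.

Lemma mm_comp2 (F : V -> V -> R) (g h : S -> V) : mf2 F ->
  measurable_fun setT (g : S -> bT R n) -> measurable_fun setT (h : S -> bT R n) ->
  measurable_fun setT (fun s => F (g s) (h s)).
Proof.
by move=> mF mg mh; exact: (measurableT_comp mF (measurable_fun_pair mg mh)).
Qed.

Lemma mm_addV (g h : S -> V) :
  measurable_fun setT (g : S -> bT R n) -> measurable_fun setT (h : S -> bT R n) ->
  measurable_fun setT ((fun s => g s + h s) : S -> bT R n).
Proof.
move=> mg mh; apply: measurable_rV => i.
apply: (eq_measurable_fun (fun s => g s ord0 i + h s ord0 i : R)).
  by move=> x _; rewrite mxE.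
apply: measurable_funD; first exact: (measurableT_comp (measurable_coord i) mg).
exact: (measurableT_comp (measurable_coord i) mh).
Qed.

Lemma mm_scaleV c (g : S -> V) :
  measurable_fun setT (g : S -> bT R n) ->
  measurable_fun setT ((fun s => c *: g s) : S -> bT R n).
Proof. by move=> mg; exact: (measurableT_comp (measurable_scale c) mg). Qed.

Lemma mm_oppV (g : S -> V) :
  measurable_fun setT (g : S -> bT R n) ->
  measurable_fun setT ((fun s => - g s) : S -> bT R n).
Proof. by move=> mg; exact: (measurableT_comp (@measurable_oppV R n) mg). Qed.

Lemma mm_oppr (f : S -> R) :
  measurable_fun setT f -> measurable_fun setT (fun s => - f s).
Proof. by move=> h; exact: measurableT_comp. Qed.

Lemma mm_normr (f : S -> R) :
  measurable_fun setT f -> measurable_fun setT (fun s => `|f s|).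
Proof. by move=> h; exact: measurableT_comp. Qed.

Lemma mm_powR (f : S -> R) p :
  measurable_fun setT f -> measurable_fun setT (fun s => f s `^ p).
Proof. by move=> h; apply: (measurableT_comp (measurable_powR _) h). Qed.

Lemma mm_bool (f : S -> bool) :
  measurable_fun setT f -> measurable_fun setT (fun s => (f s)%:R : R).
Proof.
move=> mf_; apply: (eq_measurable_fun (fun s : S => if f s then 1 else 0 : R)).
  by move=> x _; case: (f x).
exact: measurable_fun_ifT.
Qed.

Lemma mm_lt (f g : S -> R) : measurable_fun setT f -> measurable_fun setT g ->
  measurable_fun setT (fun s => (f s < g s)%R%:R : R).
Proof. by move=> h1 h2; apply/mm_bool/measurable_fun_ltr. Qed.

Lemma mm_le (f g : S -> R) : measurable_fun setT f -> measurable_fun setT g ->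
  measurable_fun setT (fun s => (f s <= g s)%R%:R : R).
Proof. by move=> h1 h2; apply/mm_bool/measurable_fun_ler. Qed.

End MeasTac.

(** Follows the syntax of the function and closes the leaves with [mf] and [mf2] facts of the
    context; this is why such facts are introduced just before each call of [mm]. *)
Ltac mm1 := lazymatch goal with
  | |- measurable_fun _ (fun p => (@?f p) + (@?g p)) =>
      first [apply: measurable_funD | apply: mm_addV]
  | |- measurable_fun _ (fun p => (@?f p) * (@?g p)) => apply: measurable_funM
  | |- measurable_fun _ (fun p => - (@?f p)) => first [apply: mm_oppr | apply: mm_oppV]
  | |- measurable_fun _ (fun p => (@?f p) ^+ _) => apply: measurable_funX
  | |- measurable_fun _ (fun p => `|@?f p|) => apply: mm_normr
  | |- _ => first
  [ exact: measurable_id | exact: measurable_fst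
  | exact: measurable_snd | assumption | exact: measurable_cst
  | match goal with
    | H : mf ?w |- measurable_fun _ (fun _ => ?w _) => apply: (mm_comp H)
    | H : mf2 ?w |- measurable_fun _ (fun _ => ?w _ _) => apply: (mm_comp2 H)
    end
  | apply: mm_scaleV | apply: measurable_minr | apply: measurable_maxr
  | apply: mm_lt | apply: mm_le | apply: mm_powR ]
  end.
Ltac mm := rewrite /mf2 /mf /=; repeat mm1.

(** * The Euclidean norm *)

Section Enorm.
Variables (R : realType) (n : nat).
Local Notation V := 'rV[R]_n.
Implicit Types (x y : V).

Lemma discr_le (A B C : R) : 0 <= B ->
  (forall t, 0 <= t ^+ 2 * B + 2 * t * A + C) -> A ^+ 2 <= B * C.
Proof.
move=> B_ge0 H; have [B0|B0] := eqVneq B 0.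
  have [->|A1] := eqVneq A 0; first by rewrite expr0n /= B0 mul0r.
  have := H (- (C + 1) / (2 * A)).
  by rewrite B0 mulr0 add0r (_ : 2 * _ * A = - (C + 1)); [lra|field].
have Bp : 0 < B by rewrite lt_def B0.
have := H (- A / B); rewrite (_ : _ + C = C - A ^+ 2 / B); last by field.
by rewrite subr_ge0 ler_pdivrMr // mulrC.
Qed.

Lemma enorm_ge0 x : 0 <= enorm x.
Proof. exact: sqrtr_ge0. Qed.

Lemma enorm_sqr x : enorm x ^+ 2 = \sum_(i < n) x ord0 i ^+ 2.
Proof. by rewrite sqr_sqrtr // sumr_ge0 // => i _; rewrite sqr_ge0. Qed.

Lemma enormZ c x : enorm (c *: x) = `|c| * enorm x.
Proof.
rewrite /enorm -sqrtr_sqr -sqrtrM ?sqr_ge0 // mulr_sumr; congr Num.sqrt.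
by apply: eq_bigr => i _; rewrite mxE exprMn.
Qed.

Lemma enormN x : enorm (- x) = enorm x.
Proof. by rewrite -scaleN1r enormZ normrN1 mul1r. Qed.

Lemma enorm0 : enorm (0 : V) = 0.
Proof. by rewrite -(scale0r 0) enormZ normr0 mul0r. Qed.

Lemma enorm_eq0 x : (enorm x == 0) = (x == 0).
Proof.
apply/eqP/eqP => [|->]; last exact: enorm0.
move=> /(congr1 (fun a => a ^+ 2)); rewrite expr0n /= enorm_sqr => /eqP.
rewrite psumr_eq0 => [/allP h|i _]; last exact: sqr_ge0.
apply/rowP => i; have := h i; rewrite mem_index_enum sqrf_eq0 => /(_ isT) /eqP.
by rewrite mxE.
Qed.

Lemma enorm_gt0 x : (0 < enorm x) = (x != 0).
Proof. by rewrite lt_def enorm_eq0 enorm_ge0 andbT. Qed.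

Definition dot x y := \sum_(i < n) x ord0 i * y ord0 i.

Lemma dot_le x y : `|dot x y| <= enorm x * enorm y.
Proof.
rewrite -(ler_pXn2r (n := 2)) ?nnegrE ?mulr_ge0 ?enorm_ge0 //.
rewrite real_normK ?num_real // exprMn; apply: discr_le; first exact: sqr_ge0.
move=> t; rewrite !enorm_sqr /dot !mulr_sumr -!big_split /=; apply: sumr_ge0 => i _.
rewrite (_ : _ + _ = (t * x ord0 i + y ord0 i) ^+ 2); last by ring.
exact: sqr_ge0.
Qed.

Lemma enormD_sqr x y : enorm (x + y) ^+ 2 = enorm x ^+ 2 + 2 * dot x y + enorm y ^+ 2.
Proof.
rewrite !enorm_sqr /dot mulr_sumr -!big_split /=; apply: eq_bigr => i _.
by rewrite mxE; ring.
Qed.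

Lemma enormD x y : enorm (x + y) <= enorm x + enorm y.
Proof.
rewrite -(ler_pXn2r (n := 2)) ?nnegrE ?addr_ge0 ?enorm_ge0 //.
have := le_trans (ler_norm _) (dot_le x y).
rewrite enormD_sqr sqrrD mulr2n; lra.
Qed.

Lemma enormB x y : enorm (x - y) <= enorm x + enorm y.
Proof. by rewrite (le_trans (enormD _ _)) // enormN. Qed.

Lemma enorm_subl x y : enorm x - enorm y <= enorm (x + y).
Proof.
by rewrite lerBlDr (le_trans _ (enormB _ _)) // addrK.
Qed.

Lemma coord_le x i : `|x ord0 i| <= enorm x.
Proof.
rewrite -(ler_pXn2r (n := 2)) ?nnegrE ?enorm_ge0 //.
rewrite enorm_sqr real_normK ?num_real // (bigD1 i) //= lerDl.
by apply: sumr_ge0 => j _; exact: sqr_ge0.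
Qed.

Lemma continuous_enorm : continuous (@enorm R n).
Proof.
move=> x; apply: continuous_comp; last exact: sqrt_continuous.
apply: cvg_big; [exact: add_continuous|exact: nbhs_filter|].
move=> i _; apply: (@continuous_comp _ _ _ (fun y : V => y ord0 i) (fun t : R => t ^+ 2)).
  exact: coord_continuous.
exact: exprn_continuous.
Qed.

Lemma mf_enorm : mf (@enorm R n).
Proof. exact: continuous_measurable continuous_enorm. Qed.

End Enorm.

(** * Volumes of cubes, balls and annuli *)

Lemma intRn_prod (R : realType) (g : R -> R) (G : R) n :
  measurable_fun setT g -> (forall t, 0 <= g t) ->
  (\int[@lebesgue_measure R]_t (g t)%:E = G%:E)%E ->
  intRn (fun x : 'rV[R]_n => (\prod_(i < n) g (x ord0 i))%:E) = (G ^+ n)%:E.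
Proof.
move=> mg g0 gG; have G0 : 0 <= G.
  by rewrite -lee_fin -gG; apply: integral_ge0 => t _; rewrite lee_fin.
elim: n => [|n IH]; first by rewrite /= big_ord0.
rewrite intRnS.
have mP : mf (fun x : 'rV[R]_n => \prod_(i < n) g (x ord0 i)).
  apply: measurable_prod => i _; exact: (measurableT_comp mg (measurable_coord i)).
have P0 (x : 'rV[R]_n) : 0 <= \prod_(i < n) g (x ord0 i) by exact: prodr_ge0.
transitivity (\int[@lebesgue_measure R]_t ((g t)%:E * (G ^+ n)%:E))%E.
  apply: eq_integral => t _.
  rewrite -IH intRnE //; last 2 first.
  - apply/measurable_EFinP; apply: measurable_prod => i _.
    apply: (measurableT_comp mg).
    exact: (measurableT_comp (measurable_coord i) (measurable_emb t)).
  - by move=> x; rewrite lee_fin; exact: prodr_ge0.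
  rewrite intRnE //; last exact/measurable_EFinP.
  rewrite -ge0_integralZl_EFin //; last exact/measurable_EFinP.
    apply: eq_integral => x _; rewrite big_ord_recl /= /emb row_mx_ord0 EFinM.
    by congr (_ * _%:E)%E; apply: eq_bigr => i _; rewrite row_mx_lift0.
  by move=> x _; rewrite lee_fin.
rewrite ge0_integralZr ?lee_fin ?exprn_ge0 //; last 2 first.
- exact/measurable_EFinP.
- by move=> t _; rewrite lee_fin.
by rewrite gG -EFinM exprS.
Qed.

Section Balls.
Variables (R : realType) (n : nat).
Local Notation V := 'rV[R]_n.

Definition chi (r : R) (x : V) : R := (enorm x < r)%R%:R.

Lemma mf_chi r : mf (chi r).
Proof. have := @mf_enorm R n => h; rewrite /chi; mm. Qed.

Lemma chi_ge0 r x : 0 <= chi r x.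
Proof. exact: ler0n. Qed.

Lemma chi_le1 r x : chi r x <= 1.
Proof. by rewrite /chi lern1; case: (_ < _). Qed.

Lemma ig_box (c : R) : 0 <= c ->
  ig (fun x : V => \prod_(i < n) (`|x ord0 i| <= c)%R%:R) /\
  RI (fun x : V => \prod_(i < n) (`|x ord0 i| <= c)%R%:R) = (2 * c) ^+ n.
Proof.
move=> c0; pose g (t : R) : R := (`|t| <= c)%R%:R.
have mg : measurable_fun setT g by rewrite /g; mm.
have gG : (\int[@lebesgue_measure R]_t (g t)%:E = (2 * c)%:E)%E.
  transitivity (\int[@lebesgue_measure R]_t (\1_(`[- c, c]%classic) t)%:E)%E.
    by apply: eq_integral => t _; rewrite /g indicE mem_setE in_itv /= ler_norml.
  rewrite integral_indic // setIT; apply: etrans (lebesgue_measure_itv _) _.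
  rewrite /= lte_fin; have [h|h] := ltP (- c) c.
    by rewrite -EFinD; congr EFin; ring.
  by rewrite (_ : c = 0) ?mulr0 //; lra.
have P0 (x : V) : 0 <= \prod_(i < n) g (x ord0 i).
  by apply: prodr_ge0 => i _; exact: ler0n.
have mP : mf (fun x : V => \prod_(i < n) g (x ord0 i)).
  apply: measurable_prod => i _; exact: (measurableT_comp mg (measurable_coord i)).
have E : intRn (fun x : V => (\prod_(i < n) g (x ord0 i))%:E) = ((2 * c) ^+ n)%:E.
  by apply: intRn_prod => // t; exact: ler0n.
have I1 : ig (fun x : V => \prod_(i < n) g (x ord0 i)).
  by apply: ig_intRn => //; rewrite E ltry.
by split => //; apply: EFin_inj; rewrite -E intRn_RI.
Qed.

Lemma ig_chi r : ig (chi r).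
Proof.
have [r0|r0] := leP 0 r; last first.
  apply: (eq_ig (f := fun=> 0)); last exact: ig0.
  by move=> x; rewrite /chi ltNge (le_trans (ltW r0)) ?enorm_ge0.
apply: ig_le (mf_chi r) (ig_box r0).1 _ => x; rewrite ger0_norm ?chi_ge0 //.
rewrite /chi; case: ltP => h; last by apply: prodr_ge0 => i _; exact: ler0n.
rewrite big1 // => i _; rewrite (le_trans (coord_le _ _)) //; exact: ltW.
Qed.

Lemma chi_sqr r (a : R) x : chi r x * a ^+ 2 = (chi r x * a) ^+ 2.
Proof.
by rewrite exprMn; congr (_ * _); rewrite /chi; case: (_ < _); rewrite ?expr1n ?expr0n.
Qed.

Lemma ig_chi_sqr r (D : R) (L : V -> R) : mf L -> (forall x, `|L x| <= D) ->
  ig (fun x => chi r x * L x ^+ 2).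
Proof.
move=> mL LD; have ic := ig_chi r; have mc := mf_chi r.
apply: (ig_le _ (igZ (D ^+ 2) ic)) => [|x]; first by mm.
rewrite normrM (ger0_norm (chi_ge0 _ _)) mulrC ler_wpM2r ?chi_ge0 //.
by rewrite normrX lerXn2r ?nnegrE // (le_trans _ (LD x)).
Qed.

Lemma RI_chi r : 0 < r -> RI (chi r) = r ^+ n * RI (chi 1).
Proof.
move=> r0; have ri : 0 < r^-1 by rewrite invr_gt0.
have := RI_scale ri (ig_chi 1); rewrite invrK => <-; apply: eq_RI => x.
by rewrite /chi enormZ gtr0_norm // mulrC ltr_pdivrMr // mul1r.
Qed.

(** The cube of side 2 has volume 2^n and lies in the ball of radius n + 1, whose volume is a
    multiple of that of the unit ball. *)
Lemma vol_gt0 : 0 < RI (chi 1).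
Proof.
rewrite lt_def RI_ge0 ?andbT; last by move=> x; exact: chi_ge0.
apply/eqP => h0; have [i1 e1] := ig_box ler01.
have : RI (fun x : V => \prod_(i < n) (`|x ord0 i| <= 1)%R%:R) <= RI (chi n.+1%:R).
  apply: RI_le => //; first exact: ig_chi.
  move=> x; have [h|/forallP h] := boolP [forall i, `|x ord0 i| <= 1].
    rewrite big1 => [|i _]; last by rewrite (forallP h i).
    rewrite /chi (_ : (enorm x < _) = true) //.
    rewrite -(ltr_pXn2r (n := 2)) ?nnegrE ?enorm_ge0 // enorm_sqr.
    apply: (@le_lt_trans _ _ n%:R); last first.
      by rewrite -natrX ltr_nat expnS expn1 (leq_trans (ltnSn n)) // leq_pmulr.
    rewrite -[in leRHS](card_ord n) -sumr_const; apply: ler_sum => i _.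
    by rewrite -real_normK ?num_real // exprn_ile1 ?(forallP h i).
  have /forallPn [i hi] : ~~ [forall i, `|x ord0 i| <= 1] by apply/forallP.
  by rewrite (bigD1 i) //= (negbTE hi) mul0r chi_ge0.
by rewrite e1 RI_chi ?ltr0Sn // h0 mulr0 mulr1 leNgt exprn_gt0.
Qed.

Definition ann (h : R) (x : V) : R := chi h x - chi (h / 2) x.

Lemma annE h x : 0 <= h -> ann h x = ((h / 2 <= enorm x) && (enorm x < h))%R%:R.
Proof.
move=> h0; rewrite /ann /chi; case: ltP => a; case: ltP => b /=; rewrite ?subr0 ?subrr //.
by move: a b; lra.
Qed.

Lemma ig_ann h : ig (ann h).
Proof. by apply: igB; exact: ig_chi. Qed.

Lemma ann_gt0 : (0 < n)%N -> 0 < RI (ann 1).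
Proof.
move=> n0; rewrite RIB; try exact: ig_chi.
rewrite (RI_chi (r := 1 / 2)) // -[X in X - _]mul1r -mulrBl mulr_gt0 ?vol_gt0 //.
by rewrite subr_gt0 exprn_ilt1 -?lt0n // ?divr_ge0 // ltr_pdivrMr // mul1r ltr1n.
Qed.

Lemma RI_ann (h : R) : 0 < h -> RI (ann h) = h ^+ n * RI (ann 1).
Proof.
move=> h0; rewrite !RIB; try exact: ig_chi.
have h2 : 0 < h / 2 by rewrite divr_gt0.
rewrite (RI_chi h0) (RI_chi h2) (@RI_chi (1 / 2)) ?divr_gt0 //.
by rewrite !exprMn expr1n; ring.
Qed.

End Balls.
Arguments ig_chi {R n} r.
Arguments mf_chi {R n} r.
Arguments mf_enorm {R n}.
Arguments ig_ann {R n} h.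

(** [A / (1 - r)] is the fixed point of t -> A + r t, so as an upper bound it reproduces itself. *)
Lemma geo_bound (R : realFieldType) (u : nat -> R) (A r : R) : 0 <= r -> r < 1 ->
  u 0%N <= A / (1 - r) -> (forall k, u k.+1 <= A + r * u k) ->
  forall k, u k <= A / (1 - r).
Proof.
move=> r0 r1 u0 uS; elim=> [//|k IH]; apply: le_trans (uS k) _.
have r2 : 0 < 1 - r by lra.
apply: (@le_trans _ _ (A + r * (A / (1 - r)))); first by rewrite lerD2l ler_wpM2l.
by rewrite le_eqVlt (_ : _ + _ = A / (1 - r)) ?eqxx //; field; lra.
Qed.

(** * Integrability of the kernel *)

Section Kernel.
Variables (R : realType) (n : nat).
Local Notation V := 'rV[R]_n.
Implicit Types (y : V) (s : R).

Definition pw s y : R := enorm y `^ (- (n%:R + s)).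
(** The model kernel of the class, with its normalisation. At the origin it is 0 for 1 <= s, because
    a nonzero power of 0 is 0 by convention. *)
Definition kap s y : R := (2 - s) * pw s y.
(** The weight against which every kernel of the class has finite mass: |y|^2 is what second
    differences gain near 0, and 1 is what boundedness gives far away. *)
Definition m1 y : R := Num.min 1 (enorm y ^+ 2).

Lemma ln2_gt0 : 0 < ln 2 :> R.
Proof. by rewrite ln_gt0 // ltr1n. Qed.

(** With t = 2 - s, exp(t ln 2) >= 1 + t ln 2 yields 1 - 2^(-t) >= t ln 2 / (1 + t ln 2), and t <= 1
    bounds the denominator. The second alternative is void once 1 <= s. Together with [pow2B_lb]
    this makes 1 - 2^(s-2) comparable to 2 - s. *)
Lemma pow2B_ub s : s < 2 ->
  (2 - s) * (ln 2 / (1 + ln 2)) <= 1 - 2 `^ (s - 2) \/ 1 < 2 - s.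
Proof.
move=> s2; have l2 := ln2_gt0; have [h|h] := leP (2 - s) 1; last by right.
left; have t0 : 0 < 2 - s by lra.
have E : 2 `^ (s - 2) = (expR ((2 - s) * ln 2))^-1.
  by rewrite /powR pnatr_eq0 /= -expRN; congr expR; ring.
have h1 := expR_ge1Dx ((2 - s) * ln 2).
have p1 : 0 < 1 + (2 - s) * ln 2 by rewrite addr_gt0 ?mulr_gt0.
have h2 : 2 `^ (s - 2) <= (1 + (2 - s) * ln 2)^-1.
  by rewrite E lef_pV2 ?posrE ?expR_gt0.
apply: le_trans (lerB (lexx 1) h2).
have -> : 1 - (1 + (2 - s) * ln 2)^-1 = (2 - s) * (ln 2 / (1 + (2 - s) * ln 2)).
  by field; rewrite gt_eqF.
rewrite ler_pM2l // ler_pM2l // lef_pV2 ?posrE ?addr_gt0 ?mulr_gt0 //.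
by rewrite lerD2l ler_piMl // ltW.
Qed.

Lemma pow2B_lb s : 1 - 2 `^ (s - 2) <= (2 - s) * ln 2.
Proof.
have h := expR_ge1Dx ((s - 2) * ln 2 : R).
by rewrite /powR pnatr_eq0 /=; lra.
Qed.

Lemma pw_ge0 s y : 0 <= pw s y. Proof. exact: powR_ge0. Qed.

Lemma mf_pw s : mf (pw s).
Proof. have h := mf_enorm (n := n) (R := R); rewrite /pw; mm. Qed.

Lemma pw0 s : 1 <= s -> pw s 0 = 0.
Proof.
move=> s1; rewrite /pw enorm0 powR0 // oppr_eq0 gt_eqF //.
by rewrite ltr_wpDl //; lra.
Qed.

Lemma pw_le s (d : R) y : 1 <= s -> 0 < d -> d <= enorm y -> pw s y <= d `^ (- (n%:R + s)).
Proof.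
move=> s1 d0 dy; have a0 : 0 <= n%:R + s by rewrite addr_ge0 //; lra.
rewrite /pw !powRN lef_pV2 ?posrE ?powR_gt0 ?(lt_le_trans d0) //.
by rewrite ge0_ler_powR // nnegrE ?enorm_ge0 ?ltW.
Qed.

Lemma pw_scale s (c : R) y : 0 < c -> pw s (c *: y) = c `^ (- (n%:R + s)) * pw s y.
Proof. by move=> c0; rewrite /pw enormZ gtr0_norm // powRM ?enorm_ge0 ?ltW. Qed.

Lemma pow_half s : (2^-1) `^ (- (n%:R + s)) = 2 ^+ n * 2 `^ s :> R.
Proof.
rewrite powRN -[2^-1 in LHS]powR_inv1 // -powRrM mulN1r powRN invrK.
by rewrite powRD ?powR_mulrn //; apply/implyP.
Qed.

Lemma pow_two s : 2 `^ (- (n%:R + s)) = (2 ^+ n * 2 `^ s)^-1 :> R.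
Proof. by rewrite powRN powRD ?powR_mulrn //; apply/implyP. Qed.

Lemma pow2s s : 2 `^ s = 4 * 2 `^ (s - 2) :> R.
Proof.
rewrite powRB ?pnatr_eq0 ?implybT // powR_mulrn // expr2.
by field.
Qed.

Lemma pow2_le4 s : s < 2 -> 2 `^ s <= 4 :> R.
Proof.
move=> s2; apply: (@le_trans _ _ (2 `^ 2)); first by rewrite ler_powR ?ler1n // ltW.
by rewrite powR_mulrn // expr2; lra.
Qed.

Lemma pow2_ge2 s : 1 <= s -> 2 <= 2 `^ s :> R.
Proof. by move=> s1; rewrite le1r_powR // ler1n. Qed.

Lemma chi_scale (c r : R) y : 0 < c -> chi r (c *: y) = chi (r / c) y.
Proof. by move=> c0; rewrite /chi enormZ gtr0_norm // ltr_pdivlMr // mulrC. Qed.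

Lemma chi_mono (r1 r2 : R) y : r1 <= r2 -> chi r1 y <= chi r2 y.
Proof.
by rewrite /chi => r12; case: ltP => // h; rewrite (lt_le_trans h r12).
Qed.

(** Cutting off the ball of radius 2^-k makes the integrand bounded, hence integrable before any
    estimate is known; bounds uniform in k then pass to the limit by Fatou. [far_] plays the same
    role at infinity. *)
Definition near_ s (k : nat) y := enorm y ^+ 2 * pw s y * (chi 1 y - chi (2^-1 ^+ k) y).

Lemma near_ge0 s k y : 0 <= near_ s k y.
Proof.
rewrite !mulr_ge0 ?exprn_ge0 ?enorm_ge0 ?pw_ge0 // subr_ge0 chi_mono //.
by rewrite exprn_ile1 ?invr_ge0 // invf_le1 // ler1n.
Qed.

Lemma near_le s k y : 1 <= s ->
  `|near_ s k y| <= (2^-1 ^+ k) `^ (- (n%:R + s)) * chi 1 y.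
Proof.
move=> s1; rewrite ger0_norm ?near_ge0 // /near_ /chi.
have p0 : 0 < 2^-1 ^+ k :> R by rewrite exprn_gt0 // invr_gt0.
have [h|h] := ltP (enorm y) 1; last first.
  rewrite ltNge (le_trans _ h) ?subrr ?mulr0 //.
  by rewrite exprn_ile1 ?invr_ge0 // invf_le1 // ler1n.
have [h2|h2] := ltP (enorm y) (2^-1 ^+ k).
  by rewrite subrr mulr0 mulr1 powR_ge0.
rewrite subr0 !mulr1 -[leRHS]mul1r ler_pM ?exprn_ge0 ?enorm_ge0 ?pw_ge0 ?pw_le //.
by rewrite exprn_ile1 ?enorm_ge0 // ltW.
Qed.

Lemma mf_near s k : mf (near_ s k).
Proof.
have h1 := mf_enorm (n := n) (R := R); have h2 := mf_pw s; have h3 := mf_chi (n := n) (1 : R).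
have h4 := mf_chi (n := n) (2^-1 ^+ k : R); rewrite /near_; mm.
Qed.

Lemma ig_near s k : 1 <= s -> ig (near_ s k).
Proof.
move=> s1.
apply: (ig_le (mf_near s k) (igZ ((2^-1 ^+ k) `^ (- (n%:R + s))) (ig_chi 1))) => y.
exact: near_le.
Qed.

Lemma nearS s k y : 1 <= s ->
  near_ s k.+1 y = near_ s 1 y + enorm y ^+ 2 * pw s y * (chi (2^-1) y - chi (2^-1 ^+ k.+1) y).
Proof. by move=> s1; rewrite /near_ expr1; ring. Qed.

(** Self-similarity: dilating by 2 carries the part of the shell inside the ball of radius 1/2 onto
    the shell of index k. The integrand is homogeneous of degree 2 - n - s and the volume
    contributes n, whence the ratio 2^(s-2). [RI_far] uses the inverse dilation, with ratio 2^-s. *)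
Lemma RI_near s k : 1 <= s -> s < 2 ->
  RI (near_ s k.+1) = RI (near_ s 1) + 2 `^ (s - 2) * RI (near_ s k).
Proof.
move=> s1 s2; pose g y := enorm y ^+ 2 * pw s y * (chi (2^-1) y - chi (2^-1 ^+ k.+1) y).
have ig_g : ig g.
  apply: (eq_ig (f := fun y => near_ s k.+1 y - near_ s 1 y)).
    by move=> y; rewrite nearS // addrC addKr.
  by apply: igB; exact: ig_near.
rewrite (eq_RI (nearS k ^~ s1)) RID // ; last exact: ig_near.
congr (_ + _); rewrite -/g.
have h : 0 < 2^-1 :> R by rewrite invr_gt0.
have := RI_scale h ig_g; rewrite invrK.
rewrite (eq_RI (g := fun y => (2 ^+ n * 2 `^ (s - 2)) * near_ s k y)); last first.
  move=> y; rewrite /g /near_ pw_scale // pow_half pow2s enormZ gtr0_norm //.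
  have e1 : 2^-1 / 2^-1 = 1 :> R by rewrite divff ?gt_eqF.
  have e2 : 2^-1 ^+ k.+1 / 2^-1 = 2^-1 ^+ k :> R by rewrite exprSr mulfK ?gt_eqF.
  by rewrite !chi_scale // e1 e2; field.
rewrite RIZ; last exact: ig_near.
by rewrite -mulrA => /mulfI -> //; rewrite expf_eq0 pnatr_eq0 andbF.
Qed.

Definition far_ s (k : nat) y := pw s y * (chi (2 ^+ k) y - chi 1 y).

Lemma far_ge0 s k y : 0 <= far_ s k y.
Proof.
by rewrite mulr_ge0 ?pw_ge0 // subr_ge0 chi_mono // exprn_ege1 // ler1n.
Qed.

Lemma far_le s k y : 1 <= s -> `|far_ s k y| <= chi (2 ^+ k) y.
Proof.
move=> s1; rewrite ger0_norm ?far_ge0 // /far_ /chi.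
have [h|h] := ltP (enorm y) 1.
  by rewrite (lt_le_trans h) ?subrr ?mulr0 // exprn_ege1 // ler1n.
rewrite subr0 ler_piMl ?ler0n //.
by apply: le_trans (pw_le s1 ltr01 h) _; rewrite powR1.
Qed.

Lemma mf_far s k : mf (far_ s k).
Proof.
have h2 := mf_pw s; have h3 := mf_chi (n := n) (1 : R); have h4 := mf_chi (n := n) (2 ^+ k : R).
rewrite /far_; mm.
Qed.

Lemma ig_far s k : 1 <= s -> ig (far_ s k).
Proof. by move=> s1; apply: (ig_le (mf_far s k) (ig_chi (2 ^+ k))) => y; exact: far_le. Qed.

Lemma RI_far s k : 1 <= s -> s < 2 ->
  RI (far_ s k.+1) = RI (far_ s 1) + (2 `^ s)^-1 * RI (far_ s k).
Proof.
move=> s1 s2; pose g y := pw s y * (chi (2 ^+ k.+1) y - chi 2 y).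
have ig_g : ig g.
  apply: (eq_ig (f := fun y => far_ s k.+1 y - far_ s 1 y)).
    by move=> y; rewrite /far_ /g expr1; ring.
  by apply: igB; exact: ig_far.
rewrite (eq_RI (g := fun y => far_ s 1 y + g y)); last first.
  by move=> y; rewrite /far_ /g expr1; ring.
rewrite RID //; last exact: ig_far.
congr (_ + _).
have := RI_scale (ltr0Sn R 1) ig_g.
rewrite (eq_RI (g := fun y => (2 ^+ n * 2 `^ s)^-1 * far_ s k y)); last first.
  move=> y; rewrite /g /far_ pw_scale // pow_two.
  have e1 : 2 / 2 = 1 :> R by rewrite divff.
  have e2 : 2 ^+ k.+1 / 2 = 2 ^+ k :> R by rewrite exprSr mulfK.
  by rewrite !chi_scale // e1 e2; ring.
rewrite RIZ; last exact: ig_far.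
by rewrite invfM -exprVn -mulrA => /mulfI -> //; rewrite expf_eq0 invr_eq0 pnatr_eq0 andbF.
Qed.

Lemma m1_ge0 y : 0 <= m1 y.
Proof. by rewrite /m1 le_min ler01 sqr_ge0. Qed.

Lemma mf_m1 : mf m1.
Proof. have h := mf_enorm (n := n) (R := R); rewrite /m1; mm. Qed.

Lemma kap_ge0 s y : s < 2 -> 0 <= kap s y.
Proof. by move=> s2; rewrite mulr_ge0 ?pw_ge0 // subr_ge0 ltW. Qed.

Lemma kap0 s : 1 <= s -> kap s 0 = 0.
Proof. by move=> s1; rewrite /kap pw0 // mulr0. Qed.

(** The bounds of [near_bound] and [far_bound] added; s does not occur in it. *)
Definition kapC : R :=
  (2 ^+ n * 4 * RI (@chi R n 1)) * ((1 + ln 2) / ln 2 + 1) + 2 * RI (@chi R n 2).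

Lemma RI_near1 s : 1 <= s -> s < 2 -> RI (near_ s 1) <= 2 ^+ n * 4 * RI (@chi R n 1).
Proof.
move=> s1 s2; rewrite -RIZ; last exact: ig_chi.
apply: RI_le; [exact: ig_near|exact/igZ/ig_chi|] => y.
apply: le_trans (ler_norm _) _; apply: le_trans (near_le 1 y s1) _.
rewrite expr1 pow_half ler_wpM2r ?chi_ge0 // ler_pM2l ?exprn_gt0 //.
exact: pow2_le4.
Qed.

(* The bound is uniform as s -> 2: the factor 2 - s compensates the
   singularity at the origin, whose integral is estimated by self-similarity. *)
Lemma near_bound s k : 1 <= s -> s < 2 ->
  (2 - s) * RI (near_ s k) <= (2 ^+ n * 4 * RI (@chi R n 1)) * ((1 + ln 2) / ln 2 + 1).
Proof.
move=> s1 s2; set A := _ * _ * RI _; have l2 := ln2_gt0.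
have A0 : 0 <= A.
  rewrite !mulr_ge0 ?exprn_ge0 // RI_ge0 // => y; exact: chi_ge0.
have r0 : 0 < 2 `^ (s - 2) :> R by rewrite powR_gt0.
have r1 : 2 `^ (s - 2) < 1 :> R.
  rewrite /powR pnatr_eq0 /= -[ltRHS]expR0 ltr_expR.
  by rewrite pmulr_llt0 //; lra.
have H : RI (near_ s k) <= A / (1 - 2 `^ (s - 2)).
  apply: (geo_bound (u := fun k => RI (near_ s k))) => //.
    rewrite (eq_RI (g := fun=> 0)); last first.
      by move=> y; rewrite /near_ expr0 subrr mulr0.
    by rewrite RI0 divr_ge0 // subr_ge0 ltW.
  by move=> j; rewrite RI_near // lerD2r RI_near1.
have t0 : 0 < 2 - s by lra.
have d0 : 0 < 1 - 2 `^ (s - 2) :> R by lra.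
have [h|h] := pow2B_ub s2; last by exfalso; move: h; lra.
apply: (@le_trans _ _ (A * ((1 + ln 2) / ln 2))); last first.
  by rewrite ler_wpM2l // lerDl.
apply: le_trans (ler_wpM2l (ltW t0) H) _; rewrite mulrCA ler_wpM2l //.
rewrite ler_pdivrMr // mulrC -ler_pdivrMr ?divr_gt0 ?addr_gt0 //.
by rewrite invf_div.
Qed.

Lemma far_bound s k : 1 <= s -> s < 2 -> RI (far_ s k) <= 2 * RI (@chi R n 2).
Proof.
move=> s1 s2; have V0 : 0 <= RI (@chi R n 2) by apply: RI_ge0 => y; exact: chi_ge0.
have H := geo_bound (u := fun k => RI (far_ s k)) (A := RI (@chi R n 2)) (r := 2^-1).
apply: le_trans (H _ _ _ _ k) _; rewrite ?invr_ge0 ?invf_lt1 ?ltr1n //.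
- rewrite (eq_RI (g := fun=> 0)); last first.
    by move=> y; rewrite /far_ expr0 subrr mulr0.
  by rewrite RI0 divr_ge0 //; lra.
- move=> j; rewrite RI_far // lerD //.
    apply: RI_le; [exact: ig_far|exact: ig_chi|] => y.
    by apply: le_trans (ler_norm _) _; have := far_le 1 y s1; rewrite expr1.
  rewrite ler_wpM2r // ?RI_ge0 // => [y|]; first exact: far_ge0.
  by rewrite lef_pV2 ?posrE ?powR_gt0 // pow2_ge2.
- by rewrite le_eqVlt (_ : _ / _ = 2 * RI (@chi R n 2)) ?eqxx //; field; lra.
Qed.

Lemma ig_m1kap s : 1 <= s -> s < 2 ->
  ig (fun y => m1 y * kap s y) /\ RI (fun y => m1 y * kap s y) <= kapC.
Proof.
move=> s1 s2; pose f_ k y := (2 - s) * near_ s k y + (2 - s) * far_ s k y.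
have t0 : 0 < 2 - s by lra.
have i1 k : ig (fun y => (2 - s) * near_ s k y) by apply: igZ; exact: ig_near.
have i2 k : ig (fun y => (2 - s) * far_ s k y) by apply: igZ; exact: ig_far.
apply: (RI_fatou (f_ := f_)).
- by move=> k; exact: igD.
- by move=> k y; rewrite addr_ge0 // mulr_ge0 ?near_ge0 ?far_ge0 // ltW.
- move=> y; apply: cvg_near_cst.
  have [->|y0] := eqVneq y 0.
    apply: nearW => k; rewrite /f_ /near_ /far_ pw0 // kap0 //; ring.
  have e0 : 0 < enorm y by rewrite enorm_gt0.
  have H1 : \forall k \near \oo, 2^-1 ^+ k <= enorm y.
    have := @cvg_expr R (2^-1); rewrite ger0_norm ?invr_ge0 // invf_lt1 // ltr1n => /(_ isT).
    by move=> /cvgr_le; apply.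
  have H2 : \forall k \near \oo, enorm y < 2 ^+ k.
    have := @cvg_expr R (2^-1); rewrite ger0_norm ?invr_ge0 // invf_lt1 // ltr1n.
    move=> /(_ isT) /cvgr_lt /(_ (enorm y)^-1); rewrite invr_gt0 => /(_ e0).
    apply: filterS => k; rewrite exprVn ltf_pV2 ?posrE ?exprn_gt0 //.
  near=> k; rewrite /f_ /near_ /far_ /kap /m1 /chi.
  have -> : (enorm y < 2 ^+ k) = true by near: k.
  have -> : (enorm y < 2^-1 ^+ k) = false by apply/negbTE; rewrite -leNgt; near: k.
  have [h|h] := ltP (enorm y) 1.
    rewrite (min_idPr _) ?exprn_ile1 ?enorm_ge0 ?ltW //= subrr subr0; ring.
  rewrite (min_idPl _) ?exprn_ege1 //= subrr subr0; ring.
- move=> k; rewrite RID // !RIZ ?lerD ?near_bound //; [|exact: ig_far|exact: ig_near].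
  have h := far_bound k s1 s2; apply: le_trans h; rewrite ler_piMl //; last lra.
  by apply: RI_ge0 => y; exact: far_ge0.
Unshelve. all: by end_near.
Qed.

End Kernel.

(** * Integro-differential operators and the energy *)

Section Operators.
Variables (R : realType) (n : nat).
Local Notation V := 'rV[R]_n.
Implicit Types (w u v h : V -> R) (x y z : V) (s c C r : R).

(** Bounded with compact support. The class is stable under translations, so differences can be
    summed by parts without any regularity. *)
Definition bcs C r w := [/\ mf w, forall x, `|w x| <= C & forall x, r <= enorm x -> w x = 0].

Lemma bcs_ge0 C r w : bcs C r w -> 0 <= C.
Proof. by case=> _ /(_ 0) h _; exact: le_trans h. Qed.

Lemma bcs_chi C r w : bcs C r w -> forall x, `|w x| <= C * chi r x.
Proof.
move=> [_ wC w0] x; rewrite /chi; case: ltP => h; first by rewrite mulr1.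
by rewrite w0 // normr0 mulr0.
Qed.

Lemma ig_bcs C r w : bcs C r w -> ig w.
Proof.
move=> hw; have [mw _ _] := hw.
by apply: (ig_le mw (igZ C (ig_chi r))) => x; exact: bcs_chi.
Qed.

Lemma bcsM C r D w h : bcs C r w -> mf h -> (forall x, `|h x| <= D) ->
  bcs (C * D) r (fun x => w x * h x).
Proof.
move=> hw mh hD; have [mw wC w0] := hw; split=> [|x|x rx].
- mm.
- by rewrite normrM ler_pM.
- by rewrite w0 // mul0r.
Qed.

Lemma ig_bcsM C r D w h : bcs C r w -> mf h -> (forall x, `|h x| <= D) ->
  ig (fun x => w x * h x).
Proof. by move=> hw mh hD; exact: (ig_bcs (bcsM hw mh hD)). Qed.

Definition Dd (h : V) w x := w (x + h) - w (x - h).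

Lemma bcs_shift C r w a : bcs C r w -> bcs C (r + enorm a) (fun x => w (x + a)).
Proof.
move=> [mw wC w0]; split=> [|x|x rx]; [exact: mf_shift|exact: wC|].
apply: w0; apply: le_trans (enorm_subl _ _); lra.
Qed.

Lemma bcsD C1 C2 r1 r2 w1 w2 : bcs C1 r1 w1 -> bcs C2 r2 w2 ->
  bcs (C1 + C2) (Num.max r1 r2) (fun x => w1 x + w2 x).
Proof.
move=> [m1_ b1 s1] [m2_ b2 s2]; split=> [|x|x]; first mm.
  by rewrite (le_trans (ler_normD _ _)) // lerD.
by rewrite ge_max => /andP[/s1 -> /s2 ->]; rewrite addr0.
Qed.

Lemma bcsN C r w : bcs C r w -> bcs C r (fun x => - w x).
Proof.
move=> [m1_ b1 s1]; split=> [|x|x /s1 ->]; [mm|by rewrite normrN|by rewrite oppr0].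
Qed.

Lemma bcs_Dd C r w a : bcs C r w -> exists C' r', bcs C' r' (Dd a w).
Proof.
move=> hw; do 2 eexists; exact: (bcsD (bcs_shift a hw) (bcsN (bcs_shift (- a) hw))).
Qed.

(* Summation by parts: the central difference is antisymmetric. *)
Lemma RI_Dd C1 C2 r1 r2 u v a : bcs C1 r1 u -> bcs C2 r2 v ->
  RI (fun x => Dd a u x * v x) = - RI (fun x => u x * Dd a v x).
Proof.
move=> hu hv; have [mu bu su] := hu; have [mv bv sv] := hv.
have i1 b : ig (fun x => u (x + b) * v x).
  by apply: ig_bcsM (bcs_shift b hu) _ bv.
have i2 b : ig (fun x => u x * v (x + b)).
  by apply: (@ig_bcsM _ _ C2 _ (fun x => v (x + b)) hu) => [|x]; [exact: mf_shift|exact: bv].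
have E b : RI (fun x => u (x + b) * v x) = RI (fun x => u x * v (x - b)).
  rewrite -(RI_shift b (i2 (- b))); apply: eq_RI => x; by rewrite addrK.
rewrite (eq_RI (g := fun x => u (x + a) * v x - u (x - a) * v x)); last first.
  by move=> x; rewrite /Dd mulrBl.
rewrite RIB // !E opprK.
rewrite [in RHS](eq_RI (g := fun x => u x * v (x + a) - u x * v (x - a))); last first.
  by move=> x; rewrite /Dd mulrBr.
by rewrite RIB // opprB.
Qed.

(* Second differences factor through half steps, which makes
   [RI_delta2_pos] a square. *)
Lemma delta2E w x y : delta2 w x y = Dd (2^-1 *: y) (Dd (2^-1 *: y) w) x.
Proof.
have e : 2^-1 *: y + 2^-1 *: y = y.
  by rewrite -scalerDl (_ : 2^-1 + 2^-1 = 1) ?scale1r //; field.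
have e1 : x + 2^-1 *: y + 2^-1 *: y = x + y by rewrite -addrA e.
have e2 : x - 2^-1 *: y - 2^-1 *: y = x - y by rewrite -addrA -opprD e.
rewrite /delta2 /Dd e1 e2 addrK subrK; ring.
Qed.

Lemma DdC a b w x : Dd a (Dd b w) x = Dd b (Dd a w) x.
Proof.
rewrite /Dd ![x + a + _]addrAC ![x - a + _]addrAC [x + b - a]addrAC; ring.
Qed.

Lemma RI_delta2_pos C r w y z : bcs C r w ->
  0 <= RI (fun x => delta2 w x y * delta2 w x z).
Proof.
move=> hw; set a := 2^-1 *: y; set b := 2^-1 *: z.
have [C1 [r1 h1]] := bcs_Dd a hw; have [C2 [r2 h2]] := bcs_Dd b hw.
have [C3 [r3 h3]] := bcs_Dd b h2; have [C4 [r4 h4]] := bcs_Dd a h2.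
rewrite (eq_RI (g := fun x => Dd a (Dd a w) x * Dd b (Dd b w) x)); last first.
  by move=> x; rewrite !delta2E.
rewrite (RI_Dd a h1 h3).
rewrite (eq_RI (g := fun x => Dd b (Dd a (Dd b w)) x * Dd a w x)); last first.
  by move=> x; rewrite DdC mulrC.
rewrite (RI_Dd b h4 h1) opprK; apply: RI_ge0 => x.
by rewrite DdC -expr2 sqr_ge0.
Qed.

(** The squared L^2 modulus of continuity of w. Integrated against a kernel it gives the quadratic
    form of -L, a Gagliardo seminorm for the model kernel. *)
Definition Gd w y := RI (fun x => (w (x + y) - w x) ^+ 2).

Lemma ig_Gd C r w y : bcs C r w -> ig (fun x => (w (x + y) - w x) ^+ 2).
Proof.
move=> hw; have h := bcsD (bcs_shift y hw) (bcsN hw).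
by have [m_ b_ _] := h; apply: ig_bcsM h m_ b_.
Qed.

Lemma Gd_ge0 w y : 0 <= Gd w y.
Proof. by apply: RI_ge0 => x; exact: sqr_ge0. Qed.

Lemma mf_Gd w : mf w -> mf (Gd w).
Proof. by move=> mw; apply: (mf_RI (F := fun y x => (w (x + y) - w x) ^+ 2)); mm. Qed.

Lemma RI_delta2_self C r w y : bcs C r w ->
  RI (fun x => delta2 w x y * w x) = - Gd w y.
Proof.
move=> hw; set a := 2^-1 *: y; have [C1 [r1 h1]] := bcs_Dd a hw.
rewrite (eq_RI (g := fun x => Dd a (Dd a w) x * w x)); last first.
  by move=> x; rewrite !delta2E.
rewrite (RI_Dd a h1 hw); congr (- _).
rewrite /Gd -(RI_shift (- a) (ig_Gd y hw)); apply: eq_RI => x.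
rewrite -expr2 /Dd -addrA; congr ((w (_ + _) - _) ^+ 2).
rewrite /a -scaleNr -[X in _ + X]scale1r -scalerDl; congr (_ *: _); lra.
Qed.

Lemma GdN C r w y : bcs C r w -> Gd w (- y) = Gd w y.
Proof.
move=> hw; rewrite /Gd -(RI_shift y (ig_Gd (- y) hw)); apply: eq_RI => x.
by rewrite addrK -[RHS]sqrrN opprB.
Qed.

(** The increment along 2y is the sum of two increments along y with the same L^2 norm. This
    comparison of two scales drives [ann_energy]. *)
Lemma Gd_double C r w y : bcs C r w -> Gd w (2 *: y) <= 4 * Gd w y.
Proof.
move=> hw; have i1 := ig_Gd y hw; have i2 := ig_shift y i1.
rewrite (_ : 4 * Gd w y = 2 * RI (fun x => (w (x + y + y) - w (x + y)) ^+ 2) + 2 * Gd w y).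
  rewrite -!RIZ // -RID; try exact: igZ.
  apply: RI_le; [exact: (ig_Gd _ hw)|by apply: igD; exact: igZ|] => x.
  have -> : 2 *: y = y + y by rewrite scaler_nat mulr2n.
  rewrite addrA; have := sqr_ge0 ((w (x + y + y) - w (x + y)) - (w (x + y) - w x)); nra.
rewrite (RI_shift y i1) /Gd; lra.
Qed.

(** Compactly supported C^{1,1} functions described by differences alone. Second differences are
    then at most [4 * C * m1 y], so L converges absolutely, and the class is stable under cutoffs
    and mollification without computing derivatives. *)
Definition nice C r w :=
  [/\ bcs C r w, forall x y, `|w (x + y) - w x| <= C * enorm y &
      forall x y, `|delta2 w x y| <= C * enorm y ^+ 2].

(** Only the upper bound is recorded, since kernels such as [a * K1 y - K2 y] have to belong and may
    vanish; the lower bound is a separate hypothesis where ellipticity enters. *)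
Definition kern c s (K : V -> R) := [/\ 0 <= c, mf K & forall y, 0 <= K y <= c * kap s y].

Definition Lk (K : V -> R) w x := RI (fun y => delta2 w x y * K y).

Lemma mf2_delta2 w : mf w -> mf2 (delta2 w).
Proof. by move=> mw; rewrite /delta2; mm. Qed.

Lemma nice_delta2 C r w x y : nice C r w -> `|delta2 w x y| <= 4 * C * m1 y.
Proof.
move=> [hw _ h2]; have C0 := bcs_ge0 hw; have [_ wC _] := hw; rewrite /m1.
have [h|h] := leP 1 (enorm y ^+ 2).
  rewrite mulr1; have := wC (x + y); have := wC (x - y); have := wC x.
  by rewrite /delta2 !ler_norml => /andP[? ?] /andP[? ?] /andP[? ?];
    apply/andP; split; lra.
apply: le_trans (h2 x y) _; rewrite ler_wpM2r ?sqr_ge0 //; lra.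
Qed.

(** The second difference vanishes unless one of x, x + y, x - y lies in the support. The three
    indicators integrate in x to three times the volume of the ball, whatever y: this is the
    majorant for Fubini. *)
Lemma nice_delta2_chi C r w x y : nice C r w ->
  `|delta2 w x y| <= 4 * C * m1 y * (chi r x + chi r (x + y) + chi r (x - y)).
Proof.
move=> hw; have h := nice_delta2 x y hw; have [[_ _ w0] _ _] := hw.
have [hb|hb] := boolP [|| enorm x < r, enorm (x + y) < r | enorm (x - y) < r].
  apply: le_trans h _; have [h1 _ _] := hw; have C0 := bcs_ge0 h1.
  rewrite -[leLHS]mulr1 ler_wpM2l ?mulr_ge0 ?m1_ge0 //.
  have := chi_ge0 r x; have := chi_ge0 r (x + y); have := chi_ge0 r (x - y).
  by move: hb; rewrite /chi => /or3P[] -> /=; lra.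
rewrite (_ : delta2 w x y = 0) ?normr0.
  by rewrite !mulr_ge0 ?m1_ge0 ?addr_ge0 ?chi_ge0 //; have [h1 _ _] := hw; exact: bcs_ge0 h1.
move: hb; rewrite !negb_or -!leNgt => /and3P[/w0 e1 /w0 e2 /w0 e3].
by rewrite /delta2 e1 e2 e3; ring.
Qed.

Lemma kern_ge0 c s K y : kern c s K -> 0 <= K y.
Proof. by case=> _ _ /(_ y) /andP[]. Qed.

Section FixedS.
Variable s : R.
Hypotheses (s1 : 1 <= s) (s2 : s < 2).
Local Notation kC := (kapC R n).

Lemma kapC_ge0 : 0 <= kC.
Proof.
have [_ h] := ig_m1kap n s1 s2; apply: le_trans h; apply: RI_ge0 => y.
by rewrite mulr_ge0 ?m1_ge0 ?kap_ge0.
Qed.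

Lemma ig_m1K c K : kern c s K ->
  ig (fun y => m1 y * K y) /\ RI (fun y => m1 y * K y) <= c * kC.
Proof.
move=> hK; have [c0 mK hK1] := hK; have [i1 r1] := ig_m1kap n s1 s2.
have H y : m1 y * K y <= c * (m1 y * kap s y).
  by rewrite mulrCA ler_wpM2l ?m1_ge0 //; have /andP[] := hK1 y.
have i2 : ig (fun y => m1 y * K y).
  apply: (ig_le _ (igZ c i1)) => [|y]; first by have := @mf_m1 R n => mm1; mm.
  by rewrite ger0_norm ?mulr_ge0 ?m1_ge0 // (kern_ge0 _ hK).
split => //; apply: le_trans (RI_le i2 (igZ c i1) H) _.
by rewrite RIZ // ler_wpM2l.
Qed.

Lemma ig_delta2K C r w c K x : nice C r w -> kern c s K ->
  ig (fun y => delta2 w x y * K y).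
Proof.
move=> hw hK; have [c0 mK _] := hK; have [i1 _] := ig_m1K hK.
have [[mw _ _] _ _] := hw.
apply: (ig_le _ (igZ (4 * C) i1)) => [|y].
  by have h := mf2_sect x (mf2_delta2 mw); mm.
have K0 := kern_ge0 y hK.
by rewrite normrM (ger0_norm K0) mulrA ler_wpM2r // (nice_delta2 _ _ hw).
Qed.

Lemma Lk_le C r w c K x : nice C r w -> kern c s K -> `|Lk K w x| <= 4 * C * (c * kC).
Proof.
move=> hw hK; have [i1 r1] := ig_m1K hK; have [h1 _ _] := hw; have C0 := bcs_ge0 h1.
apply: (@le_trans _ _ (RI (fun y => 4 * C * (m1 y * K y)))); last first.
  by rewrite RIZ // ler_wpM2l // mulr_ge0.
apply: RI_absle; [exact: (ig_delta2K x hw hK)|exact: igZ|] => y.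
have K0 := kern_ge0 y hK.
by rewrite normrM (ger0_norm K0) mulrA ler_wpM2r // (nice_delta2 _ _ hw).
Qed.

Lemma mf_Lk w K : mf w -> mf K -> mf (Lk K w).
Proof.
move=> mw mK; have h := mf2_delta2 mw.
by apply: (mf_RI (F := fun x y => delta2 w x y * K y)); mm.
Qed.

Lemma LopE C r w c K x : nice C r w -> kern c s K -> Lop K w x = Lk K w x.
Proof. by move=> hw hK; rewrite /Lop Rint_RI //; exact: (ig_delta2K x hw hK). Qed.

Lemma ig_delta2h C r w h D y : nice C r w -> mf h -> (forall x, `|h x| <= D) ->
  ig (fun x => delta2 w x y * h x).
Proof.
move=> hw mh hD; have [[mw _ _] _ _] := hw; have ic := ig_chi (n := n) r.
have i1 : ig (fun x => 4 * C * m1 y * D * (chi r x + chi r (x + y) + chi r (x - y))).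
  apply: igZ; apply: igD; last exact: (ig_shift (- y) ic).
  by apply: igD => //; exact: ig_shift.
apply: (ig_le _ i1) => [|x]; first by have hh := mf2_sect y (mf2_swap (mf2_delta2 mw)); mm.
rewrite normrM mulrAC ler_pM //; exact: (nice_delta2_chi _ _ hw).
Qed.

(** The function [h] is merely bounded, without compact support, so that it can itself be some
    [Lk K2 w]. *)
Lemma Lk_pair C r w c K h D : nice C r w -> kern c s K -> mf h ->
  (forall x, `|h x| <= D) ->
  [/\ ig (fun x => Lk K w x * h x),
      ig (fun y => K y * RI (fun x => delta2 w x y * h x)) &
      RI (fun x => Lk K w x * h x) = RI (fun y => K y * RI (fun x => delta2 w x y * h x))].
Proof.
move=> hw hK mh hD; have [i1 r1] := ig_m1K hK; have [h1 _ _] := hw.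
have C0 := bcs_ge0 h1; have [mw _ _] := h1; have [c0 mK _] := hK.
have md := mf2_delta2 mw; have D0 : 0 <= D := le_trans (normr_ge0 _) (hD 0).
pose B y x := 4 * C * m1 y * D * K y * (chi r x + chi r (x + y) + chi r (x - y)).
have ic := ig_chi (n := n) r.
have iB y : ig (B y).
  apply: igZ; apply: igD; last exact: (ig_shift (- y) ic).
  by apply: igD => //; exact: ig_shift.
have RB y : RI (B y) = 4 * C * D * (3 * RI (@chi R n r)) * (m1 y * K y).
  rewrite RIZ; last first.
    apply: igD; last exact: (ig_shift (- y) ic).
    by apply: igD => //; exact: ig_shift.
  rewrite RID //; [|by apply: igD => //; exact: ig_shift|exact: (ig_shift (- y) ic)].
  rewrite RID //; last exact: ig_shift.
  rewrite RI_shift // (RI_shift (- y) ic); ring.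
pose F y x := delta2 w x y * h x * K y.
have FB y x : `|F y x| <= B y x.
  have K0 := kern_ge0 y hK; rewrite /F !normrM (ger0_norm K0) /B.
  rewrite (_ : _ * (chi r x + _ + _) = (4 * C * m1 y * (chi r x + chi r (x + y) + chi r (x - y))) * D * K y); last by ring.
  rewrite ler_wpM2r // ler_pM //; exact: (nice_delta2_chi _ _ hw).
have iF y : ig (F y).
  apply: (ig_le _ (iB y)) => //; rewrite /F.
  by have hh := mf2_sect y (mf2_swap md); mm.
have mF : mf2 F by rewrite /F; have md' := mf2_swap md; mm.
have FG y : RI (fun x => `|F y x|) <= 4 * C * D * (3 * RI (@chi R n r)) * (m1 y * K y).
  by rewrite -RB; apply: RI_le => //; exact: ig_abs.
have [I1 I2 E] := Fubini_RI mF iF FG (igZ _ i1).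
have E1 y : RI (F y) = K y * RI (fun x => delta2 w x y * h x).
  rewrite -RIZ; first by apply: eq_RI => x; rewrite /F mulrC.
  exact: (ig_delta2h y hw mh hD).
have E2 x : RI (fun y => F y x) = Lk K w x * h x.
  rewrite mulrC -RIZ; last exact: (ig_delta2K x hw hK).
  by apply: eq_RI => y; rewrite /F; ring.
split.
- by apply: eq_ig I2 => x; rewrite E2.
- by apply: eq_ig I1 => y; rewrite E1.
- exact: (etrans (esym (eq_RI E2)) (etrans (esym E) (eq_RI E1))).
Qed.

Lemma ig_Lk2 C r w c1 c2 K1 K2 : nice C r w -> kern c1 s K1 -> kern c2 s K2 ->
  ig (fun x => Lk K1 w x * Lk K2 w x).
Proof.
move=> hw h1 h2; have [[mw _ _] _ _] := hw; have [_ m2 _] := h2.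
by have [] := Lk_pair hw h1 (mf_Lk mw m2) (fun x => Lk_le x hw h2).
Qed.

Lemma Lk_pos C r w c1 c2 K1 K2 : nice C r w -> kern c1 s K1 -> kern c2 s K2 ->
  0 <= RI (fun x => Lk K1 w x * Lk K2 w x).
Proof.
move=> hw h1 h2; have [[mw wC _] _ _] := hw; have [_ m2 _] := h2.
have [_ _ ->] := Lk_pair hw h1 (mf_Lk mw m2) (fun x => Lk_le x hw h2).
apply: RI_ge0 => y; rewrite mulr_ge0 ?(kern_ge0 _ h1) //.
rewrite (eq_RI (g := fun x => Lk K2 w x * delta2 w x y)); last by move=> x; rewrite mulrC.
have md := mf2_sect y (mf2_swap (mf2_delta2 mw)).
have [_ _ ->] := Lk_pair hw h2 md (fun x => nice_delta2 x y hw).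
apply: RI_ge0 => z; rewrite mulr_ge0 ?(kern_ge0 _ h2) //.
have [hb _ _] := hw; exact: (RI_delta2_pos z y hb).
Qed.

Lemma kernD c1 c2 a K1 K2 : 0 <= a -> kern c1 s K1 -> kern c2 s K2 ->
  kern (a * c1 + c2) s (fun y => a * K1 y + K2 y).
Proof.
move=> a0 [c10 m1_ h1] [c20 m2_ h2]; split; [by rewrite addr_ge0 ?mulr_ge0|mm|] => y.
have /andP[a1 b1] := h1 y; have /andP[a2 b2] := h2 y.
by rewrite addr_ge0 ?mulr_ge0 //= mulrDl lerD // -mulrA ler_wpM2l.
Qed.

Lemma kernB c1 c2 a K1 K2 : 0 <= a -> kern c1 s K1 -> kern c2 s K2 ->
  (forall y, K2 y <= a * K1 y) -> kern (a * c1) s (fun y => a * K1 y - K2 y).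
Proof.
move=> a0 [c10 m1_ h1] [c20 m2_ h2] h; split; [by rewrite mulr_ge0|mm|] => y.
have /andP[a1 b1] := h1 y; have /andP[a2 b2] := h2 y.
rewrite subr_ge0 h /= (le_trans (y := a * K1 y)) ?gerBl //.
by rewrite -mulrA ler_wpM2l.
Qed.

(* Apply [Lk_pos] to the kernels [a K1 - K2] and [a K1 + K2]. *)
Lemma Lk_cmp C r w c1 c2 a K1 K2 : nice C r w -> kern c1 s K1 -> kern c2 s K2 ->
  0 <= a -> (forall y, K2 y <= a * K1 y) ->
  RI (fun x => Lk K2 w x ^+ 2) <= a ^+ 2 * RI (fun x => Lk K1 w x ^+ 2).
Proof.
move=> hw h1 h2 a0 h; have := Lk_pos hw (kernB a0 h1 h2 h) (kernD a0 h1 h2).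
have i1 := ig_Lk2 hw h1 h1; have i2 := ig_Lk2 hw h2 h2.
rewrite (eq_RI (g := fun x => a ^+ 2 * Lk K1 w x ^+ 2 - Lk K2 w x ^+ 2)).
  by rewrite RIB ?RIZ ?subr_ge0 //; exact: igZ.
move=> x; have j1 := ig_delta2K x hw h1; have j2 := ig_delta2K x hw h2.
have EB : Lk (fun y => a * K1 y - K2 y) w x = a * Lk K1 w x - Lk K2 w x.
  rewrite /Lk -RIZ // -RIB //; last exact: igZ.
  by apply: eq_RI => y; ring.
have ED : Lk (fun y => a * K1 y + K2 y) w x = a * Lk K1 w x + Lk K2 w x.
  rewrite /Lk -RIZ // -RID //; last exact: igZ.
  by apply: eq_RI => y; ring.
rewrite EB ED; ring.
Qed.

Lemma Lk_energy C r w c K : nice C r w -> kern c s K ->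
  ig (fun y => K y * Gd w y) /\
  RI (fun y => K y * Gd w y) = - RI (fun x => Lk K w x * w x).
Proof.
move=> hw hK; have [hb _ _] := hw; have [mw wC _] := hb.
have [_ i1 ->] := Lk_pair hw hK mw wC.
have E y : K y * RI (fun x => delta2 w x y * w x) = - (K y * Gd w y).
  by rewrite (RI_delta2_self y hb) mulrN.
have i2 : ig (fun y => K y * Gd w y).
  by apply: eq_ig (igN i1) => y; rewrite E opprK.
by split=> //; rewrite (eq_RI E) RIN // opprK.
Qed.

Lemma Lk_energy_le C r w c K (t : R) : nice C r w -> kern c s K -> 0 < t ->
  2 * RI (fun y => K y * Gd w y) <=
    t * RI (fun x => Lk K w x ^+ 2) + t^-1 * RI (fun x => w x ^+ 2).
Proof.
move=> hw hK t0; have [hb _ _] := hw; have [mw wC _] := hb.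
have [_ ->] := Lk_energy hw hK; have i1 := ig_Lk2 hw hK hK.
have i2 : ig (fun x => w x * w x) by apply: ig_bcsM hb mw wC.
have [i3 _ _] := Lk_pair hw hK mw wC.
rewrite -RIN // -!RIZ //; last exact: igN.
rewrite -RID //; try exact: igZ.
apply: RI_le; [apply/igZ/igN/i3|by apply: igD; exact: igZ|] => x.
have ti : 0 <= t^-1 by rewrite invr_ge0 ltW.
have := mulr_ge0 ti (sqr_ge0 (t * Lk K w x + w x)).
rewrite (_ : t^-1 * _ = t * Lk K w x ^+ 2 + t^-1 * w x ^+ 2 + 2 * (Lk K w x * w x)); last first.
  by field; lra.
lra.
Qed.

End FixedS.
End Operators.

(** * Nash inequality *)

Section Nash.
Variables (R : realType) (n : nat).
Local Notation V := 'rV[R]_n.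
Implicit Types (w u v : V -> R) (x y z : V) (c C r lam h : R).

Lemma RI_CSw (k f g : V -> R) : (forall y, 0 <= k y) ->
  ig (fun y => k y * f y ^+ 2) -> ig (fun y => k y * g y ^+ 2) ->
  ig (fun y => k y * (f y * g y)) ->
  RI (fun y => k y * (f y * g y)) ^+ 2 <=
  RI (fun y => k y * f y ^+ 2) * RI (fun y => k y * g y ^+ 2).
Proof.
move=> k0 f2 g2 fg; apply: discr_le => [|t].
  by apply: RI_ge0 => y; rewrite mulr_ge0 ?sqr_ge0.
rewrite -!RIZ // -RID; try exact: igZ.
rewrite -RID //; last by apply: igD; exact: igZ.
apply: RI_ge0 => y; rewrite (_ : _ + _ = k y * (t * f y + g y) ^+ 2); last by ring.
by rewrite mulr_ge0 ?sqr_ge0.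
Qed.

(** Compare w with its translates, averaged with weight [a]: w(x)^2 + w(x+y)^2 is the squared
    increment plus 2 w(x) w(x+y), and |w(x) w(x+y)| integrated over all x and y is the square of the
    L^1 norm. This takes the place of the splitting into low and high frequencies. *)
Lemma Nash_pre C r w (a : V -> R) : bcs C r w -> ig a -> (forall y, 0 <= a y <= 1) ->
  ig (fun y => a y * Gd w y) ->
  RI a * RI (fun x => w x ^+ 2) <=
    2^-1 * RI (fun y => a y * Gd w y) + RI (fun x => `|w x|) ^+ 2.
Proof.
move=> hw ia a01 iaG; have [mw wC _] := hw.
have ma := ig_mf ia; have iw := ig_bcs hw; have C0 := bcs_ge0 hw.
pose N := RI (fun x => `|w x|); pose F x y := `|w x| * `|w (x + y)|.
have mF : mf2 F by rewrite /F; mm.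
have iF x : ig (F x).
  apply: igZ; apply: (eq_ig (f := fun y => `|w (y + x)|)); first by move=> y; rewrite addrC.
  exact: (ig_shift x (ig_abs iw)).
have RF x : RI (F x) = N * `|w x|.
  rewrite RIZ; last first.
    apply: (eq_ig (f := fun y => `|w (y + x)|)); first by move=> y; rewrite addrC.
    exact: (ig_shift x (ig_abs iw)).
  rewrite mulrC; congr (_ * _); rewrite /N -(RI_shift x (ig_abs iw)).
  by apply: eq_RI => y; rewrite addrC.
have FG x : RI (fun y => `|F x y|) <= N * `|w x|.
  by rewrite -RF le_eqVlt; apply/orP; left; apply/eqP; apply: eq_RI => y;
    rewrite ger0_norm // mulr_ge0.
have [_ I2 E] := Fubini_RI mF iF FG (igZ N (ig_abs iw)).
have i2 : ig (fun x => w x ^+ 2) by apply: ig_bcsM hw mw wC.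
have P y : RI (fun x => w x ^+ 2) <= RI (fun x => F x y) + 2^-1 * Gd w y.
  have ish := ig_shift y i2.
  have e : RI (fun x => w x ^+ 2) = RI (fun x => 2^-1 * w x ^+ 2 + 2^-1 * w (x + y) ^+ 2).
    rewrite RID; try exact: igZ.
    by rewrite (RIZ _ i2) (RIZ _ ish) (RI_shift y i2); field.
  have iFy : ig (fun x => F x y).
    apply: (ig_bcsM (C := C) (r := r) (D := C)) => [||x]; last by rewrite normr_id.
      have [_ _ w0] := hw; split=> [|x|x /w0 ->]; [mm|by rewrite normr_id|by rewrite normr0].
    by have h := mf_shift y mw; mm.
  rewrite e -RIZ; last exact: (ig_Gd y hw).
  have iG := igZ 2^-1 (ig_Gd y hw); rewrite -(RID iFy iG).
  apply: RI_le; [exact: (igD (igZ _ i2) (igZ _ ish))|exact: (igD iFy iG)|] => x.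
  rewrite /F -normrM; have := ler_norm (w x * w (x + y)); move: `|_| => z; lra.
have iaF : ig (fun y => a y * RI (fun x => F x y)).
  apply: (ig_le _ I2) => [|y].
    by have h := mf_RI (mf2_swap mF); mm.
  have /andP[a0 a1] := a01 y.
  have RF0 : 0 <= RI (fun x => F x y) by apply: RI_ge0 => x; rewrite mulr_ge0.
  by rewrite (ger0_norm (mulr_ge0 a0 RF0)) (ler_piMl RF0 a1).
have -> : RI (fun x => `|w x|) ^+ 2 = RI (fun y => RI (fun x => F x y)).
  by rewrite -E (eq_RI RF) (RIZ _ (ig_abs iw)) expr2.
rewrite mulrC -(RIZ _ ia) -(RIZ _ iaG) -(RID (igZ 2^-1 iaG) I2).
apply: RI_le; [exact: (igZ _ ia)|exact: (igD (igZ 2^-1 iaG) I2)|] => y.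
have /andP[a0 a1] := a01 y.
have RF0 : 0 <= RI (fun x => F x y) by apply: RI_ge0 => x; rewrite mulr_ge0.
have := P y; have := Gd_ge0 w y; move: (RI _) (RI _) (Gd w y) RF0 => A B G B0 G0 PP.
have q1 := ler_wpM2l a0 PP; have q2 : 0 <= (1 - a y) * B by apply: mulr_ge0 => //; rewrite subr_ge0.
move: q1 q2; lra.
Qed.

Section FixedS.
Variable s : R.
Hypotheses (s1 : 1 <= s) (s2 : s < 2).

(** The ellipticity bound alone would leave 2 - s in a denominator. By dilation and [Gd_double], the
    ball of radius h/2 carries at least the fraction 2^(s-2) of the energy of the ball of radius h.
    The annulus thus carries at most 1 - 2^(s-2) <= (2 - s) ln 2 of it, which cancels the
    denominator. *)
Lemma ann_energy C r w c K lam h : nice C r w -> kern c s K -> 0 < lam ->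
  (forall y, lam * kap s y <= K y) -> 0 < h -> h <= 1 ->
  ig (fun y => ann h y * Gd w y) /\
  RI (fun y => ann h y * Gd w y) <= h ^+ n.+1 * (ln 2 / lam) * RI (fun y => K y * Gd w y).
Proof.
move=> hw hK l0 hl h0 h1; have [hb _ _] := hw; have [mw _ _] := hb.
have [iE _] := Lk_energy s1 s2 hw hK; have t0 : 0 < 2 - s by rewrite subr_gt0.
have mG := mf_Gd mw; have mp := mf_pw (n := n) s.
pose P k y := chi k y * (pw s y * Gd w y).
have P_ge0 k y : 0 <= P k y by rewrite !mulr_ge0 ?chi_ge0 ?pw_ge0 ?Gd_ge0.
have PE k y : P k y <= (lam * (2 - s))^-1 * (K y * Gd w y).
  have l2 : 0 < lam * (2 - s) by exact: mulr_gt0.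
  rewrite ler_pdivlMl //; apply: (@le_trans _ _ (lam * (2 - s) * (pw s y * Gd w y))).
    by rewrite ler_pM2l // ler_piMl ?mulr_ge0 ?chi_le1 ?pw_ge0 ?Gd_ge0.
  rewrite mulrA ler_wpM2r ?Gd_ge0 //; apply: le_trans (hl y); rewrite /kap.
  by rewrite mulrA.
have iP k : ig (P k).
  apply: (ig_le _ (igZ (lam * (2 - s))^-1 iE)) => [|y].
    by have mk := mf_chi (n := n) k; rewrite /P; mm.
  by rewrite ger0_norm.
have half : RI (P (h / 2)) >= 2 `^ (s - 2) * RI (P h).
  have hh : 0 < 2^-1 :> R by rewrite invr_gt0.
  have := RI_scale hh (iP (h / 2)); rewrite invrK => e.
  have p0 : 0 < 2 ^+ n :> R by rewrite exprn_gt0.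
  rewrite -(ler_pM2l p0) -e mulrA -RIZ //.
  apply: RI_le => [||y]; [exact: igZ|exact: ig_scale|].
  have e3 : h / 2 / 2^-1 = h by rewrite invrK divfK.
  rewrite /P pw_scale // pow_half (pow2s s) chi_scale // e3.
  have gd := Gd_double (2^-1 *: y) hb; rewrite scalerA mulfV ?gt_eqF // scale1r in gd.
  have q0 : 0 <= chi h y * (2 ^+ n * 2 `^ (s - 2) * pw s y).
    by rewrite !mulr_ge0 ?chi_ge0 ?powR_ge0 ?pw_ge0.
  have H := ler_wpM2l q0 gd; apply: le_trans (le_trans _ H) _.
    by rewrite le_eqVlt; apply/orP; left; apply/eqP; ring.
  by rewrite le_eqVlt; apply/orP; left; apply/eqP; ring.
have iA : ig (fun y => ann h y * Gd w y).
  have [_ wC _] := hb.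
  have G2 y : Gd w y <= 4 * RI (fun x => w x ^+ 2).
    have i2 : ig (fun x => w x ^+ 2) by apply: ig_bcsM hb mw wC.
    have -> : 4 * RI (fun x => w x ^+ 2) = RI (fun x => 2 * w (x + y) ^+ 2 + 2 * w x ^+ 2).
      rewrite RID; [|exact: igZ (ig_shift y i2)|exact: igZ].
      rewrite !RIZ // ?(RI_shift y i2); [ring|exact: (ig_shift y i2)].
    apply: RI_le; [exact: (ig_Gd y hb)|apply: igD; apply: igZ => //; exact: (ig_shift y i2)|] => x.
    have := sqr_ge0 (w (x + y) + w x); nra.
  have ma := ig_mf (ig_ann (n := n) h).
  apply: (ig_le _ (igZ (4 * RI (fun x => w x ^+ 2)) (ig_ann (n := n) h))) => [|y]; first mm.
  have a0 : 0 <= ann h y by rewrite (annE y (ltW h0)) ler0n.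
  by rewrite ger0_norm ?mulr_ge0 ?Gd_ge0 // mulrC ler_wpM2r.
split=> //.
have hp : 0 < h ^+ n.+1 by rewrite exprn_gt0.
have i3 : ig (fun y => P h y - P (h / 2) y) by exact: igB.
apply: (@le_trans _ _ (h ^+ n.+1 * (RI (P h) - RI (P (h / 2))))).
  rewrite -RIB // -RIZ //; apply: RI_le => // [|y]; first exact: igZ.
  rewrite /P -mulrBl -/(ann h y) (annE _ (ltW h0)).
  case: andP => [[a1 a2]|_]; last by rewrite !mul0r mulr0.
  rewrite !mul1r mulrA ler_peMl ?Gd_ge0 // /pw powRN.
  have y0 : 0 < enorm y by apply: lt_le_trans a1; rewrite divr_gt0.
  rewrite ler_pdivlMr ?mul1r; last by rewrite powR_gt0.
  (* On the annulus |y| < h <= 1, so |y|^(n+s) <= h^(n+s) <= h^(n+1) because 1 <= s. *)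
  apply: (@le_trans _ _ (h `^ (n%:R + s))).
    have sn : 0 <= n%:R + s by apply: addr_ge0; [exact: ler0n|exact: le_trans s1].
    by apply: ge0_ler_powR => //; rewrite ?nnegrE ?enorm_ge0 ?(ltW h0) // ltW.
  rewrite -(powR_mulrn _ (ltW h0)); apply: ger_powR; first by rewrite h0.
  by rewrite -natr1 lerD2l.
rewrite -mulrA ler_pM2l //.
have f1 : RI (P h) <= (lam * (2 - s))^-1 * RI (fun y => K y * Gd w y).
  by rewrite -RIZ //; apply: RI_le => //; exact: igZ.
have f0 : 0 <= RI (P h) by exact: RI_ge0.
have f2 : 1 - 2 `^ (s - 2) <= (2 - s) * ln 2 := pow2B_lb s.
apply: (@le_trans _ _ ((2 - s) * ln 2 * RI (P h))); first by nra.
apply: le_trans (ler_wpM2l _ f1) _; first by rewrite mulr_ge0 ?ltW ?ln2_gt0.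
by rewrite le_eqVlt; apply/orP; left; apply/eqP; field; lra.
Qed.

(** Dividing [Nash_pre] by the volume of the annulus, of order h^n, leaves one factor h in front of
    the energy. Young's inequality with weight b h turns b h times the energy into half of (b h)^2
    times the squared norm of L w, plus half of the left-hand side, which is absorbed. A small h
    thus buys a small coefficient. *)
Lemma Nash C r w c K lam h : (0 < n)%N -> nice C r w -> kern c s K -> 0 < lam ->
  (forall y, lam * kap s y <= K y) -> 0 < h -> h <= 1 ->
  RI (fun x => w x ^+ 2) <=
    (ln 2 / (2 * lam * RI (@ann R n 1)) * h) ^+ 2 * RI (fun x => Lk K w x ^+ 2) +
    2 / (RI (@ann R n 1) * h ^+ n) * RI (fun x => `|w x|) ^+ 2.
Proof.
move=> n0 hw hK l0 hl h0 h1; have [hb _ _] := hw.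
have [iA A_le] := ann_energy hw hK l0 hl h0 h1.
have a01 y : 0 <= ann h y <= 1.
  by rewrite (annE y (ltW h0)) ler0n lern1 leq_b1.
have NP := Nash_pre hb (ig_ann h) a01 iA.
have a1 : 0 < RI (@ann R n 1) := ann_gt0 R n0.
move: NP; rewrite (RI_ann _ h0); set A := RI (@ann R n 1) in a1 *.
set W := RI (fun x => w x ^+ 2); set N2 := RI _ ^+ 2; move=> NP.
set E := RI (fun y => K y * Gd w y) in A_le.
set b := ln 2 / (2 * lam * A); have b0 : 0 < b by rewrite divr_gt0 ?mulr_gt0 ?ln2_gt0.
have hn : 0 < h ^+ n by rewrite exprn_gt0.
have Wle : W <= b * h * E + N2 / (A * h ^+ n).
  rewrite -(ler_pM2l (mulr_gt0 hn a1)); apply: le_trans NP _.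
  rewrite [X in _ <= X](_ : _ = 2^-1 * (h ^+ n.+1 * (ln 2 / lam) * E) + N2).
    by rewrite lerD2r ler_pM2l // invr_gt0.
  by rewrite /b exprS; field; rewrite !gt_eqF.
have bh : 0 < b * h by rewrite mulr_gt0.
have := Lk_energy_le s1 s2 hw hK bh; rewrite -/E -/W; set Q := RI _ => HE.
have : 2 * (b * h * E) <= (b * h) ^+ 2 * Q + W.
  have := ler_wpM2l (ltW bh) HE.
  rewrite (_ : b * h * (_ + _) = (b * h) ^+ 2 * Q + W); last by field; rewrite !gt_eqF.
  by rewrite mulrCA.
rewrite (_ : 2 / (A * h ^+ n) * N2 = 2 * (N2 / (A * h ^+ n))); last by ring.
lra.
Qed.

End FixedS.
End Nash.

(** * Cutoff functions *)

Section Step.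
Variable R : realType.
Implicit Types (a b t : R).

Definition pos2 t : R := Num.max t 0 ^+ 2.
(** Piecewise quadratic passage from 0 to 1 on [0, 1]: the second derivative is 4 on the first half,
    -4 on the second and 0 elsewhere. This is just regular enough for bounded second differences,
    and all its bounds reduce to polynomial inequalities. *)
Definition step t : R := 2 * pos2 t - 4 * pos2 (t - 2^-1) + 2 * pos2 (t - 1).

Lemma pos2_le0 t : t <= 0 -> pos2 t = 0.
Proof. by move=> h; rewrite /pos2 (max_idPr h) expr0n. Qed.

Lemma pos2_ge0 t : 0 <= t -> pos2 t = t ^+ 2.
Proof. by move=> h; rewrite /pos2 (max_idPl h). Qed.

Lemma pos2_delta t b : 0 <= pos2 (t + b) + pos2 (t - b) - 2 * pos2 t <= 2 * b ^+ 2.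
Proof.
have [h1|h1] := leP t 0; have [h2|h2] := leP (t + b) 0; have [h3|h3] := leP (t - b) 0;
  rewrite ?(pos2_le0 h1) ?(pos2_le0 h2) ?(pos2_le0 h3) ?(pos2_ge0 (ltW h1))
    ?(pos2_ge0 (ltW h2)) ?(pos2_ge0 (ltW h3)); apply/andP; split; nra.
Qed.

Lemma step_delta t b : `|step (t + b) + step (t - b) - 2 * step t| <= 8 * b ^+ 2.
Proof.
have /andP[a1 b1] := pos2_delta t b.
have /andP[a2 b2] := pos2_delta (t - 2^-1) b.
have /andP[a3 b3] := pos2_delta (t - 1) b.
rewrite /step ![t + b - _]addrAC ![t - b - _]addrAC ler_norml; apply/andP; split; lra.
Qed.

Lemma step_cases t : [\/ t <= 0 /\ step t = 0,
  (0 <= t <= 2^-1) /\ step t = 2 * t ^+ 2,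
  (2^-1 <= t <= 1) /\ step t = 1 - 2 * (1 - t) ^+ 2 | 1 <= t /\ step t = 1].
Proof.
rewrite /step; have [h1|h1] := leP t 0.
  constructor 1; split=> //.
  rewrite !pos2_le0 ?mulr0 //; [ring|lra|lra].
have [h2|h2] := leP t 2^-1.
  constructor 2; split; first by rewrite ltW.
  rewrite (pos2_ge0 (ltW h1)) (pos2_le0 (t := t - 2^-1)) ?(pos2_le0 (t := t - 1)); [ring|lra|lra].
have [h3|h3] := leP t 1.
  constructor 3; split; first by rewrite ltW.
  rewrite (pos2_ge0 (ltW h1)) (pos2_ge0 (t := t - 2^-1)) ?(pos2_le0 (t := t - 1)); [by field|lra|lra].
constructor 4; split; first by rewrite ltW.
rewrite (pos2_ge0 (ltW h1)) (pos2_ge0 (t := t - 2^-1)) ?(pos2_ge0 (t := t - 1)); [by field|lra|lra].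
Qed.

Lemma step01 t : 0 <= step t <= 1.
Proof.
by case: (step_cases t) => -[h ->]; apply/andP; split; nra.
Qed.

Lemma step_lip_le a b : a <= b -> `|step b - step a| <= 2 * (b - a).
Proof.
move=> ab; case: (step_cases a) => -[h ->]; case: (step_cases b) => -[h' ->];
  rewrite ler_norml; apply/andP; split; nra.
Qed.

Lemma step_lip a b : `|step b - step a| <= 2 * `|b - a|.
Proof.
have [h|h] := leP a b; first by rewrite (ger0_norm (x := b - a)) ?subr_ge0 // step_lip_le.
by rewrite distrC [`|b - a|]distrC (ger0_norm (x := a - b)) ?subr_ge0 ?(ltW h) // step_lip_le // ltW.
Qed.

Lemma measurable_step : measurable_fun setT step.
Proof. by rewrite /step /pos2; mm. Qed.

End Step.

Section Cutoff.
Variables (R : realType) (n : nat).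
Local Notation V := 'rV[R]_n.

Definition cutoff (M r rho : R) (eta : V -> R) :=
  [/\ mf eta, forall x, 0 <= eta x <= 1,
      forall x y, `|eta (x + y) - eta x| <= M * enorm y,
      forall x y, `|delta2 eta x y| <= M ^+ 2 * enorm y ^+ 2 &
      (forall x, enorm x <= r -> eta x = 1) /\ (forall x, rho <= enorm x -> eta x = 0)].

(** [step] is composed with a quadratic polynomial [q] of x, whose increments are exact, so the norm
    is never differentiated. As rho + r >= 1, the difference of squares [D] is at least the width
    [d]. The constant 16 is comfortable: the second difference costs 132 / d^2, below 16^2 / d^2. *)
Lemma cutoff_exists (r rho : R) : 2^-1 <= r -> r < rho -> rho <= 1 ->
  exists eta, cutoff (16 / (rho - r)) r rho eta.
Proof.
move=> r2 rr rho1; pose d := rho - r; pose D := rho ^+ 2 - r ^+ 2.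
have d0 : 0 < d by rewrite subr_gt0.
have dD : d <= D by rewrite /d /D; nra.
have D0 : 0 < D by lra.
have D1 : D <= 1 by rewrite /D; nra.
pose q (x : V) := (rho ^+ 2 - enorm x ^+ 2) / D.
pose eta x := step (q x).
have e01 x : 0 <= eta x <= 1 by exact: step01.
have e1 x : enorm x <= r -> eta x = 1.
  move=> hx; rewrite /eta; have h1 : 1 <= q x.
    rewrite /q ler_pdivlMr // mul1r /D lerD2l lerN2 ler_pXn2r ?nnegrE ?enorm_ge0 //; lra.
  by case: (step_cases (q x)) => -[h ->] //; nra.
have e0 x : rho <= enorm x -> eta x = 0.
  move=> hx; rewrite /eta; have h1 : q x <= 0.
    rewrite /q ler_pdivrMr // mul0r subr_le0 ler_pXn2r ?nnegrE ?enorm_ge0 //; lra.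
  by case: (step_cases (q x)) => -[h ->] //; nra.
have Mge : 16 <= 16 / d by rewrite ler_pdivlMr // ler_piMr //; lra.
have M0 : 0 <= 16 / d by lra.
have qE x y : q (x + y) = q x - 2 * dot x y / D - enorm y ^+ 2 / D.
  by rewrite /q enormD_sqr; ring.
have bound8 : 8 / D <= 8 / d by rewrite ler_pM2l // lef_pV2.
(* For |y| >= 1 the bounds follow from 0 <= eta <= 1. For |y| < 1 this disposes of |x| > 2, so that
   |dot x y| <= 2 |y| in what remains. *)
have far x : 2 < enorm x -> forall y, enorm y < 1 -> eta (x + y) = 0.
  move=> hx y hy; apply: e0; have := enorm_subl x y; lra.
exists eta; split => //.
- have me := mf_enorm (R := R) (n := n).
  have mq : mf q by rewrite /q; mm.
  exact: (measurableT_comp (@measurable_step R) mq).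
- move=> x y; have [hy|hy] := leP 1 (enorm y).
    have /andP[? ?] := e01 x; have /andP[? ?] := e01 (x + y).
    apply: (@le_trans _ _ 1); first by rewrite ler_norml; apply/andP; split; lra.
    rewrite -/d; nra.
  have [hx|hx] := leP (enorm x) 2; last first.
    rewrite (far x hx y hy) e0 ?subrr ?normr0 ?mulr_ge0 ?enorm_ge0 //; lra.
  apply: le_trans (step_lip _ _) _; rewrite qE.
  rewrite (_ : q x - _ - _ - q x = - ((2 * dot x y + enorm y ^+ 2) / D)); last by ring.
  rewrite normrN normrM (ger0_norm (x := D^-1)) ?invr_ge0 ?(ltW D0) //.
  have hd := dot_le x y; have y0 := enorm_ge0 y; have x0 := enorm_ge0 x.
  have h : `|2 * dot x y + enorm y ^+ 2| <= 8 * enorm y.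
    apply: le_trans (ler_normD _ _) _; rewrite normrM (ger0_norm (x := 2)) //.
    rewrite (ger0_norm (x := enorm y ^+ 2)) ?sqr_ge0 //; nra.
  apply: (@le_trans _ _ (16 / D * enorm y)).
    rewrite mulrA -[X in _ <= X]mulrAC ler_wpM2r ?invr_ge0 ?(ltW D0) //; lra.
  by rewrite ler_wpM2r // ler_pM2l // lef_pV2.
- move=> x y; have [hy|hy] := leP 1 (enorm y).
    have /andP[? ?] := e01 x; have /andP[? ?] := e01 (x + y); have /andP[? ?] := e01 (x - y).
    apply: (@le_trans _ _ 2).
      by rewrite /delta2 ler_norml; apply/andP; split; lra.
    rewrite -/d -exprMn; have h : 2 <= 16 / d * enorm y by nra.
    nra.
  have [hx|hx] := leP (enorm x) 2; last first.
    rewrite /delta2 (far x hx y hy) (far x hx (- y)) ?enormN // e0; last by lra.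
    by rewrite addr0 mulr0 subrr normr0 mulr_ge0 ?sqr_ge0.
  have hd := dot_le x y; have y0 := enorm_ge0 y; have x0 := enorm_ge0 x.
  pose b := 2 * dot x y / D; pose g := enorm y ^+ 2 / D.
  have g0 : 0 <= g by rewrite divr_ge0 ?sqr_ge0 // ltW.
  have E1 : q (x + y) = q x - b - g by rewrite qE.
  have E2 : q (x - y) = q x + b - g.
    rewrite qE enormN /b /g; congr (_ - _).
    have -> : dot x (- y) = - dot x y.
      by rewrite /dot -sumrN; apply: eq_bigr => i _; rewrite mxE mulrN.
    by ring.
  (* The part [b] of the increment odd in y is handled by the second difference of [step], the even
     part [g] by its Lipschitz bound. *)
  have s1 := step_lip (q x - b) (q (x + y)); have s2 := step_lip (q x + b) (q (x - y)).
  have s3 := step_delta (q x) b.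
  rewrite E1 (_ : q x - b - g - (q x - b) = - g) ?normrN ?(ger0_norm g0) in s1; last by ring.
  rewrite E2 (_ : q x + b - g - (q x + b) = - g) ?normrN ?(ger0_norm g0) in s2; last by ring.
  have T : `|delta2 eta x y| <= 4 * g + 8 * b ^+ 2.
    rewrite /delta2 /eta E1 E2; move: s1 s2 s3; rewrite !ler_norml.
    by move=> /andP[? ?] /andP[? ?] /andP[? ?]; apply/andP; split; lra.
  apply: le_trans T _.
  have hb : b ^+ 2 <= 16 * enorm y ^+ 2 / D ^+ 2.
    rewrite /b exprMn exprVn ler_pM2r ?invr_gt0 ?exprn_gt0 // exprMn.
    have : dot x y ^+ 2 <= (enorm x * enorm y) ^+ 2.
      by rewrite -[leLHS]real_normK ?num_real // ler_pXn2r ?nnegrE ?mulr_ge0.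
    rewrite exprMn; have : enorm x ^+ 2 <= 4 by nra.
    have := sqr_ge0 (enorm y); nra.
  have hg : g <= enorm y ^+ 2 / D ^+ 2.
    rewrite /g ler_wpM2l ?sqr_ge0 // lef_pV2 ?posrE ?exprn_gt0 //; nra.
  apply: (@le_trans _ _ (132 * (enorm y ^+ 2 / D ^+ 2))); first by lra.
  have hi : D ^- 2 <= d ^- 2 by rewrite lef_pV2 ?posrE ?exprn_gt0 //; nra.
  have Y0 := sqr_ge0 (enorm y); have hY := ler_wpM2l Y0 hi.
  have i0 : 0 <= enorm y ^+ 2 * D ^- 2 by rewrite mulr_ge0 // invr_ge0 sqr_ge0.
  rewrite exprMn exprVn -/d; move: hY i0; move: (D ^- 2) (d ^- 2) (enorm y ^+ 2) => *; lra.
Qed.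

End Cutoff.

Lemma sqr3_le (R : realDomainType) (p q u a b c : R) :
  p ^+ 2 <= a -> q ^+ 2 <= b -> u ^+ 2 <= c -> (p + q + u) ^+ 2 <= 3 * a + 3 * b + 3 * c.
Proof.
have := sqr_ge0 (p - q); have := sqr_ge0 (p - u); have := sqr_ge0 (q - u); lra.
Qed.

(** * Commutator with a cutoff *)

Section Comm.
Variables (R : realType) (n : nat).
Local Notation V := 'rV[R]_n.
Implicit Types (w u eta : V -> R) (x y z : V) (c C r lam h M : R).

Lemma cutoff_m1 M r rho eta x y : 2 <= M -> cutoff M r rho eta ->
  `|delta2 eta x y| <= M ^+ 2 * m1 y /\ (eta (x + y) - eta x) ^+ 2 <= M ^+ 2 * m1 y.
Proof.
move=> M2 [_ e01 e1 e2 _]; have /andP[? ?] := e01 x; have /andP[? ?] := e01 (x + y).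
have /andP[? ?] := e01 (x - y); have y0 := enorm_ge0 y.
have h1 := e1 x y; have h2 := e2 x y.
rewrite /m1; have [h|h] := leP 1 (enorm y ^+ 2).
  rewrite mulr1; split; last by nra.
  apply: (@le_trans _ _ 2); last by nra.
  by rewrite /delta2 ler_norml; apply/andP; split; lra.
split=> //; rewrite -exprMn -[leLHS]real_normK ?num_real // ler_pXn2r ?nnegrE ?mulr_ge0 //; lra.
Qed.

(** Discrete Leibniz rule: in (1 + M)^2 the terms 1, 2M and M^2 stand for both differences falling
    on w, one on each factor, and both on eta. *)
Lemma nice_cut M C r r1 rho eta w : 0 <= M -> cutoff M r1 rho eta -> nice C r w ->
  nice (C * (1 + M) ^+ 2) rho (fun x => eta x * w x).
Proof.
move=> M0 [me e01 e1 e2 [_ e0]] [hb w1 w2]; have [mw wC _] := hb; have C0 := bcs_ge0 hb.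
have eN x : `|eta x| <= 1 by have /andP[? ?] := e01 x; rewrite ger0_norm.
have k0 : C <= C * (1 + M) ^+ 2 by nra.
have cross x y : `|(w (x + y) - w x) * (eta (x + y) - eta x)| <= C * M * enorm y ^+ 2.
  rewrite normrM; have h1 := w1 x y; have h2 := e1 x y.
  by rewrite (_ : C * M * _ = (C * enorm y) * (M * enorm y)) ?ler_pM //; ring.
split.
- split=> [|x|x rx]; first mm.
    rewrite normrM (le_trans _ k0) // -[leRHS]mul1r ler_pM //.
  by rewrite e0 // mul0r.
- move=> x y; have y0 := enorm_ge0 y.
  rewrite (_ : _ - _ = eta (x + y) * (w (x + y) - w x) + w x * (eta (x + y) - eta x)); last by ring.
  apply: le_trans (ler_normD _ _) _; rewrite !normrM.
  have h1 : `|eta (x + y)| * `|w (x + y) - w x| <= C * enorm y.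
    by rewrite -[leRHS]mul1r ler_pM.
  have h2 : `|w x| * `|eta (x + y) - eta x| <= C * (M * enorm y) by rewrite ler_pM.
  apply: (@le_trans _ _ (C * (1 + M) * enorm y)); first by lra.
  by rewrite ler_wpM2r // ler_wpM2l //; nra.
- move=> x y; have y0 := sqr_ge0 (enorm y).
  have -> : delta2 (fun x => eta x * w x) x y = eta x * delta2 w x y + w x * delta2 eta x y
     + (w (x + y) - w x) * (eta (x + y) - eta x)
     + (w (x - y) - w x) * (eta (x - y) - eta x) by rewrite /delta2; ring.
  have h1 : `|eta x * delta2 w x y| <= C * enorm y ^+ 2.
    by rewrite normrM -[leRHS]mul1r ler_pM.
  have h2 : `|w x * delta2 eta x y| <= C * (M ^+ 2 * enorm y ^+ 2) by rewrite normrM ler_pM.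
  have h3 := cross x y; have h4 := cross x (- y); rewrite enormN in h4.
  apply: le_trans (ler_normD _ _) _; apply: le_trans (lerD (ler_normD _ _) (lexx _)) _.
  apply: le_trans (lerD (lerD (ler_normD _ _) (lexx _)) (lexx _)) _.
  rewrite (_ : C * (1 + M) ^+ 2 * _ = C * enorm y ^+ 2 + C * (M ^+ 2 * enorm y ^+ 2) + C * M * enorm y ^+ 2 + C * M * enorm y ^+ 2); last by ring.
  lra.
Qed.

Section FixedS.
Variable s : R.
Hypotheses (s1 : 1 <= s) (s2 : s < 2).
Local Notation kC := (kapC R n).

(* [L, eta] is of order s - 1 or less, so the energy of w suffices to bound it. *)
Lemma commutator M C r r1 rho eta w c K : 2 <= M -> cutoff M r1 rho eta ->
  nice C r w -> kern c s K ->
  ig (fun x => (Lk K (fun x => eta x * w x) x - eta x * Lk K w x) ^+ 2) /\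
  RI (fun x => (Lk K (fun x => eta x * w x) x - eta x * Lk K w x) ^+ 2) <=
   3 * (M ^+ 2 * (c * kC)) ^+ 2 * RI (fun x => w x ^+ 2) +
   6 * (M ^+ 2 * (c * kC)) * RI (fun y => K y * Gd w y).
Proof.
move=> M2 he hw hK; have M0 : 0 <= M by lra.
have hew := nice_cut M0 he hw; have [hb w1 w2] := hw; have [mw wC _] := hb.
have C0 := bcs_ge0 hb; have [me e01 _ _ _] := he; have [c0 mK _] := hK.
have K0 y : 0 <= K y := kern_ge0 y hK.
have [i1 r1_] := ig_m1K s1 s2 hK; set B := M ^+ 2 * (c * kC).
have B0 : 0 <= B.
  by rewrite !mulr_ge0 ?sqr_ge0 // (kapC_ge0 n s1 s2).
pose cm x := Lk K (fun x => eta x * w x) x - eta x * Lk K w x.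
(* The sign [e], always 1 or -1, selects the forward or the backward increment. In [cmE] the
   commutator is w L(eta) plus one cross term for each sign, and each cross term is bounded by
   Cauchy-Schwarz in y. *)
pose D2 e x y := (w (x + e *: y) - w x) ^+ 2.
pose H e x := RI (fun y => K y * D2 e x y).
have D2m e x y : `|e| = 1 -> D2 e x y <= 4 * C ^+ 2 * m1 y.
  move=> e1; rewrite /D2 /m1; have := wC (x + e *: y); have := wC x.
  have := w1 x (e *: y); rewrite enormZ e1 mul1r; have y0 := enorm_ge0 y.
  move: (w (x + e *: y)) (w x) => p q a1 a2 a3.
  have [h|h] := leP 1 (enorm y ^+ 2).
    by move: a2 a3; rewrite !ler_norml => /andP[? ?] /andP[? ?]; nra.
  apply: (@le_trans _ _ ((C * enorm y) ^+ 2)).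
    by rewrite -[(p - q) ^+ 2]real_normK ?num_real // ler_pXn2r ?nnegrE ?mulr_ge0.
  rewrite exprMn; apply: ler_wpM2r; first exact: sqr_ge0.
  have := sqr_ge0 C; lra.
have mD2 e : mf2 (D2 e) by rewrite /D2; mm.
have iD e x : `|e| = 1 -> ig (fun y => K y * D2 e x y).
  move=> e1; apply: (ig_le _ (igZ (4 * C ^+ 2) i1)) => [|y].
    by have h := mf2_sect x (mD2 e); mm.
  rewrite (ger0_norm (mulr_ge0 (K0 y) (sqr_ge0 _))).
  by rewrite mulrA [leLHS]mulrC; apply: ler_wpM2r => //; exact: D2m.
pose X2 e x y := (eta (x + e *: y) - eta x) ^+ 2.
have mX2 e : mf2 (X2 e) by rewrite /X2; mm.
have X2m e x y : X2 e x y <= M ^+ 2 * m1 y \/ `|e| != 1.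
  have [e1|] := eqVneq `|e| 1; last by right.
  left; have [_ h] := cutoff_m1 x (e *: y) M2 he.
  by apply: le_trans h _; rewrite /m1 enormZ e1 mul1r.
have iX e x : `|e| = 1 -> ig (fun y => K y * X2 e x y) /\ RI (fun y => K y * X2 e x y) <= B.
  move=> e1; have P y : K y * X2 e x y <= M ^+ 2 * (m1 y * K y).
    rewrite mulrA [leLHS]mulrC; apply: ler_wpM2r => //.
    by case: (X2m e x y) => //; rewrite e1 eqxx.
  have i : ig (fun y => K y * X2 e x y).
    apply: (ig_le _ (igZ (M ^+ 2) i1)) => [|y].
      by have h := mf2_sect x (mX2 e); mm.
    by rewrite (ger0_norm (mulr_ge0 (K0 y) (sqr_ge0 _))); exact: P.
  split=> //; apply: le_trans (RI_le i (igZ _ i1) P) _.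
  by rewrite (RIZ _ i1) /B ler_wpM2l ?sqr_ge0.
pose A e x := RI (fun y => K y * ((w (x + e *: y) - w x) * (eta (x + e *: y) - eta x))).
have iA e x : `|e| = 1 -> ig (fun y => K y * ((w (x + e *: y) - w x) * (eta (x + e *: y) - eta x))).
  move=> e1; have [iX1 _] := iX e x e1.
  apply: (ig_le _ (igD (iD e x e1) iX1)) => [|y].
    have h1 : mf2 (fun x y => w (x + e *: y) - w x) by mm.
    have h2 : mf2 (fun x y => eta (x + e *: y) - eta x) by mm.
    by have h3 := mf2_sect x h1; have h4 := mf2_sect x h2; mm.
  rewrite normrM (ger0_norm (K0 y)) -mulrDr ler_wpM2l // /D2 /X2 normrM.
  move: (w _ - _) (eta _ - _) => p q.
  rewrite -(real_normK (num_real p)) -(real_normK (num_real q)).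
  have := sqr_ge0 (`|p| - `|q|); have := normr_ge0 p; have := normr_ge0 q; nra.
have A2 e x : `|e| = 1 -> A e x ^+ 2 <= H e x * B.
  move=> e1; have [iX1 rX] := iX e x e1.
  apply: le_trans (RI_CSw K0 (iD e x e1) iX1 (iA e x e1)) _.
  by apply: ler_wpM2l rX; apply: RI_ge0 => y; rewrite mulr_ge0 ?sqr_ge0.
have [iE _] := Lk_energy s1 s2 hw hK.
have GE e y : e = 1 \/ e = -1 -> Gd w (e *: y) = Gd w y.
  by case=> ->; rewrite ?scale1r // scaleN1r (GdN y hb).
have HE e : e = 1 \/ e = -1 -> ig (H e) /\ RI (H e) = RI (fun y => K y * Gd w y).
  move=> e1; pose F y x := K y * D2 e x y.
  have mF : mf2 F by rewrite /F; have h := mf2_swap (mD2 e); mm.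
  have iF y : ig (F y) by apply: igZ; exact: (ig_Gd (e *: y) hb).
  have RF y : RI (F y) = K y * Gd w y.
    by rewrite (RIZ _ (ig_Gd (e *: y) hb)) -(GE e y e1).
  have FG y : RI (fun x => `|F y x|) <= K y * Gd w y.
    rewrite -RF le_eqVlt; apply/orP; left; apply/eqP; apply: eq_RI => x.
    by rewrite (ger0_norm (mulr_ge0 (K0 y) (sqr_ge0 _))).
  have [_ I2 E] := Fubini_RI mF iF FG iE.
  by split; [exact: I2|exact: (etrans (esym E) (eq_RI RF))].
pose T x := RI (fun y => delta2 eta x y * K y).
have mde : mf2 (delta2 eta) := mf2_delta2 me.
have P1 x y : `|delta2 eta x y * K y| <= M ^+ 2 * (m1 y * K y).
  rewrite normrM (ger0_norm (K0 y)) mulrA; apply: ler_wpM2r => //.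
  by have [] := cutoff_m1 x y M2 he.
have iT x : ig (fun y => delta2 eta x y * K y).
  apply: (ig_le _ (igZ (M ^+ 2) i1)) => [|y]; last exact: P1.
  by have h := mf2_sect x mde; mm.
have TB x : `|T x| <= B.
  apply: le_trans (RI_absle (iT x) (igZ _ i1) (P1 x)) _.
  by rewrite (RIZ _ i1) /B ler_wpM2l ?sqr_ge0.
have n1 : `|1 : R| = 1 by rewrite normr1.
have nN1 : `|-1 : R| = 1 by rewrite normrN1.
have cmE x : cm x = w x * T x + A 1 x + A (-1) x.
  rewrite /cm /Lk -(RIZ _ (ig_delta2K s1 s2 x hw hK)).
  rewrite -(RIB (ig_delta2K s1 s2 x hew hK) (igZ _ (ig_delta2K s1 s2 x hw hK))).
  rewrite -(RIZ _ (iT x)) -(RID (igZ _ (iT x)) (iA 1 x n1)).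
  rewrite -(RID (igD (igZ _ (iT x)) (iA 1 x n1)) (iA (-1) x nN1)).
  by apply: eq_RI => y; rewrite scale1r scaleN1r /delta2; ring.
have mcm : mf cm.
  have m3 : mf (fun x => eta x * w x) by mm.
  by have h1 := mf_Lk m3 mK; have h2 := mf_Lk mw mK; rewrite /cm; mm.
have [iH1 RH1] := HE 1 (or_introl erefl); have [iH2 RH2] := HE (-1) (or_intror erefl).
have i2 : ig (fun x => w x ^+ 2) by apply: ig_bcsM hb mw wC.
have j1 := igZ (3 * B ^+ 2) i2; have j2 := igZ (3 * B) iH1; have j3 := igZ (3 * B) iH2.
have cmB x : cm x ^+ 2 <= 3 * B ^+ 2 * w x ^+ 2 + 3 * B * H 1 x + 3 * B * H (-1) x.
  rewrite cmE.
  rewrite (_ : _ + 3 * B * H (-1) x =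
    3 * (B ^+ 2 * w x ^+ 2) + 3 * (B * H 1 x) + 3 * (B * H (-1) x)); last by ring.
  apply: sqr3_le.
  - rewrite exprMn mulrC; apply: ler_wpM2r; first exact: sqr_ge0.
    by rewrite -[leLHS]real_normK ?num_real // ler_pXn2r ?nnegrE.
  - by rewrite [leRHS]mulrC; exact: A2.
  - by rewrite [leRHS]mulrC; exact: A2.
have icm : ig (fun x => cm x ^+ 2).
  apply: (ig_le _ (igD (igD j1 j2) j3)) => [|x]; first mm.
  by rewrite (ger0_norm (sqr_ge0 _)); exact: cmB.
split; first exact: icm.
apply: le_trans (RI_le icm (igD (igD j1 j2) j3) cmB) _.
rewrite (RID (igD j1 j2) j3) (RID j1 j2) (RIZ _ i2) (RIZ _ iH1) (RIZ _ iH2) RH1 RH2.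
by rewrite le_eqVlt; apply/orP; left; apply/eqP; ring.
Qed.

End FixedS.
End Comm.

(** After N iterations the forcing terms form a geometric series of ratio th mu <= 1/2, and the
    remainder th^N Q_N is at most Y 2^-N. Hence [Y] is absent from the conclusion; it will depend on
    the regularity of the mollified function, which is not under control. *)
Lemma iter_bound (R : archiRealFieldType) (Q : nat -> R) (A Y th mu : R) :
  0 <= A -> 0 <= Y -> 0 <= th -> 0 <= mu -> th * mu <= 2^-1 -> th * 16 <= 2^-1 ->
  (forall k, Q k <= Y * 16 ^+ k) ->
  (forall k, Q k <= th * Q k.+1 + A * mu ^+ k) -> Q 0%N <= 2 * A.
Proof.
move=> A0 Y0 th0 mu0 thmu th16 QY Qrec.
have H N : Q 0%N <= 2 * A * (1 - 2^-1 ^+ N) + th ^+ N * Q N.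
  elim: N => [|N IH]; first by rewrite !expr0 subrr mulr0 add0r mul1r.
  apply: le_trans IH _.
  have := ler_wpM2l (exprn_ge0 N th0) (Qrec N).
  have : th ^+ N * mu ^+ N <= 2^-1 ^+ N.
    by rewrite -exprMn; apply: lerXn2r => //; rewrite nnegrE ?mulr_ge0 // invr_ge0.
  move=> /(ler_wpM2l A0); rewrite (exprSr th N) (exprSr 2^-1 N).
  move: (th ^+ N) (mu ^+ N) (2^-1 ^+ N) (Q N) (Q N.+1) => a b c q q'; lra.
have H2 N : Q 0%N <= 2 * A + Y * 2^-1 ^+ N.
  apply: le_trans (H N) _; apply: lerD.
    rewrite ler_piMr ?mulr_ge0 // gerBl exprn_ge0 // invr_ge0.
  apply: le_trans (ler_wpM2l (exprn_ge0 N th0) (QY N)) _.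
  rewrite mulrCA ler_wpM2l // -exprMn.
  by apply: lerXn2r => //; rewrite nnegrE ?mulr_ge0 // invr_ge0.
rewrite leNgt; apply/negP => lt.
have [N HN] : exists N : nat, Y * 2^-1 ^+ N < Q 0%N - 2 * A.
  have e0 : 0 < Q 0%N - 2 * A by lra.
  exists (Num.truncn (Y / (Q 0%N - 2 * A))).
  have := truncnS_gt (Y / (Q 0%N - 2 * A)); set N := Num.truncn _.
  rewrite ltr_pdivrMr // => h; rewrite exprVn ltr_pdivrMr ?exprn_gt0 //.
  apply: lt_le_trans h _; rewrite mulrC ler_wpM2l ?(ltW e0) //.
  by rewrite -natrX ler_nat ltn_expl.
have := H2 N; lra.
Qed.

(** * Localisation *)

Section Far.
Variables (R : realType) (n : nat).
Local Notation V := 'rV[R]_n.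
Implicit Types (w u eta : V -> R) (x y z : V) (c C r lam h M d : R).
Variable s : R.
Hypotheses (s1 : 1 <= s) (s2 : s < 2).
Local Notation kC := (kapC R n).

Lemma kern_far c K d y : kern c s K -> 0 < d -> d <= 1 -> d <= enorm y ->
  K y <= c * d ^- n.+2.
Proof.
move=> [c0 _ hK] d0 d1 dy; have /andP[_ h] := hK y; apply: le_trans h _.
apply: ler_wpM2l => //; rewrite /kap.
have h := pw_le s1 d0 dy; have p0 := pw_ge0 s y.
apply: (@le_trans _ _ (pw s y)); first by apply: ler_piMl => //; rewrite lerBlDr -[leLHS]/(1 + 1) lerD2l.
apply: le_trans h _; rewrite powRN lef_pV2 ?posrE ?powR_gt0 ?exprn_gt0 //.
rewrite -(powR_mulrn _ (ltW d0)); apply: ger_powR; first by rewrite d0.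
by rewrite -addn2 natrD lerD2l ltW.
Qed.

Lemma ig_around w x : ig w -> ig (fun y => `|w (x + y)| + `|w (x - y)|) /\
  RI (fun y => `|w (x + y)| + `|w (x - y)|) = 2 * RI (fun y => `|w y|).
Proof.
move=> iw; have ia := ig_abs iw.
have e1 : (fun y => `|w (y + x)|) =1 (fun y => `|w (x + y)|) by move=> y; rewrite addrC.
have i1 : ig (fun y => `|w (x + y)|) := eq_ig e1 (ig_shift x ia).
have i2 : ig (fun y => `|w (x - y)|) := ig_reflect x ia.
split; first exact: (igD i1 i2).
by rewrite (RID i1 i2) -(eq_RI e1) (RI_shift x ia) (RI_reflect x ia) mulr_natl mulr2n.
Qed.

(** The two second differences at x agree for |y| < d, where eta is 1. For |y| >= d the kernel is
    bounded, so the L^1 norm of w suffices. *)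
Lemma far_part M C r r1 rho eta w c K d x : 2 <= M -> cutoff M r1 rho eta ->
  nice C r w -> kern c s K -> 0 < d -> d <= 1 -> enorm x <= r1 - d ->
  `|Lk K w x - Lk K (fun x => eta x * w x) x| <= 2 * c * d ^- n.+2 * RI (fun y => `|w y|).
Proof.
move=> M2 he hw hK d0 d1 hx; have M0 : 0 <= M by lra.
have hew := nice_cut M0 he hw; have [hb _ _] := hw; have [_ _ _ _ [e1 _]] := he.
have [c0 _ _] := hK; have [iA RA] := ig_around x (ig_bcs hb).
have ii := igB (ig_delta2K s1 s2 x hw hK) (ig_delta2K s1 s2 x hew hK).
rewrite /Lk -(RIB (ig_delta2K s1 s2 x hw hK) (ig_delta2K s1 s2 x hew hK)).
rewrite (_ : 2 * c * _ * _ = c * d ^- n.+2 * (2 * RI (fun y => `|w y|))); last by ring.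
rewrite -RA -(RIZ _ iA); apply: (RI_absle ii (igZ _ iA)) => y.
have K0 := kern_ge0 y hK; have d2 : 0 <= d ^- n.+2 by rewrite invr_ge0 exprn_ge0 // ltW.
rewrite -mulrBl normrM (ger0_norm K0).
have [hy|hy] := ltP (enorm y) d.
  rewrite (_ : delta2 w x y - _ = 0) ?normr0 ?mul0r ?mulr_ge0 ?addr_ge0 //.
  rewrite /delta2 !e1; first by ring.
  - by have := enorm_ge0 y; lra.
  - have := enormB x y; lra.
  - have := enormD x y; lra.
have hk := kern_far hK d0 d1 hy.
rewrite mulrC; apply: ler_pM => //.
have [_ e01 _ _ _] := he.
rewrite /delta2 (e1 x); last by lra.
have eb z : `|w z - eta z * w z| <= `|w z|.
  have /andP[? ?] := e01 z.
  rewrite (_ : _ - _ = (1 - eta z) * w z); last by ring.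
  by rewrite normrM ler_piMl // ger0_norm; lra.
rewrite (_ : _ - _ = (w (x + y) - eta (x + y) * w (x + y)) + (w (x - y) - eta (x - y) * w (x - y))); last by ring.
by apply: le_trans (ler_normD _ _) _; exact: lerD.
Qed.

(** Squaring the pointwise bound of [Lk_le] would not be integrable, since L w has no compact
    support; instead L w is paired with itself through [Lk_pair]. What matters is the quadratic
    dependence on [C]. *)
Lemma Lk2_le C r w c K : nice C r w -> kern c s K ->
  RI (fun x => Lk K w x ^+ 2) <= 48 * C ^+ 2 * RI (@chi R n r) * (c * kC) ^+ 2.
Proof.
move=> hw hK; have [hb _ _] := hw; have [mw wC _] := hb; have C0 := bcs_ge0 hb.
have [c0 mK _] := hK; have [i1 r1] := ig_m1K s1 s2 hK; have kC0 := kapC_ge0 n s1 s2.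
have LB x := Lk_le s1 s2 x hw hK; have mL := mf_Lk mw mK.
have [_ I2 E] := Lk_pair s1 s2 hw hK mL LB.
apply: (@le_trans _ _ (RI (fun y => K y * RI (fun x => delta2 w x y * Lk K w x)))).
  by rewrite -E le_eqVlt; apply/orP; left; apply/eqP; apply: eq_RI => x; rewrite expr2.
set D := 4 * C * (c * kC) in LB.
have D0 : 0 <= D := le_trans (normr_ge0 _) (LB 0).
have V0 : 0 <= RI (@chi R n r) by apply: RI_ge0 => x; exact: chi_ge0.
have P y : K y * RI (fun x => delta2 w x y * Lk K w x) <= 12 * C * D * RI (@chi R n r) * (m1 y * K y).
  have K0 := kern_ge0 y hK.
  rewrite mulrC mulrA; apply: ler_wpM2r => //.
  have ic := ig_chi (n := n) r; have ish := ig_shift y ic; have ish' := ig_shift (- y) ic.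
  have i3 := igD (igD ic ish) ish'.
  have i4 := ig_delta2h y hw mL LB.
  have Q x : `|delta2 w x y * Lk K w x| <= 4 * C * m1 y * D * (chi r x + chi r (x + y) + chi r (x - y)).
    by rewrite normrM mulrAC ler_pM //; exact: (nice_delta2_chi _ _ hw).
  apply: le_trans (ler_norm _) _; apply: le_trans (RI_absle i4 (igZ _ i3) Q) _.
  rewrite (RIZ _ i3) (RID (igD ic ish) ish') (RID ic ish) (RI_shift y ic) (RI_shift (- y) ic).
  by rewrite le_eqVlt; apply/orP; left; apply/eqP; ring.
apply: le_trans (RI_le I2 (igZ _ i1) P) _; rewrite (RIZ _ i1).
apply: le_trans (ler_wpM2l _ r1) _; first by rewrite !mulr_ge0.
by rewrite le_eqVlt; apply/orP; left; apply/eqP; rewrite /D; ring.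
Qed.

End Far.

(** Here Q and Q' are the squared norms of L on two consecutive truncations, W and E the mass and
    the energy of the larger one, T2 the far field and N2 the squared L^1 norm. E is eliminated by
    Young, then W by Nash; X dominates the total coefficient of W. *)
Lemma absorb_alg (R : realFieldType) (Q Q' W E F0 T2 B t th X eh2 P N2 : R) :
  0 <= B -> 0 < t -> 0 <= Q' -> 0 <= W ->
  Q <= 3 * F0 + 3 * T2 + 3 * (3 * B ^+ 2 * W + 6 * B * E) ->
  2 * E <= t * Q' + t^-1 * W -> W <= eh2 * Q' + P * N2 ->
  9 * B * t <= th / 2 -> 9 * B ^+ 2 + 9 * B * t^-1 <= X -> X * eh2 <= th / 2 ->
  Q <= th * Q' + 3 * F0 + 3 * T2 + X * (P * N2).
Proof.
move=> B0 t0 Q0 W0 h1 h2 h3 h4 h5 h6.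
have t1 : 0 <= t^-1 by rewrite invr_ge0 ltW.
have X0 : 0 <= X.
  by apply: le_trans h5; rewrite addr_ge0 ?mulr_ge0 // exprn_ge0.
have := ler_wpM2l B0 h2; have := ler_wpM2r Q0 h4; have := ler_wpM2r W0 h5.
have := ler_wpM2l X0 h3; have := ler_wpM2r Q0 h6.
move: (t^-1) => it.
lra.
Qed.

(** Half of [th] is spent on the energy term, through t, and half on the Nash term, through h. Since
    B is of order M^2, t and h are taken of order M^-2 with [D] and [g] free of M. The loss is
    therefore a power of M. *)
Lemma step_const (R : realFieldType) (b e th M : R) : 0 <= b -> 0 <= e -> 0 < th -> th <= 1 -> 1 <= M ->
  let D := 9 * (b + 1) ^+ 2 * (1 + 18 / th) in
  let g := th / (2 + 2 * D * e ^+ 2) in let h := g / M ^+ 2 in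
  let t := th / (18 * M ^+ 2 * (b + 1)) in let B := M ^+ 2 * b in
  [/\ 0 < t, 0 < g, 0 < h, h <= 1 & [/\ 9 * B * t <= th / 2,
   9 * B ^+ 2 + 9 * B * t^-1 <= M ^+ 4 * D & M ^+ 4 * D * (e * h) ^+ 2 <= th / 2]].
Proof.
move=> b0 e0 th0 th1 M1 D g h t B.
have M0 : 0 < M by apply: lt_le_trans M1.
have M20 : 0 < M ^+ 2 by rewrite exprn_gt0.
have M21 : 1 <= M ^+ 2 by rewrite exprn_ege1.
have b1 : 0 < b + 1 by rewrite ltr_wpDl.
have D0 : 0 <= D by rewrite /D !mulr_ge0 ?exprn_ge0 ?addr_ge0 ?divr_ge0 ?(ltW th0) ?(ltW b1).
have De0 : 0 <= D * e ^+ 2 by rewrite mulr_ge0 ?sqr_ge0.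
have den : 0 < 2 + 2 * D * e ^+ 2 by rewrite -mulrA ltr_pwDl // mulr_ge0.
have g0 : 0 < g by rewrite divr_gt0.
have g1 : g <= 1 by rewrite ler_pdivrMr // mul1r -mulrA; move: (D * _) De0 => q; lra.
have t0 : 0 < t by rewrite divr_gt0 // !mulr_gt0.
split=> //; first by rewrite divr_gt0.
  by rewrite ler_pdivrMr // mul1r (le_trans g1).
split.
- rewrite (_ : 9 * B * t = b / (b + 1) * (th / 2)); last first.
    by rewrite /B /t; field; rewrite !(gt_eqF M0) (gt_eqF b1).
  by rewrite ler_piMl ?ler_pdivrMr ?mul1r ?lerDl ?divr_ge0 // ltW.
- rewrite (_ : t^-1 = 18 * M ^+ 2 * (b + 1) / th); last by rewrite /t invf_div.
  rewrite (_ : _ + _ = M ^+ 4 * (9 * (b ^+ 2 + 18 / th * (b * (b + 1))))); last first.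
    by rewrite /B; field; rewrite (gt_eqF th0).
  apply: ler_wpM2l; first by rewrite exprn_ge0 // ltW.
  rewrite /D -[leRHS]mulrA; apply: ler_wpM2l => //; rewrite [leRHS]mulrDr mulr1.
  apply: lerD; first by rewrite lerXn2r ?nnegrE ?(ltW b1) // lerDl.
  rewrite [leRHS]mulrC; apply: ler_wpM2l; first by rewrite divr_ge0 // ltW.
  by rewrite expr2; apply: ler_wpM2r; rewrite ?(ltW b1) // lerDl.
- rewrite (_ : _ * _ = D * e ^+ 2 * g * g); last first.
    by rewrite /h; field; rewrite (gt_eqF M0).
  apply: (@le_trans _ _ (D * e ^+ 2 * g)).
    by rewrite ler_piMr // mulr_ge0 // ltW.
  rewrite /g mulrA ler_pdivrMr //.
  rewrite (_ : th / 2 * _ = th + D * e ^+ 2 * th); last by field.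
  by rewrite lerDr ltW.
Qed.

Lemma split3 (R : nzRingType) (a e p q : R) : a = e * p + e * (q - p) + (a - e * q).
Proof. by rewrite mulrBr [e * p + _]addrC subrK addrC subrK. Qed.

Lemma drop3 (R : realDomainType) (p q a k t : R) : 0 <= p -> 0 <= q ->
  a ^+ 2 <= 3 * (p * k ^+ 2) + 3 * (t ^+ 2 * q) + 3 * a ^+ 2.
Proof.
move=> p0 q0; have := mulr_ge0 p0 (sqr_ge0 k); have := mulr_ge0 (sqr_ge0 t) q0.
have := sqr_ge0 a; lra.
Qed.

Lemma cancel_alg (R : fieldType) (m4 D A m gn N2 : R) : A != 0 -> gn != 0 -> m != 0 ->
  m4 * D * (2 / (A * (gn / m)) * N2) = 2 * D / (A * gn) * (m4 * m) * N2.
Proof. by move=> q1 q2 q3; field; rewrite q1 q2 q3. Qed.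

(** * A priori estimate *)

Section Iter.
Variables (R : realType) (n : nat).
Local Notation V := 'rV[R]_n.
Implicit Types (w u eta : V -> R) (x y z : V) (c C r lam h M d : R).
Local Notation kC := (kapC R n).

(** With w = eta u and w' = eta' u one has eta w' = w, as eta' is 1 on the support of eta. Hence L w
    = eta L u + eta (L w' - L u) + [L, eta] w': the datum, a far field and the commutator. The power
    of M is 4 from the commutator plus 2n from h^-n in the Nash inequality. *)
Lemma one_step c lam th : (0 < n)%N -> 0 <= c -> 0 < lam -> 0 < th -> th <= 1 ->
  exists2 Z : R, 0 <= Z & forall s C r u K M d rho r' rho' eta eta' F0,
   1 <= s -> s < 2 -> nice C r u -> kern c s K -> (forall y, lam * kap s y <= K y) ->
   2 <= M -> 0 < d -> d <= 1 -> d^-1 <= M -> rho <= 2^-1 + 2^-1 / 2 -> rho + d <= r' ->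
   cutoff M (rho - d) rho eta -> cutoff (2 * M) r' rho' eta' ->
   RI (fun x => chi (2^-1 + 2^-1 / 2) x * Lk K u x ^+ 2) <= F0 ->
   RI (fun x => Lk K (fun x => eta x * u x) x ^+ 2) <=
   th * RI (fun x => Lk K (fun x => eta' x * u x) x ^+ 2) + 3 * F0 +
   Z * M ^+ (n.+2 * 2) * RI (fun x => `|u x|) ^+ 2.
Proof.
move=> n0 c0 l0 th0 th1.
pose A := RI (@ann R n 1); pose b := c * kC; pose e := ln 2 / (2 * lam * A).
have A0 : 0 < A := ann_gt0 R n0.
have e0 : 0 <= e by rewrite divr_ge0 ?(ltW (ln2_gt0 R)) // !mulr_ge0 // ltW.
pose D := 9 * (b + 1) ^+ 2 * (1 + 18 / th).
pose g := th / (2 + 2 * D * e ^+ 2).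
pose V1 := RI (@chi R n 1).
have V0 : 0 < V1 := vol_gt0 R n.
(* The first term comes from the far field, the second from Nash. The absolute values are needed
   because the sign of [kapC], hence of [D] and [g], is known only once an admissible s is given. *)
exists (12 * c ^+ 2 * V1 + 2 * `|D| / (A * `|g| ^+ n)).
  apply: addr_ge0; first by rewrite !mulr_ge0 ?sqr_ge0 // ltW.
  by apply: divr_ge0; rewrite mulr_ge0 ?exprn_ge0 // ltW.
move=> s C r u K M d rho r' rho' eta eta' F0 s1 s2 hu hK hl M2 d0 d1 dM rho1 rr' he he' hF.
have kC0 : 0 <= kC := kapC_ge0 n s1 s2.
have b0 : 0 <= b by rewrite mulr_ge0.
have M1 : 1 <= M by apply: le_trans M2; rewrite ler1n.
have M0 : 0 <= M by apply: le_trans M1.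
have MM0 : 0 <= 2 * M by rewrite mulr_ge0.
have MM2 : 2 <= 2 * M by rewrite ler_peMr.
have [t0 g0 h0 h1 [k1 k2 k3]] := step_const b0 e0 th0 th1 M1.
set h := g / M ^+ 2 in h0 h1 k3.
set t := th / (18 * M ^+ 2 * (b + 1)) in t0 k1 k2.
pose w := fun x => eta x * u x; pose w' := fun x => eta' x * u x.
have hw : nice _ rho w := nice_cut M0 he hu.
have hw' : nice _ rho' w' := nice_cut MM0 he' hu.
have [[mu uC u0] _ _] := hu; have [[mw' w'C _] _ _] := hw'; have [[mw wC _] _ _] := hw.
have [c0' mK _] := hK.
have [me e01 _ _ [e1 e00]] := he; have [me' e01' _ _ [e1' _]] := he'.
have ew x : eta x * w' x = w x.
  rewrite /w' /w; have [hx|hx] := leP rho (enorm x); first by rewrite e00 // !mul0r.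
  rewrite e1' ?mul1r //; apply: le_trans (ltW hx) _; apply: le_trans rr'.
  by rewrite lerDl ltW.
have [icm cm_le] := commutator s1 s2 M2 he hw' hK.
have {}ew : (fun x => eta x * w' x) = w by apply/funext.
rewrite ew in icm cm_le.
set N1 := RI (fun x => `|u x|).
have N10 : 0 <= N1 by apply: RI_ge0.
set T := 2 * c * d ^- n.+2 * N1.
have T0 : 0 <= T by rewrite !mulr_ge0 // invr_ge0 exprn_ge0 // ltW.
have dLk x : enorm x < rho -> `|Lk K u x - Lk K w' x| <= T.
  move=> hx; apply: (far_part s1 s2 MM2 he' hu hK d0 d1).
  by rewrite lerBrDr (le_trans _ rr') // lerD2r ltW.
have iQ := ig_Lk2 s1 s2 hw hK hK; have iQ' := ig_Lk2 s1 s2 hw' hK hK.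
have mLu := mf_Lk mu mK; have LuB x := Lk_le s1 s2 x hu hK.
have i1 := ig_chi_sqr (2^-1 + 2^-1 / 2) mLu LuB.
have i2 := ig_chi (n := n) (1 : R).
have mLw := mf_Lk (mw' : mf w') mK.
have S1 : RI (fun x => Lk K w x ^+ 2) <= 3 * F0 + 3 * (T ^+ 2 * V1) +
    3 * (3 * (M ^+ 2 * b) ^+ 2 * RI (fun x => w' x ^+ 2) +
         6 * (M ^+ 2 * b) * RI (fun y => K y * Gd w' y)).
  have P x : Lk K w x ^+ 2 <= 3 * (chi (2^-1 + 2^-1 / 2) x * Lk K u x ^+ 2) +
      3 * (T ^+ 2 * chi 1 x) + 3 * (Lk K w x - eta x * Lk K w' x) ^+ 2.
    rewrite {1}(split3 (Lk K w x) (eta x) (Lk K u x) (Lk K w' x)).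
    have /andP[p0 p1] := e01 x.
    have [hx|hx] := leP rho (enorm x).
      rewrite e00 // !mul0r !add0r subr0.
      exact: drop3 (chi_ge0 _ _) (chi_ge0 _ _).
    have c1 : chi (2^-1 + 2^-1 / 2) x = 1 by rewrite /chi (lt_le_trans hx rho1).
    have c2 : chi 1 x = 1.
      by rewrite /chi (lt_le_trans hx) // (le_trans rho1) //; lra.
    rewrite c1 c2 mul1r mulr1; apply: sqr3_le => //.
      rewrite exprMn ler_piMl ?sqr_ge0 // expr_le1 //.
    rewrite -real_normK ?num_real // lerXn2r ?nnegrE // normrM (ger0_norm p0).
    rewrite distrC; apply: le_trans (dLk x hx); exact: ler_piMl.
  have j1 := igZ 3 i1; have j2 := igZ 3 (igZ (T ^+ 2) i2); have j3 := igZ 3 icm.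
  have iq : ig (fun x => Lk K w x ^+ 2) := iQ.
  apply: le_trans (RI_le iq (igD (igD j1 j2) j3) P) _.
  rewrite (RID (igD j1 j2) j3) (RID j1 j2) (RIZ _ i1) (RIZ _ (igZ (T ^+ 2) i2)) (RIZ _ i2) (RIZ _ icm).
  by apply: lerD; [apply: lerD => //; rewrite ler_wpM2l|rewrite ler_wpM2l].
have S2 := Lk_energy_le s1 s2 hw' hK t0.
have S3 := Nash s1 s2 n0 hw' hK l0 hl h0 h1.
have NN : RI (fun x => `|w' x|) <= N1.
  have iu := ig_abs (ig_bcs (let: And3 q _ _ := hu in q)).
  have iw := ig_abs (ig_bcs (let: And3 q _ _ := hw' in q)).
  apply: (RI_le iw iu) => x; rewrite /w' normrM; have /andP[p0 p1] := e01' x.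
  by rewrite (ger0_norm p0) ler_piMl.
have S3' : RI (fun x => w' x ^+ 2) <= (e * h) ^+ 2 * RI (fun x => Lk K w' x ^+ 2) +
    2 / (A * h ^+ n) * N1 ^+ 2.
  apply: le_trans S3 _; rewrite lerD2l ler_wpM2l //.
    by rewrite divr_ge0 // mulr_ge0 ?exprn_ge0 // ltW.
  by rewrite lerXn2r ?nnegrE // RI_ge0.
have B0 : 0 <= M ^+ 2 * b by rewrite mulr_ge0 ?sqr_ge0.
have Q'0 : 0 <= RI (fun x => Lk K w' x ^+ 2) by apply: RI_ge0 => x; exact: sqr_ge0.
have W'0 : 0 <= RI (fun x => w' x ^+ 2) by apply: RI_ge0 => x; exact: sqr_ge0.
have := absorb_alg B0 t0 Q'0 W'0 S1 S2 S3' k1 k2 k3.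
move=> fin; apply: le_trans fin _; rewrite -addrA lerD2l (_ : _ * `|g| ^+ n = A * g ^+ n); last first.
  by rewrite (ger0_norm (ltW g0)).
have D0 : 0 <= D.
  by rewrite /D !mulr_ge0 ?exprn_ge0 ?addr_ge0 ?divr_ge0 ?(ltW th0).
rewrite (ger0_norm D0) (mulrDl (12 * c ^+ 2 * V1)) (mulrDl (12 * c ^+ 2 * V1 * _)); apply: lerD.
  rewrite /T.
  rewrite (_ : 3 * _ = 12 * c ^+ 2 * V1 * (d ^- n.+2) ^+ 2 * N1 ^+ 2); last by ring.
  rewrite ler_wpM2r ?sqr_ge0 // ler_wpM2l ?mulr_ge0 ?sqr_ge0 ?(ltW V0) //.
  by rewrite -exprVn -exprM lerXn2r ?nnegrE ?invr_ge0 ?(ltW d0).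
rewrite le_eqVlt; apply/orP; left; apply/eqP.
rewrite /h expr_div_n -[in LHS]exprM.
have -> : (n.+2 * 2 = 4 + 2 * n)%N by rewrite mulnC mulnS mulnS addnA.
rewrite exprD; apply: cancel_alg; rewrite lt0r_neq0 ?exprn_gt0 //.
exact: lt_le_trans ltr01 M1.
Qed.

End Iter.

Lemma sum2_le (R : realDomainType) (p q T : R) : 0 <= T -> `|p - q| <= T ->
  p ^+ 2 <= 2 * q ^+ 2 + 2 * T ^+ 2.
Proof.
move=> T0 h; have h2 : (p - q) ^+ 2 <= T ^+ 2.
  by rewrite -real_normK ?num_real // lerXn2r ?nnegrE.
have := sqr_ge0 (p - 2 * q); lra.
Qed.

Lemma fin_alg (R : realFieldType) (q q' a F0 N2 Z1 V1 e N : R) : 0 <= F0 -> 0 <= Z1 -> 0 <= V1 ->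
  q' <= a ^+ 2 * q -> q <= 2 * (3 * F0 + Z1 * N ^+ 2) ->
  2 * q' + 2 * (2 * a * e * N) ^+ 2 * V1 <=
  (2 * a ^+ 2 * (6 + 2 * Z1) + 2 * V1 * (2 * a * e) ^+ 2) * (F0 + N ^+ 2).
Proof.
move=> F0_ Z0 V0 h1 h2; have := ler_wpM2l (sqr_ge0 a) h2.
have p1 := mulr_ge0 (mulr_ge0 (sqr_ge0 a) Z0) F0_.
have p2 := mulr_ge0 (sqr_ge0 a) (sqr_ge0 N).
have p3 := mulr_ge0 (mulr_ge0 V0 (sqr_ge0 (2 * a * e))) F0_.
move: h1 h2 p1 p2 p3; rewrite !exprMn; lra.
Qed.

Lemma pow_alg (R : comNzRingType) (Z m0 N2 : R) m k :
  Z * (m0 * 2 ^+ k) ^+ (m * 2) * N2 = Z * m0 ^+ (m * 2) * N2 * (4 ^+ m) ^+ k.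
Proof.
rewrite exprMn mulrA [RHS]mulrAC; congr (_ * _ * _).
have -> : 4 = 2 ^+ 2 :> R by rewrite -natrX.
by rewrite -!exprM; congr (_ ^+ _); rewrite mulnC (mulnC m) mulnA.
Qed.

Lemma dyad_step (R : realFieldType) (d d' : R) : 0 < d -> d <= 32^-1 -> d' = d / 2 ->
  [/\ d <= 1, 2^-1 + 2^-1 / 2 - 3 * d <= 2^-1 + 2^-1 / 2 &
   2^-1 + 2^-1 / 2 - 3 * d + d <= 2^-1 + 2^-1 / 2 - 3 * d' - d'].
Proof. by move=> d0 d1 ->; split; lra. Qed.

Lemma oneD_le (R : realDomainType) (m : R) : 2 <= m -> 1 + m <= 2 * m.
Proof. lra. Qed.

Lemma dyad_le1 (R : realFieldType) (d : R) : 0 < d -> 2^-1 + 2^-1 / 2 - 3 * d <= 1.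
Proof. lra. Qed.

Lemma dyad0_le (R : realFieldType) : (2^-1 : R) <=
  2^-1 + 2^-1 / 2 - 3 * (2 ^+ 0 * 32)^-1 - (2 ^+ 0 * 32)^-1 - 8^-1.
Proof. rewrite expr0; lra. Qed.

Section Apriori.
Variables (R : realType) (n : nat).
Local Notation V := 'rV[R]_n.
Implicit Types (w u eta : V -> R) (x y z : V) (c C r lam h M d : R).
Local Notation kC := (kapC R n).

Lemma apriori c lam a : (0 < n)%N -> 0 <= c -> 0 < lam -> 0 <= a ->
  exists2 Z : R, 0 <= Z & forall s C r u K K' c',
   1 <= s -> s < 2 -> nice C r u -> kern c s K -> (forall y, lam * kap s y <= K y) ->
   kern c' s K' -> c' <= a -> (forall y, K' y <= a * K y) ->
   RI (fun x => chi 2^-1 x * Lk K' u x ^+ 2) <=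
   Z * (RI (fun x => chi (2^-1 + 2^-1 / 2) x * Lk K u x ^+ 2) + RI (fun x => `|u x|) ^+ 2).
Proof.
move=> n0 c0 l0 a0.
(* The widths halve at each step, so M doubles and the loss M^(2(n+2)) of [one_step] is multiplied
   by 4^(n+2). *)
pose mu : R := 4 ^+ n.+2; pose th : R := (2 * mu)^-1.
have mu16 : 16 <= mu.
  by rewrite /mu (_ : 16 = 4 ^+ 2 :> R) ?ler_eXn2l ?ltr1n //; rewrite -natrX.
have mu0 : 0 < mu by apply: lt_le_trans mu16.
have th0 : 0 < th by rewrite invr_gt0 mulr_gt0.
have th1 : th <= 1.
  have q : 1 <= 2 * mu.
    by apply: le_trans (_ : mu <= _); [apply: le_trans mu16; rewrite ler1n|rewrite ler_peMl ?ler1n // ltW].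
  have q2 : 0 < 2 * mu by apply: lt_le_trans q.
  by rewrite /th invf_le1.
have [Z Z0 HZ] := one_step n0 c0 l0 th0 th1.
pose V1 := RI (@chi R n 1).
have V0 : 0 < V1 := vol_gt0 R n.
have [m0 em0] : exists m0 : R, m0 = 16 * 32 by eexists.
have m02 : 2 <= m0 by rewrite em0 -natrM ler_nat.
have m00 : 0 <= m0 by apply: le_trans m02.
pose Z1 := Z * m0 ^+ (n.+2 * 2).
have Z10 : 0 <= Z1 := mulr_ge0 Z0 (exprn_ge0 _ m00).
exists (2 * a ^+ 2 * (6 + 2 * Z1) + 2 * V1 * (2 * a * 8 ^+ n.+2) ^+ 2).
  apply: addr_ge0; last by apply: mulr_ge0 (sqr_ge0 _); apply: mulr_ge0 => //; exact: ltW.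
  apply: mulr_ge0; first by apply: mulr_ge0 (sqr_ge0 _).
  by apply: addr_ge0 => //; rewrite mulr_ge0.
move=> s C r u K K' c' s1 s2 hu hK hl hK' c'a hKK'.
set N1 := RI (fun x => `|u x|); set F0 := RI (fun x => chi (2^-1 + 2^-1 / 2) x * _).
have N10 : 0 <= N1 by apply: RI_ge0.
have F00 : 0 <= F0 by apply: RI_ge0 => x; rewrite mulr_ge0 ?chi_ge0 ?sqr_ge0.
have [hb _ _] := hu; have C0 := bcs_ge0 hb; have kC0 : 0 <= kC := kapC_ge0 n s1 s2.
(* The factor 3 in [rho] makes [rho k + d k] equal to [rho k.+1 - d k.+1], so each cutoff is 1 up to
   distance d_k beyond the support of the previous one. The factor 32 makes [rho 0 - d 0] equal to
   5/8, which leaves a margin 1/8 around the ball of radius 1/2. *)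
pose d k : R := (2 ^+ k * 32)^-1.
pose rho k : R := 2^-1 + 2^-1 / 2 - 3 * d k.
pose M k : R := m0 * 2 ^+ k.
have d0 k : 0 < d k by rewrite invr_gt0 mulr_gt0 ?exprn_gt0.
have dS k : d k.+1 = d k / 2 by rewrite /d exprS; field; rewrite expf_neq0.
have d32 k : d k <= 32^-1.
  by rewrite lef_pV2 ?posrE ?mulr_gt0 ?exprn_gt0 // ler_peMl // exprn_ege1 // ler1n.
have dM k : M k = 16 / d k by rewrite /M /d invrK em0; ring.
have M2 k : 2 <= M k.
  by rewrite /M; apply: (le_trans m02); rewrite ler_peMr // exprn_ege1 // ler1n.
have hcut k : exists eta : V -> R, cutoff (M k) (rho k - d k) (rho k) eta.
  have := d32 k; have := d0 k => p0 p32.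
  have e1 : M k = 16 / (rho k - (rho k - d k)) by rewrite dM; congr (_ / _); ring.
  by rewrite e1; apply: cutoff_exists; rewrite /rho; lra.
have [eta heta] := choice hcut.
pose Q k := RI (fun x => Lk K (fun x => eta k x * u x) x ^+ 2).
have Qrec k : Q k <= th * Q k.+1 + (3 * F0 + Z1 * N1 ^+ 2) * mu ^+ k.
  have h := HZ s C r u K (M k) (d k) (rho k) (rho k.+1 - d k.+1) (rho k.+1) (eta k) (eta k.+1) F0.
  have dM' : (d k)^-1 <= M k by rewrite dM ler_peMl ?ler1n // invr_ge0 ltW.
  have MS : M k.+1 = 2 * M k by rewrite /M exprS; ring.
  have := h s1 s2 hu hK hl (M2 k) (d0 k) _ dM' _ _ (heta k) _ (lexx _).
  have [q1 q2 q3] := dyad_step (d0 k) (d32 k) (dS k).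
  rewrite -MS => {}h; apply: le_trans (h _ _ _ (heta k.+1)) _.
  - exact: q1.
  - exact: q2.
  - exact: q3.
  rewrite -addrA lerD2l (mulrDl (3 * F0)); apply: lerD.
    by rewrite ler_peMr ?mulr_ge0 // exprn_ege1 // (le_trans _ mu16) // ler1n.
  by rewrite le_eqVlt; apply/orP; left; apply/eqP; exact: pow_alg.
(* Cutting off multiplies the constant of niceness by (1 + M_k)^2 <= (2 m0 2^k)^2, and [Lk2_le]
   squares it: hence growth like 16^k. *)
pose Y := 48 * (C * (2 * m0) ^+ 2) ^+ 2 * V1 * (c * kC) ^+ 2.
have QY k : Q k <= Y * 16 ^+ k.
  have M0 : 0 <= M k by apply: le_trans (M2 k).
  have hw := nice_cut M0 (heta k) hu.
  apply: le_trans (Lk2_le s1 s2 hw hK) _.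
  have -> : Y * 16 ^+ k = 48 * (C * ((2 * m0) * 2 ^+ k) ^+ 2) ^+ 2 * V1 * (c * kC) ^+ 2.
    rewrite /Y (_ : 16 = 2 ^+ 4); last by rewrite -natrX.
    by rewrite -exprM mulnC exprM; ring.
  apply: ler_wpM2r; first exact: sqr_ge0.
  have M1 : 0 <= 1 + M k by rewrite addr_ge0.
  have le1 : 1 + M k <= 2 * m0 * 2 ^+ k by rewrite -mulrA; apply: oneD_le (M2 k).
  have le2 : C * (1 + M k) ^+ 2 <= C * (2 * m0 * 2 ^+ k) ^+ 2.
    by apply: ler_wpM2l => //; rewrite lerXn2r ?nnegrE // (le_trans M1).
  have P0 : 0 <= C * (1 + M k) ^+ 2 := mulr_ge0 C0 (sqr_ge0 _).
  have le3 : 48 * (C * (1 + M k) ^+ 2) ^+ 2 <= 48 * (C * (2 * m0 * 2 ^+ k) ^+ 2) ^+ 2.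
    by apply: ler_wpM2l => //; rewrite lerXn2r ?nnegrE // (le_trans P0).
  have P1 : 0 <= 48 * (C * (1 + M k) ^+ 2) ^+ 2 := mulr_ge0 (ler0n _ _) (sqr_ge0 _).
  apply: (ler_pM P1 _ le3).
    by apply: RI_ge0 => x; exact: chi_ge0.
  apply: RI_le (ig_chi _) (ig_chi _) _ => x; apply: chi_mono.
  exact: dyad_le1 (d0 k).
have thmu : th * mu <= 2^-1.
  by rewrite /th invfM -mulrA mulVf ?mulr1 // gt_eqF.
have th16 : th * 16 <= 2^-1.
  by apply: le_trans thmu; rewrite ler_wpM2l // ltW.
have A0 : 0 <= 3 * F0 + Z1 * N1 ^+ 2.
  by apply: addr_ge0; [exact: mulr_ge0 (ler0n _ _) F00|exact: mulr_ge0 Z10 (sqr_ge0 _)].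
have Y0 : 0 <= Y.
  apply: mulr_ge0 (sqr_ge0 _); apply: mulr_ge0 (ltW V0).
  exact: mulr_ge0 (ler0n _ _) (sqr_ge0 _).
have Q0 := iter_bound A0 Y0 (ltW th0) (ltW mu0) thmu th16 QY Qrec.
have M00 : 0 <= M 0%N by apply: le_trans (M2 0%N).
(* The kernels are compared on the truncation, where [Lk_cmp] is available; the margin 1/8 then
   returns to u on the ball of radius 1/2 at the cost of its L^1 norm. *)
pose w := fun x => eta 0%N x * u x.
have hw : nice _ (rho 0%N) w := nice_cut M00 (heta 0%N) hu.
have hcmp := Lk_cmp s1 s2 hw hK hK' a0 hKK'.
have [c'0 mK' _] := hK'; have [mu_ _ _] := hb.
have d80 : 0 < (8^-1 : R) by rewrite invr_gt0.
have d81 : (8^-1 : R) <= 1 by rewrite invf_le1 // ler1n.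
set T := 2 * a * 8 ^+ n.+2 * N1.
have T0 : 0 <= T.
  exact: mulr_ge0 (mulr_ge0 (mulr_ge0 (ler0n _ _) a0) (exprn_ge0 _ (ler0n _ _))) N10.
have dL x : enorm x < 2^-1 -> `|Lk K' u x - Lk K' w x| <= T.
  move=> hx; apply: le_trans (far_part s1 s2 (M2 0%N) (heta 0%N) hu hK' d80 d81 _) _.
    by apply: le_trans (ltW hx) _; exact: dyad0_le.
  by rewrite -exprVn invrK /T ler_wpM2r // ler_wpM2r ?exprn_ge0 // ler_wpM2l.
have iL := ig_Lk2 s1 s2 hw hK' hK'.
have ichi := ig_chi (n := n) (1 : R).
have mLu := mf_Lk mu_ mK'; have LuB x := Lk_le s1 s2 x hu hK'.
have i1 := ig_chi_sqr 2^-1 mLu LuB.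
have P x : chi 2^-1 x * Lk K' u x ^+ 2 <= 2 * Lk K' w x ^+ 2 + 2 * T ^+ 2 * chi 1 x.
  have := chi_ge0 1 x => q1; rewrite {1}/chi; case: ltP => hx; last first.
    rewrite mul0r; apply: addr_ge0; first exact: mulr_ge0 (ler0n _ _) (sqr_ge0 _).
    by apply: mulr_ge0 q1; exact: mulr_ge0 (ler0n _ _) (sqr_ge0 _).
  rewrite mul1r (_ : chi 1 x = 1); last first.
    by rewrite /chi (lt_trans hx) // invf_lt1 // ltr1n.
  rewrite mulr1; apply: sum2_le => //; exact: dL.
apply: le_trans (RI_le i1 (igD (igZ 2 iL) (igZ (2 * T ^+ 2) ichi)) P) _.
rewrite (RID (igZ 2 iL) (igZ (2 * T ^+ 2) ichi)) (RIZ _ iL) (RIZ _ ichi) -/V1.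
apply: fin_alg hcmp Q0; rewrite ?(ltW V0) ?sqr_ge0 //.
Qed.

End Apriori.

(** * Test functions *)

Section FlatFunctions.
Variable R : realType.
Implicit Types (t e : R) (m : nat).

(** The family t^-m exp(-1/t) contains exp(-1/t), and the derivative of each member is a combination
    of members; smoothness thus reduces to one first-order computation. *)
Definition flat m t : R := if 0 < t then (t^-1) ^+ m * expR (- t^-1) else 0.

Lemma flat_le0 m t : t <= 0 -> flat m t = 0.
Proof. by rewrite /flat; case: ltP. Qed.

Lemma flat_ge0 m t : 0 <= flat m t.
Proof.
by rewrite /flat; case: ltP => // t0; rewrite mulr_ge0 ?expR_ge0 // exprn_ge0 // invr_ge0 ltW.
Qed.

(** A single term of the series, exp(1/t) >= t^(-m-2) / (m+2)!, is enough. The quadratic bound gives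
    the zero derivative at the origin. *)
Lemma flat_quad m : exists2 c : R, 0 <= c & forall t, `|flat m t| <= c * t ^+ 2.
Proof.
exists (m.+2`!%:R); first exact: ler0n.
move=> t; rewrite ger0_norm ?flat_ge0 // /flat; case: ltP => t0; last first.
  by rewrite mulr_ge0 ?sqr_ge0.
have p0 : 0 <= t^-1 by rewrite invr_ge0 ltW.
have := expR_ge1Dxn m.+1 p0; set F : R := m.+2`!%:R => h.
have F0 : 0 < F by rewrite ltr0n fact_gt0.
have h2 : t^-1 ^+ m.+2 / F <= expR t^-1 by apply: le_trans h; rewrite lerDr.
rewrite expRN ler_pdivrMr ?expR_gt0 //; move: h2; rewrite ler_pdivrMr // => h2.
have t20 : 0 <= t ^+ 2 by rewrite sqr_ge0.
have := ler_wpM2r t20 h2.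
rewrite -addn2 exprD -mulrA -exprMn mulVf ?gt_eqF // expr1n mulr1 => h3.
by apply: le_trans h3 _; rewrite le_eqVlt; apply/orP; left; apply/eqP; ring.
Qed.

Lemma is_derive_flat m t :
  is_derive t 1 (flat m) (- m%:R * flat m.+1 t + flat m.+2 t).
Proof.
have [t0|t0|->] := ltgtP t 0.
- rewrite !flat_le0 ?(ltW t0) // mulr0 addr0.
  apply: (@near_eq_is_derive R R R (cst 0)).
  by near=> s; rewrite flat_le0 // ltW //; near: s; exact: lt_nbhsl.
- have tn : t != 0 by rewrite gt_eqF.
  have d0 : derivable (fun s : R => s^-1) t 1 by apply: derivableV.
  have d1 : is_derive t 1 (fun s : R => s^-1) (- t ^- 2).
    split; first exact: d0.
    rewrite deriveV; [by rewrite derive_id [LHS]mulr1|exact: tn|exact: derivable_id].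
  have d2 := is_deriveX m d1.
  have dN : is_derive t 1 (fun s : R => - s^-1) (- - t ^- 2) by apply: is_deriveN.
  have dN1 : derivable (fun s : R => - s^-1) t 1 by case: dN.
  have dE : derivable expR (- t^-1) 1 by case: (is_derive_expR (- t^-1)).
  have d3 : is_derive t 1 (expR \o (fun s => - s^-1)) (expR (- t^-1) * (- - t ^- 2)).
    split.
      by apply/derivable1_diffP; apply: differentiable_comp; apply/derivable1_diffP; [exact: dN1|exact: dE].
    by rewrite -derive1E (derive1_comp dN1 dE) !derive1E !derive_val.
  apply: (near_eq_is_derive _ (is_derive_eq (is_deriveM d2 d3) _)).
    near=> s; have s0 : 0 < s by near: s; exact: lt_nbhsr.
    by rewrite /flat s0 /= !fctE.
  rewrite /flat t0 !fctE /GRing.scale /= opprK; case: (m) => [|k].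
    by rewrite !mul0r oppr0 !mul0r mulr0 add0r addr0 expr0 exprVn; ring.
  by rewrite /= -!exprVn !exprS; move: (t^-1) (expR _) => p E; ring.
- rewrite !flat_le0 // mulr0 addr0.
  have [c c0 hc] := flat_quad m.
  have cv : (fun h : R => h^-1 *: ((flat m \o shift 0) (h *: 1) - flat m 0)) @ 0^' --> (0 : R).
    apply/cvgrPdist_lt => e e0; near=> s.
    rewrite sub0r normrN /= (flat_le0 m (lexx 0)) subr0 addr0 [s *: 1]mulr1 [_ *: _]/(_ * _) normrM.
    have s0 : s != 0 by near: s; exact: nbhs_dnbhs_neq.
    have ns0 : 0 < `|s| by rewrite normr_gt0.
    apply: (@le_lt_trans _ _ (c * `|s|)).
      rewrite normfV mulrC ler_pdivrMr // (le_trans (hc s)) //.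
      by rewrite -mulrA -expr2 real_normK ?num_real.
    apply: (@le_lt_trans _ _ ((c + 1) * `|s|)); first by rewrite ler_wpM2r // lerDl.
    rewrite mulrC -ltr_pdivlMr ?ltr_wpDl //.
    near: s; apply: dnbhs0_lt; rewrite divr_gt0 // ltr_wpDl //.
  by split; [apply/cvg_ex; exists 0 | exact: cvg_lim cv].
Unshelve. all: by end_near. Qed.

Lemma flat_mono s t : 0 < s -> s <= t -> flat 0 s <= flat 0 t.
Proof.
move=> s0 st; have t0 := lt_le_trans s0 st.
by rewrite /flat s0 t0 !expr0 !mul1r ler_expR lerN2 lef_pV2.
Qed.

End FlatFunctions.

Section Smooth.
Variables (R : realType) (n : nat).
Local Notation V := 'rV[R]_n.
Implicit Types (f g q : V -> R) (x v a : V).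

(** An algebra of differentiable functions closed under directional derivatives, hence made of
    smooth functions; it contains the bumps without any formula for their higher derivatives. *)
Inductive flat_alg : (V -> R) -> Prop :=
| FA_cst c : flat_alg (fun=> c)
| FA_coord i : flat_alg (fun x => x ord0 i)
| FA_add f g : flat_alg f -> flat_alg g -> flat_alg (f + g)
| FA_mul f g : flat_alg f -> flat_alg g -> flat_alg (f * g)
| FA_flat m q : flat_alg q -> flat_alg (flat m \o q).

Lemma differentiable_flat m (t : R) : differentiable (@flat R m) t.
Proof. by apply/derivable1_diffP; case: (is_derive_flat m t). Qed.

Lemma FA_diff f : flat_alg f -> forall x, differentiable f x.
Proof.
elim=> [c|i|{}f g _ IHf _ IHg|{}f g _ IHf _ IHg|m q _ IH] x.
- exact: differentiable_cst.
- exact: differentiable_coord.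
- exact: differentiableD.
- exact: differentiableM.
- by apply: differentiable_comp => //; exact: differentiable_flat.
Qed.

Lemma derive_coord i x v : derive (fun x : V => x ord0 i : R) x v = v ord0 i.
Proof.
apply: lim_near_cst => //; near=> h.
rewrite /= !mxE addrK [LHS]mulrA mulVf ?mul1r //.
by near: h; exact: nbhs_dnbhs_neq.
Unshelve. all: by end_near. Qed.

Lemma FA_derive f v : flat_alg f -> flat_alg (fun x => derive f x v).
Proof.
have ext (g h : V -> R) : h =1 g -> flat_alg g -> flat_alg h by move=> /funext ->.
elim=> [c|i|{}f g hf IHf hg IHg|{}f g hf IHf hg IHg|m q hq IH].
- by apply: (ext (fun=> 0)); [move=> x; exact: derive_cst|exact: FA_cst].
- by apply: (ext (fun=> v ord0 i)); [move=> x; exact: derive_coord|exact: FA_cst].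
- apply: ext (FA_add IHf IHg) => x.
  by rewrite deriveD //; exact/diff_derivable/FA_diff.
- apply: ext (FA_add (FA_mul hf IHg) (FA_mul hg IHf)) => x.
  by rewrite deriveM //; exact/diff_derivable/FA_diff.
- pose d := (fun=> - m%:R : R) * (flat m.+1 \o q) + (flat m.+2 \o q).
  apply: (ext (d * (fun x => derive q x v))) => [x|].
    have dq := FA_diff hq x; have df := differentiable_flat m (q x).
    rewrite deriveE; last exact: differentiable_comp.
    rewrite diff_comp // deriv1E; last exact/derivable1_diffP.
    rewrite /= -deriveE // derive1E; have [_ ->] := is_derive_flat m (q x).
    by rewrite /d !fctE [RHS]mulrC.
  by apply: FA_mul IH; apply: FA_add; [apply: FA_mul; [exact: FA_cst|exact: FA_flat]|exact: FA_flat].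
Qed.

Lemma FA_smooth f : flat_alg f -> Defs.smooth f.
Proof.
move=> hf vs; suff : flat_alg (Defs.iterD vs f) by move=> /FA_diff.
by elim: vs => [|v vs IH] //=; exact: FA_derive.
Qed.

Definition bump0 (a : V) (e : R) x : R := flat 0 (e ^+ 2 - enorm (x - a) ^+ 2).

Lemma FA_sum (F : 'I_n -> V -> R) (r : seq 'I_n) : (forall i, flat_alg (F i)) ->
  flat_alg (fun x => \sum_(i <- r) F i x).
Proof.
have ext (g h : V -> R) : h =1 g -> flat_alg g -> flat_alg h by move=> /funext ->.
move=> hF; elim: r => [|i r IH].
  by apply: ext (FA_cst 0) => x; rewrite big_nil.
by apply: ext (FA_add (hF i) IH) => x; rewrite big_cons.
Qed.

Lemma smooth_bump0 a e  : Defs.smooth (bump0 a e).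
Proof.
have ext (g h : V -> R) : h =1 g -> flat_alg g -> flat_alg h by move=> /funext ->.
apply: FA_smooth; apply: FA_flat.
have hd i : flat_alg ((fun x => x ord0 i) + (fun=> - a ord0 i)) by do !constructor.
apply: ext (FA_add (FA_cst (e ^+ 2)) (FA_mul (FA_cst (-1)) (FA_sum (index_enum 'I_n) (fun i => FA_mul (hd i) (hd i))))).
move=> x; rewrite enorm_sqr !fctE mulN1r; congr (_ - _).
by apply: eq_bigr => i _; rewrite !mxE expr2.
Qed.

Lemma bump0_ge0 a e x : 0 <= bump0 a e x. Proof. exact: flat_ge0. Qed.

Lemma bump0_eq0 a e x : 0 <= e -> e <= enorm (x - a) -> bump0 a e x = 0.
Proof. by move=> e0 h; rewrite /bump0 flat_le0 // subr_le0 lerXn2r ?nnegrE ?enorm_ge0. Qed.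

End Smooth.

Section TestFunctions.
Variables (R : realType) (n : nat).
Local Notation V := 'rV[R]_n.
Implicit Types (f g phi : V -> R) (x y v a : V) (r rho e : R).

Lemma compact_enorm rho : compact [set x : V | enorm x <= rho].
Proof.
apply: bounded_closed_compact.
  exists (`|rho|); split; first exact: num_real.
  move=> N hN x /= hx; rewrite /Num.norm /= mx_normrE; apply/bigmax_leP; split.
    exact: le_trans (ltW hN).
  move=> [i j] _ /=; rewrite (ord1 i); apply: le_trans (coord_le x j) _.
  by apply: le_trans hx _; apply: le_trans (ler_norm _) (ltW hN).
rewrite (_ : [set x : V | _] = @enorm R n @^-1` [set t | t <= rho]) //.
by apply: preimage_closed; [move=> x _; exact: continuous_enorm|exact: closed_le].
Qed.

Lemma cc_bounded f rho : continuous f -> (forall x, rho < enorm x -> f x = 0) ->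
  exists2 C : R, 0 <= C & forall x, `|f x| <= C.
Proof.
move=> cf f0.
have [M [Mr hM]] : bounded_set (f @` [set x : V | enorm x <= rho]).
  apply: compact_bounded; apply: continuous_compact; last exact: compact_enorm.
  exact: continuous_subspaceT.
exists (`|M| + 1); first by rewrite addr_ge0.
move=> x; have [h|h] := leP (enorm x) rho; last by rewrite f0 // normr0 addr_ge0.
apply: hM; last by exists x.
by rewrite (le_lt_trans (ler_norm M)) // ltrDl.
Qed.

Lemma smooth_diff f x : Defs.smooth f -> differentiable f x.
Proof. by move=> /(_ [::] x). Qed.

Lemma smooth_continuous f : Defs.smooth f -> continuous f.
Proof. by move=> hf x; apply: differentiable_continuous; exact: smooth_diff. Qed.

Lemma smooth_derive f v : Defs.smooth f -> Defs.smooth (fun x => derive f x v).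
Proof.
move=> hf vs x; rewrite (_ : Defs.iterD vs _ = Defs.iterD (rcons vs v) f); first exact: hf.
by elim: vs => [|w vs IH] //=; rewrite IH.
Qed.

Lemma derive_supp f rho v x : (forall x, rho < enorm x -> f x = 0) ->
  rho < enorm x -> derive f x v = 0.
Proof.
move=> f0 hx; rewrite (near_eq_derive v (g := cst 0)); first exact: derive_cst.
have h : \forall y \near x, rho < enorm y.
  have c : {for x, continuous (@enorm R n)} := @continuous_enorm R n x.
  exact: (c [set t | rho < t] (lt_nbhsr hx)).
by apply: filterS h => y hy; rewrite f0.
Qed.

Lemma is_derive_line f x y (t : R) : Defs.smooth f ->
  is_derive t 1 (fun t : R => f (x + t *: y)) (derive f (x + t *: y) y).
Proof.
move=> hf; have dv : derivable f (x + t *: y) y := diff_derivable (smooth_diff (x + t *: y) hf).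
have E : (fun h : R => h^-1 *: (((fun t => f (x + t *: y)) \o shift t) (h *: 1) - f (x + t *: y))) =
    (fun h : R => h^-1 *: ((f \o shift (x + t *: y)) (h *: y) - f (x + t *: y))).
  apply/funext => h /=; congr (_ *: (f _ - _)).
  by rewrite [h *: 1]mulr1 scalerDl addrCA.
by split; [rewrite /derivable E|rewrite /derive E].
Qed.

Lemma derive_partial f x v : Defs.smooth f ->
  derive f x v = \sum_i v ord0 i * derive f x (delta_mx ord0 i).
Proof.
move=> hf; have df := smooth_diff x hf.
rewrite deriveE // {1}(row_sum_delta v) linear_sum; apply: eq_bigr => i _.
by rewrite linearZ /= deriveE.
Qed.

Lemma line_mvt (g dg : R -> R) : (forall t : R, is_derive t 1 g (dg t)) ->
  exists2 t : R, 0 <= t <= 1 & g 1 - g 0 = dg t.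
Proof.
move=> hg; have cg : {within `[0%R, 1%R], continuous g}.
  apply: continuous_subspaceT => t; apply: differentiable_continuous.
  by apply/derivable1_diffP; case: (hg t).
have [t + E] := MVT_segment ler01 (fun t _ => hg t) cg.
by rewrite in_itv /= => ht; exists t => //; rewrite E subr0 mulr1.
Qed.

Lemma smooth_lip f rho : Defs.smooth f -> (forall x, rho < enorm x -> f x = 0) ->
  exists2 L : R, 0 <= L & forall x y, `|f (x + y) - f x| <= L * enorm y.
Proof.
move=> hf f0.
have hD i : exists C : R, forall x, `|derive f x (delta_mx ord0 i)| <= C.
  have [C _ hC] := cc_bounded (smooth_continuous (smooth_derive (delta_mx ord0 i) hf))
     (fun x => derive_supp (delta_mx ord0 i) f0).
  by exists C.
have [C hC] := choice hD.
have C0 i : 0 <= C i := le_trans (normr_ge0 _) (hC i 0).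
exists (\sum_i C i); first exact: sumr_ge0.
move=> x y; have [t _] := line_mvt (fun t => is_derive_line x y t hf).
rewrite scale1r scale0r addr0 => ->; rewrite derive_partial //.
apply: le_trans (ler_norm_sum _ _ _) _; rewrite mulr_suml; apply: ler_sum => i _.
by rewrite normrM mulrC; apply: ler_pM => //; exact: coord_le.
Qed.

(** The mean value theorem for t -> f(x+ty) + f(x-ty) leaves first derivatives at two points 2t|y|
    apart. One factor |y| comes from the direction, the other from the Lipschitz bound of the
    partial derivatives. *)
Lemma smooth_delta2 f rho : Defs.smooth f -> (forall x, rho < enorm x -> f x = 0) ->
  exists2 L : R, 0 <= L & forall x y, `|delta2 f x y| <= L * enorm y ^+ 2.
Proof.
move=> hf f0.
have hD i : exists L : R, 0 <= L /\ forall x y,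
   `|derive f (x + y) (delta_mx ord0 i) - derive f x (delta_mx ord0 i)| <= L * enorm y.
  have [L L0 hL] := smooth_lip (smooth_derive (delta_mx ord0 i) hf)
     (fun x => derive_supp (delta_mx ord0 i) f0).
  by exists L.
have [L hL] := choice hD.
have L0 i : 0 <= L i by case: (hL i).
exists (\sum_i 2 * L i); first by apply: sumr_ge0 => i _; rewrite mulr_ge0.
move=> x y.
pose g (t : R) := f (x + t *: y) + f (x + t *: - y).
have hg (t : R) : is_derive t 1 g (derive f (x + t *: y) y + derive f (x + t *: - y) (- y)).
  have d1 := is_derive_line x y t hf; have d2 := is_derive_line x (- y) t hf.
  exact: is_deriveD.
have [t /andP[t0 t1]] := line_mvt hg.
rewrite /g !scale1r !scale0r !addr0 => E.
rewrite /delta2 (_ : 2 * f x = f x + f x) ?E; last by ring.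
rewrite (derive_partial _ y hf) (derive_partial _ (- y) hf) -big_split /=.
apply: le_trans (ler_norm_sum _ _ _) _; rewrite mulr_suml; apply: ler_sum => i _.
rewrite mxE mulNr -mulrBr normrM expr2 mulrA [leRHS]mulrC.
apply: ler_pM => //; first exact: coord_le.
have [_ h] := hL i.
have -> : x + t *: y = x + t *: - y + (2 * t) *: y.
  by rewrite -addrA; congr (_ + _); rewrite scalerN mulr_natl mulr2n scalerDl addKr.
apply: le_trans (h _ _) _; rewrite enormZ ger0_norm ?mulr_ge0 //.
rewrite mulrA; apply: ler_wpM2r; first exact: enorm_ge0.
by rewrite mulrC; apply: ler_wpM2r => //; rewrite ler_piMr.
Qed.

Lemma smooth_nice f rho r : Defs.smooth f -> (forall x, rho < enorm x -> f x = 0) ->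
  rho < r -> exists C : R, nice C r f.
Proof.
move=> hf f0 rr.
have [C1 p1 h1] := cc_bounded (smooth_continuous hf) f0.
have [C2 p2 h2] := smooth_lip hf f0; have [C3 p3 h3] := smooth_delta2 hf f0.
exists (C1 + C2 + C3); split; first split.
- exact: continuous_measurable (smooth_continuous hf).
- by move=> x; apply: le_trans (h1 x) _; rewrite -addrA lerDl addr_ge0.
- by move=> x hx; rewrite f0 // (lt_le_trans rr).
- move=> x y; apply: le_trans (h2 x y) _; rewrite ler_wpM2r ?enorm_ge0 //.
  by rewrite addrAC lerDr addr_ge0.
- move=> x y; apply: le_trans (h3 x y) _; rewrite ler_wpM2r ?sqr_ge0 //.
  by rewrite lerDr addr_ge0.
Qed.

Lemma test_nice r phi : test_fun r phi -> exists C rho : R, rho < r /\ nice C rho phi.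
Proof.
move=> [hf [rho [rr f0]]].
have [C hC] := smooth_nice hf f0 (midf_lt rr).1.
by exists C, ((rho + r) / 2); split=> //; exact: (midf_lt rr).2.
Qed.

Lemma iterD_lin f g (c : R) : Defs.smooth f -> Defs.smooth g ->
  forall vs, Defs.iterD vs (fun x => f x + c * g x) =
    (Defs.iterD vs f) + (c \*: Defs.iterD vs g).
Proof.
move=> hf hg; elim=> [|v vs IH] //=; rewrite IH; apply/funext => x.
have d1 : derivable (Defs.iterD vs f) x v := diff_derivable (hf vs x).
have d2 : derivable (Defs.iterD vs g) x v := diff_derivable (hg vs x).
by rewrite (deriveD d1 (derivableZ (k := c) d2)) (deriveZ _ d2).
Qed.

Lemma smooth_lin f g (c : R) : Defs.smooth f -> Defs.smooth g ->
  Defs.smooth (fun x => f x + c * g x).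
Proof.
move=> hf hg vs x; rewrite iterD_lin //.
by apply: differentiableD; [exact: hf|apply: differentiableZ; exact: hg].
Qed.

Lemma test_lin r f g (c : R) : test_fun r f -> test_fun r g ->
  test_fun r (fun x => f x + c * g x).
Proof.
move=> [hf [r1 [q1 f1]]] [hg [r2 [q2 g2]]]; split; first exact: smooth_lin.
exists (Num.max r1 r2); split=> [|x]; first by rewrite gt_max q1.
by rewrite gt_max => /andP[h1 h2]; rewrite f1 // g2 // mulr0 addr0.
Qed.

Lemma smooth_cst0 : Defs.smooth (fun _ : V => 0 : R).
Proof. by apply: FA_smooth; exact: FA_cst. Qed.

Lemma test0 r : test_fun r (fun _ : V => 0 : R).
Proof. by split; [exact: smooth_cst0|exists (r - 1); split=> //; rewrite ltrBlDr ltrDl]. Qed.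

Lemma bump0_int (e : R) : 0 < e -> ig (@bump0 R n 0 e) /\ 0 < RI (@bump0 R n 0 e).
Proof.
move=> e0; have e20 : 0 < e / 2 by rewrite divr_gt0.
have supp (x : V) : e < enorm x -> bump0 0 e x = 0.
  by move=> h; apply: bump0_eq0; [exact: ltW|rewrite subr0 ltW].
have [C [hb _ _]] := smooth_nice (smooth_bump0 0 e) supp (ltr_pwDr ltr01 (lexx e)).
have ib := ig_bcs hb; split=> //.
pose q : R := flat 0 (e ^+ 2 - (e / 2) ^+ 2).
have p0 : 0 < e ^+ 2 - (e / 2) ^+ 2.
  by rewrite subr_gt0 ltrXn2r ?nnegrE ?(ltW e20) ?(ltW e0) // ltr_pdivrMr // ltr_pMr // ltr1n.
have q0 : 0 < q by rewrite /q /flat p0 expr0 mul1r expR_gt0.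
have ic := ig_chi (n := n) (e / 2).
apply: (@lt_le_trans _ _ (RI (fun x => q * chi (e / 2) x))).
  rewrite (RIZ _ ic) (RI_chi n e20); apply: mulr_gt0 => //; apply: mulr_gt0; last exact: vol_gt0.
  exact: exprn_gt0.
apply: (RI_le (igZ q ic) ib) => x; rewrite /chi; case: ltP => hx; last by rewrite mulr0 bump0_ge0.
rewrite mulr1 /bump0 subr0; apply: flat_mono => //; rewrite lerD2l lerN2.
by rewrite lerXn2r ?nnegrE ?enorm_ge0 ?(ltW e20) // ltW.
Qed.

Definition mol (e : R) x : R := bump0 0 e x / RI (@bump0 R n 0 e).

Lemma mol_ge0 e x : 0 < e -> 0 <= mol e x.
Proof. by move=> e0; have [_ h] := bump0_int e0; rewrite divr_ge0 ?bump0_ge0 // ltW. Qed.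

Lemma mol_eq0 e x : 0 < e -> e <= enorm x -> mol e x = 0.
Proof. by move=> e0 h; rewrite /mol bump0_eq0 ?mul0r ?subr0 // ltW. Qed.

Lemma molN e x : mol e (- x) = mol e x.
Proof. by rewrite /mol /bump0 !subr0 enormN. Qed.

Lemma smooth_mol e x : Defs.smooth (fun z => mol e (x - z)).
Proof.
have := smooth_lin (RI (@bump0 R n 0 e))^-1 smooth_cst0 (smooth_bump0 x e).
rewrite (_ : (fun _ => _) = (fun z => mol e (x - z))) //.
by apply/funext => z; rewrite add0r mulrC /mol /bump0 subr0 -(enormN (z - x)) opprB.
Qed.

Lemma test_mol e x r : 0 < e -> enorm x + e < r -> test_fun r (fun z => mol e (x - z)).
Proof.
move=> e0 h; split; first exact: smooth_mol.
exists (enorm x + e); split=> // z hz; apply: mol_eq0 => //.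
by have := enorm_subl z (- x); rewrite enormN -[z - x]opprB enormN; lra.
Qed.

Lemma nice_mol e : 0 < e -> exists C : R, nice C (2 * e) (mol e).
Proof.
move=> e0; have := smooth_mol e 0.
rewrite (_ : (fun z => _) = mol e); last by apply/funext => z; rewrite sub0r molN.
move=> h; apply: (smooth_nice h (rho := e)) => [x hx|]; last by rewrite ltr_pMl // ltr1n.
by apply: mol_eq0 => //; exact: ltW.
Qed.

Lemma RI_mol e : 0 < e -> ig (mol e) /\ RI (mol e) = 1.
Proof.
move=> e0; have [ib p] := bump0_int e0.
have E x : (RI (@bump0 R n 0 e))^-1 * bump0 0 e x = mol e x by rewrite mulrC.
split; first exact: eq_ig E (igZ _ ib).
by rewrite -(eq_RI E) (RIZ _ ib) mulVf // gt_eqF.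
Qed.

End TestFunctions.

(** * Mollification *)

Section Convolution.
Variables (R : realType) (n : nat).
Local Notation V := 'rV[R]_n.
Implicit Types (w u rho : V -> R) (x y z : V) (c C r : R).

Definition convol u rho x := RI (fun z => u z * rho (x - z)).

Lemma mf2_convk rho : mf rho -> mf2 (fun x z => rho (x - z)).
Proof. by move=> mr; mm. Qed.

Lemma ig_convb C r u rho x : ig u -> mf rho -> (forall x, `|rho x| <= C) ->
  ig (fun z => u z * rho (x - z)) /\
  `|RI (fun z => u z * rho (x - z))| <= C * RI (fun z => `|u z|).
Proof.
move=> iu mr hC; have mu := ig_mf iu; have iC := igZ C (ig_abs iu).
have H z : `|u z * rho (x - z)| <= C * `|u z| by rewrite normrM mulrC ler_wpM2r.
have ii : ig (fun z => u z * rho (x - z)).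
  by apply: (ig_le _ iC H); have h := mf2_sect x (mf2_convk mr); mm.
by split=> //; rewrite -(RIZ _ (ig_abs iu)); exact: RI_absle.
Qed.

Lemma conv_nice C r r0 u rho : ig u -> (forall x, r0 <= enorm x -> u x = 0) ->
  nice C r rho -> nice (C * RI (fun z => `|u z|)) (r0 + r) (convol u rho).
Proof.
move=> iu u0 [[mr rC r1] hL h2]; have mu := ig_mf iu; have mk := mf2_convk mr.
have B x := (ig_convb r x iu mr rC).2; have I x := (ig_convb r x iu mr rC).1.
split; first split.
- by apply: (mf_RI (F := fun x z => u z * rho (x - z))); mm.
- exact: B.
- move=> x hx; rewrite /convol (eq_RI (g := fun=> 0)) ?RI0 // => z.
  have [h|h] := leP r0 (enorm z); first by rewrite u0 // mul0r.
  by rewrite r1 ?mulr0 //; have := enorm_subl x (- z); rewrite enormN; lra.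
- move=> x y; rewrite /convol -(RIB (I (x + y)) (I x)) mulrAC.
  rewrite -(RIZ _ (ig_abs iu)); apply: RI_absle (igB (I _) (I _)) (igZ _ (ig_abs iu)) _ => z.
  rewrite -mulrBr normrM mulrC; apply: ler_wpM2r => //.
  by have := hL (x - z) y; rewrite addrAC.
- move=> x y; rewrite /delta2 /convol.
  have i1 := igD (I (x + y)) (I (x - y)).
  rewrite -(RID (I (x + y)) (I (x - y))) -(RIZ 2 (I x)) -(RIB i1 (igZ 2 (I x))) mulrAC.
  rewrite -(RIZ _ (ig_abs iu)); apply: RI_absle (igB i1 (igZ 2 (I x))) (igZ _ (ig_abs iu)) _ => z.
  rewrite mulrCA -mulrDr -mulrBr normrM mulrC; apply: ler_wpM2r => //.
  by have := h2 (x - z) y; rewrite /delta2 ![x - z + _]addrAC.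
Qed.

Lemma conv_L1 C r u rho : ig u -> nice C r rho -> (forall x, 0 <= rho x) -> RI rho = 1 ->
  RI (fun x => `|convol u rho x|) <= RI (fun x => `|u x|) /\
  forall g D, mf g -> (forall x, `|g x| <= D) ->
  [/\ ig (fun x => convol u rho x * g x), ig (fun z => u z * RI (fun t => rho t * g (z + t))) &
  RI (fun x => convol u rho x * g x) = RI (fun z => u z * RI (fun t => rho t * g (z + t)))].
Proof.
move=> iu [hb _ _] r0 r1; have [mr rC _] := hb; have mu := ig_mf iu; have ir := ig_bcs hb.
have mk := mf2_convk mr; have B x := (ig_convb r x iu mr rC).2.
have I x := (ig_convb r x iu mr rC).1.
have H g D : mf g -> (forall x, `|g x| <= D) ->
  [/\ ig (fun x => convol u rho x * g x), ig (fun z => u z * RI (fun t => rho t * g (z + t))) &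
  RI (fun x => convol u rho x * g x) = RI (fun z => u z * RI (fun t => rho t * g (z + t)))].
  move=> mg gD; have D0 : 0 <= D := le_trans (normr_ge0 _) (gD 0).
  pose F z x := u z * (rho (x - z) * g x).
  have mF : mf2 F by have h := mf2_swap mk; rewrite /F; mm.
  have irz z : ig (fun x => rho (x - z)) := ig_shift (- z) ir.
  have Rrz z : RI (fun x => rho (x - z)) = 1 by rewrite (RI_shift (- z) ir).
  have igr z : ig (fun x => rho (x - z) * g x).
    apply: (ig_le _ (igZ D (irz z))) => [|x].
      by have h := mf2_sect z (mf2_swap mk); mm.
    by rewrite normrM mulrC (ger0_norm (r0 _)) ler_wpM2r.
  have iF z : ig (F z) by exact: igZ.
  have bF z : RI (fun x => `|F z x|) <= D * `|u z|.
    have E x : `|F z x| <= `|u z| * (D * rho (x - z)).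
      rewrite /F !normrM (ger0_norm (r0 _)); apply: ler_wpM2l => //.
      by rewrite mulrC ler_wpM2r.
    have ii := igZ (`|u z|) (igZ D (irz z)).
    apply: le_trans (RI_le (ig_abs (iF z)) ii E) _.
    by rewrite (RIZ _ (igZ D (irz z))) (RIZ _ (irz z)) Rrz mulr1 mulrC.
  have [i1 i2 E] := Fubini_RI mF iF bF (igZ D (ig_abs iu)).
  have e1 z : RI (F z) = u z * RI (fun t => rho t * g (z + t)).
    rewrite /F (RIZ _ (igr z)) -(RI_shift z (igr z)); congr (_ * _).
    by apply: eq_RI => t; rewrite addrK addrC.
  have e2 x : RI (fun z => F z x) = convol u rho x * g x.
    rewrite mulrC /convol -(RIZ _ (I x)); apply: eq_RI => z.
    by rewrite /F mulrA mulrC.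
  split; [exact: eq_ig i2|exact: eq_ig i1|].
  by rewrite -(eq_RI e1) -(eq_RI e2) E.
split=> //.
have mc : mf (convol u rho) by apply: (mf_RI (F := fun x z => u z * rho (x - z))); mm.
(* The L^1 bound is the adjoint identity [H] tested against the sign of the convolution. *)
pose sg x : R := (0 <= convol u rho x)%R%:R * 2 - 1.
have ms : mf sg by rewrite /sg; mm.
have sgE x : sg x = if 0 <= convol u rho x then 1 else -1.
  by rewrite /sg; case: (0 <= _) => /=; rewrite ?mul1r ?mul0r ?sub0r // -[2]/(1 + 1) addrK.
clearbody sg.
have sg1 x : `|sg x| <= 1 by rewrite sgE; case: ifP => _; rewrite ?normrN normr1.
have [_ i2 E] := H sg 1 ms sg1.
have e1 x : `|convol u rho x| = convol u rho x * sg x.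
  rewrite sgE; case: ifPn => h; first by rewrite mulr1 ger0_norm.
  by rewrite mulrN1 ltr0_norm // ltNge.
rewrite (eq_RI e1) E; apply: (RI_le i2 (ig_abs iu)) => z.
apply: le_trans (ler_norm _) _; rewrite normrM ler_piMr //.
have ii : ig (fun t => rho t * sg (z + t)).
  have msz : mf (fun t => sg (z + t)).
    rewrite (_ : (fun t => _) = (fun t => sg (t + z))); first exact: mf_shift.
    by apply/funext => t; rewrite addrC.
  apply: (ig_le _ ir) => [|t]; first by mm.
  by rewrite normrM (ger0_norm (r0 _)) ler_piMr.
rewrite -r1; apply: RI_absle ii ir _ => t.
by rewrite normrM (ger0_norm (r0 _)) ler_piMr.
Qed.

(** Jensen's inequality in the form of Cauchy-Schwarz for the probability density rho(x - z),
    followed by Fubini. *)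
Lemma conv_sqr_le C r h rho : mf h -> ig (fun z => h z ^+ 2) -> nice C r rho ->
  (forall x, 0 <= rho x) -> RI rho = 1 ->
  [/\ forall x, ig (fun z => h z * rho (x - z)), ig (fun x => convol h rho x ^+ 2) &
   RI (fun x => convol h rho x ^+ 2) <= RI (fun z => h z ^+ 2)].
Proof.
move=> mh ih [hb _ _] r0 r1; have [mr rC _] := hb; have ir := ig_bcs hb.
have mk := mf2_convk mr.
have irx x : ig (fun z => rho (x - z)) := ig_reflect x ir.
have Rrx x : RI (fun z => rho (x - z)) = 1 by rewrite (RI_reflect x ir).
have C0 := bcs_ge0 hb.
have i2 x : ig (fun z => rho (x - z) * h z ^+ 2).
  apply: (ig_le _ (igZ C ih)) => [|z]; first by have hh := mf2_sect x mk; mm.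
  by rewrite normrM (ger0_norm (sqr_ge0 _)) ler_wpM2r ?sqr_ge0.
have i1 x : ig (fun z => rho (x - z) * 1 ^+ 2).
  by apply: (eq_ig _ (irx x)) => z; rewrite expr1n mulr1.
have i3 x : ig (fun z => rho (x - z) * (h z * 1)).
  apply: (ig_le _ (igD (irx x) (i2 x))) => [|z]; first by have hh := mf2_sect x mk; mm.
  rewrite mulr1 normrM (ger0_norm (r0 _)) -{2}[rho _]mulr1 -mulrDr; apply: ler_wpM2l => //.
  rewrite -[h z ^+ 2]real_normK ?num_real //; move: (`|h z|) => a.
  have := sqr_ge0 (a - 2^-1); lra.
have i4 x : ig (fun z => h z * rho (x - z)).
  by apply: (eq_ig _ (i3 x)) => z; rewrite mulr1 mulrC.
have cs x : convol h rho x ^+ 2 <= RI (fun z => rho (x - z) * h z ^+ 2).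
  have := RI_CSw (fun z => r0 (x - z)) (i2 x) (i1 x) (i3 x).
  rewrite (eq_RI (f := fun z => rho (x - z) * 1 ^+ 2) (g := fun z => rho (x - z))); last first.
    by move=> z; rewrite expr1n mulr1.
  rewrite Rrx mulr1 (eq_RI (f := fun z => rho (x - z) * (h z * 1)) (g := fun z => h z * rho (x - z))) //.
  by move=> z; rewrite mulr1 mulrC.
pose F z x := rho (x - z) * h z ^+ 2.
have mF : mf2 F by have hh := mf2_swap mk; rewrite /F; mm.
have iF z : ig (F z).
  by apply: (eq_ig _ (igZ (h z ^+ 2) (ig_shift (- z) ir))) => x; rewrite mulrC.
have RF z : RI (F z) = h z ^+ 2.
  rewrite (eq_RI (g := fun x => h z ^+ 2 * rho (x - z))); last by move=> x; rewrite mulrC.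
  by rewrite (RIZ _ (ig_shift (- z) ir)) (RI_shift (- z) ir) r1 mulr1.
have bF z : RI (fun x => `|F z x|) <= h z ^+ 2.
  rewrite -RF le_eqVlt; apply/orP; left; apply/eqP; apply: eq_RI => x.
  by rewrite ger0_norm // /F mulr_ge0 ?sqr_ge0.
have [j1 j2 E] := Fubini_RI mF iF bF ih.
have mc : mf (convol h rho) by apply: (mf_RI (F := fun x z => h z * rho (x - z))); mm.
have ic : ig (fun x => convol h rho x ^+ 2).
  apply: (ig_le _ j2) => [|x]; first by mm.
  by rewrite ger0_norm ?sqr_ge0.
split=> //; apply: le_trans (RI_le ic j2 cs) _.
by rewrite -E le_eqVlt; apply/orP; left; apply/eqP; exact: eq_RI.
Qed.

Section FixedS.
Variable s : R.
Hypotheses (s1 : 1 <= s) (s2 : s < 2).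
Local Notation kC := (kapC R n).

Lemma Lk_conv C r c K u rho x : ig u -> nice C r rho -> kern c s K ->
  ig (fun z => u z * Lk K rho (x - z)) /\
  Lk K (convol u rho) x = RI (fun z => u z * Lk K rho (x - z)).
Proof.
move=> iu hr hK; have mu := ig_mf iu; have [[mr rC _] _ _] := hr; have [c0 mK _] := hK.
have I x' := (ig_convb r x' iu mr rC).1.
pose F z y := u z * (delta2 rho (x - z) y * K y).
have mF : mf2 F by have h := mf2_delta2 mr; rewrite /F; mm.
have [i1 R1] := ig_m1K s1 s2 hK.
have id z : ig (fun y => delta2 rho (x - z) y * K y) := ig_delta2K s1 s2 _ hr hK.
have iF z : ig (F z) := igZ _ (id z).
have bF z : RI (fun y => `|F z y|) <= 4 * C * (c * kC) * `|u z|.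
  have E y : `|F z y| <= `|u z| * (4 * C * (m1 y * K y)).
    rewrite normrM; apply: ler_wpM2l => //.
    rewrite normrM (ger0_norm (kern_ge0 y hK)) mulrA; apply: ler_wpM2r.
      exact: kern_ge0 hK.
    exact: nice_delta2 hr.
  have ii := igZ (`|u z|) (igZ (4 * C) i1).
  apply: le_trans (RI_le (ig_abs (iF z)) ii E) _.
  rewrite (RIZ _ (igZ (4 * C) i1)) (RIZ _ i1) mulrC; apply: ler_wpM2r => //.
  apply: ler_wpM2l => //; rewrite mulr_ge0 //.
  by have [hb _ _] := hr; exact: bcs_ge0 hb.
have [j1 j2 E] := Fubini_RI mF iF bF (igZ _ (ig_abs iu)).
have e1 z : RI (F z) = u z * Lk K rho (x - z) by rewrite /F (RIZ _ (id z)).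
split; first exact: eq_ig e1 j1.
rewrite -(eq_RI e1) E /Lk; apply: eq_RI => y.
have i2 := igD (I (x + y)) (I (x - y)).
rewrite /delta2 /convol -(RID (I (x + y)) (I (x - y))) -(RIZ 2 (I x)) -(RIB i2 (igZ 2 (I x))).
rewrite mulrC -(RIZ _ (igB i2 (igZ 2 (I x)))); apply: eq_RI => z.
rewrite /F /delta2 ![x - z + _]addrAC; move: (rho _) (rho _) (rho _) (u z) (K y) => a b d e k.
by ring.
Qed.

Lemma Lk_reflect K rho x z : Lk K (fun z => rho (x - z)) z = Lk K rho (x - z).
Proof.
apply: eq_RI => y; congr (_ * _); rewrite /delta2 [X in X - _]addrC.
by congr (rho _ + rho _ - _); rewrite !opprD ?opprK !addrA.
Qed.

Lemma Lk_sym C r c K C' r' w v : nice C r w -> nice C' r' v -> kern c s K ->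
  RI (fun x => Lk K w x * v x) = RI (fun x => w x * Lk K v x).
Proof.
move=> hw hv hK; have [hbw _ _] := hw; have [hbv _ _] := hv.
have [mw wC _] := hbw; have [mv vC _] := hbv.
have [_ _ E1] := Lk_pair s1 s2 hw hK mv vC; have [_ _ E2] := Lk_pair s1 s2 hv hK mw wC.
rewrite E1 (eq_RI (f := fun x => w x * _) (g := fun x => Lk K v x * w x)); last first.
  by move=> x; rewrite mulrC.
rewrite E2; apply: eq_RI => y; congr (_ * _).
have sh z : ig (fun x => w (x + z) * v x).
  by apply: (ig_bcsM (bcs_shift z hbw) mv vC).
have sh' z : ig (fun x => v (x + z) * w x).
  by apply: (ig_bcsM (bcs_shift z hbv) mw wC).
have S z : RI (fun x => w (x + z) * v x) = RI (fun x => v (x - z) * w x).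
  rewrite -(RI_shift z (sh' (- z))); apply: eq_RI => x.
  by rewrite addrK mulrC.
have i0 := ig_bcsM hbw mv vC.
have i1 := igD (sh y) (sh (- y)); have i1' := igD (sh' y) (sh' (- y)).
rewrite (eq_RI (g := fun x => w (x + y) * v x + w (x - y) * v x - 2 * (w x * v x))); last first.
  by move=> x; rewrite /delta2; ring.
rewrite (eq_RI (f := fun x => delta2 v x y * w x) (g := fun x => v (x + y) * w x + v (x - y) * w x - 2 * (w x * v x))); last first.
  by move=> x; rewrite /delta2; ring.
rewrite (RIB i1 (igZ 2 i0)) (RIB i1' (igZ 2 i0)) (RID (sh y) (sh (- y))) (RID (sh' y) (sh' (- y))).
by rewrite !S opprK [X in X - _]addrC.
Qed.

Definition wt (x : V) : R := (1 + enorm x `^ s)^-1.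

Lemma wt_gt0 x : 0 < wt x.
Proof. by rewrite invr_gt0 ltr_wpDr // powR_ge0. Qed.

Lemma mf_wt : mf wt.
Proof.
have mn := @mf_enorm R n.
have E x : wt x = (1 + enorm x `^ s) `^ (- 1) by rewrite powR_inv1 // addr_ge0 ?powR_ge0.
by rewrite (funext E); mm.
Qed.

(** 17 is 1 + 4^2, a bound for 1 + |x|^s on this ball as s < 2. *)
Lemma wt_near x : enorm x <= 4 -> 1 <= 17 * wt x.
Proof.
move=> h; rewrite ler_pdivlMr ?mul1r; last by rewrite ltr_wpDr // powR_ge0.
have h1 : enorm x `^ s <= 4 `^ s.
  by apply: ge0_ler_powR; rewrite ?nnegrE ?enorm_ge0 // (le_trans ler01).
have h2 : 4 `^ s <= 4 `^ (2%:R) :> R by apply: ler_powR; [rewrite ler1n|exact: ltW].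
move: h2; rewrite powR_mulrn // => h2; have := le_trans h1 h2; lra.
Qed.

(** For |x| >= 2 the function vanishes at x, and at x + y and x - y as well unless |y| >= |x|/2,
    where the kernel is at most (|x|/2)^(-n-s). As |x|/2 >= 1, the factor with exponent n may be
    dropped, and what is left is comparable to the weight. *)
Lemma Lk_decay C r c K w x : nice C r w -> r <= 1 -> kern c s K -> 2 <= enorm x ->
  `|Lk K w x| <= 16 * c * wt x * RI (fun y => `|w y|).
Proof.
move=> hw r1 hK hx; have [hb _ _] := hw; have [mw wC w0] := hb; have [c0 mK hk] := hK.
have [iA RA] := ig_around x (ig_bcs hb).
have ii := ig_delta2K s1 s2 x hw hK.
rewrite (_ : 16 * c * wt x * _ = 8 * c * wt x * (2 * RI (fun y => `|w y|))); last by ring.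
rewrite -RA -(RIZ _ iA); apply: (RI_absle ii (igZ _ iA)) => y.
have K0 := kern_ge0 y hK; rewrite normrM (ger0_norm K0).
have x0 : 0 < enorm x / 2 by rewrite divr_gt0 // (lt_le_trans _ hx).
have x1 : 1 <= enorm x / 2 by rewrite ler_pdivlMr // mul1r.
have wt0 := ltW (wt_gt0 x).
have [hy|hy] := ltP (enorm y) (enorm x / 2).
  rewrite (_ : delta2 w x y = 0) ?normr0 ?mul0r ?mulr_ge0 ?addr_ge0 //.
  rewrite /delta2 !w0; first by ring.
  - by have := enorm_ge0 y; lra.
  - by have := enorm_subl x (- y); rewrite enormN; lra.
  - by have := enorm_subl x y; lra.
rewrite mulrC; apply: ler_pM => //; last first.
  rewrite /delta2 (w0 x) ?mulr0 ?subr0; last by lra.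
  exact: ler_normD.
have /andP[_ h] := hk y; apply: le_trans h _.
rewrite (_ : 8 * c * wt x = c * (8 * wt x)); last by ring.
apply: ler_wpM2l => //.
apply: (@le_trans _ _ (pw s y)).
  by rewrite /kap; apply: ler_piMl; [exact: pw_ge0|rewrite lerBlDr -[leLHS]/(1 + 1) lerD2l].
apply: le_trans (pw_le s1 x0 hy) _.
rewrite powRN -[8]invrK /wt -invfM lef_pV2 ?posrE ?powR_gt0 //; last first.
  by rewrite mulr_gt0 // ltr_wpDr // powR_ge0.
have xs : enorm x `^ s = (enorm x / 2) `^ s * 2 `^ s.
  by rewrite -powRM ?divfK // ltW.
have p1 : 1 <= (enorm x / 2) `^ s.
  by rewrite -[leLHS](powRr0 (enorm x / 2)); apply: ler_powR => //; exact: le_trans s1.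
apply: (@le_trans _ _ ((enorm x / 2) `^ s)); last first.
  by apply: ler_powR => //; rewrite lerDr.
rewrite xs; have := pow2_le4 s2; have := @powR_ge0 R 2 s.
move: (2 `^ s) ((_ / 2) `^ s) p1 => p q q1 p0 p4; nra.
Qed.

End FixedS.
End Convolution.

Lemma le_eps (R : realFieldType) (a b N : R) : 0 <= N ->
  (forall e, 0 < e -> a <= b + e * N) -> a <= b.
Proof.
move=> N0 h; apply/ler_addgt0Pr => e e0.
have N1 : 0 < N + 1 by rewrite ltr_wpDl.
have p : 0 < e / (N + 1) by rewrite divr_gt0.
apply: le_trans (h _ p) _; rewrite lerD2l.
rewrite mulrAC ler_pdivrMr // ler_wpM2l ?ltW //.
by rewrite ltrDl.
Qed.

Lemma dual_alg (R : realFieldType) (L Z V U F P x y : R) :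
  0 <= L -> 0 <= Z -> 0 <= V -> 0 <= U -> 0 <= F -> 0 <= P ->
  x ^+ 2 <= Z * (2 * F + 2 * ((16 * L * U) ^+ 2 * V) + (17 * U) ^+ 2) * P ->
  y ^+ 2 <= (16 * L * U) ^+ 2 * (V * P) ->
  (x + y) ^+ 2 <= (2 * (Z * (2 + 2 * ((16 * L) ^+ 2 * V) + 17 ^+ 2)) + 2 * ((16 * L) ^+ 2 * V)) *
    (U ^+ 2 + F) * P.
Proof.
move=> L0 Z0 V0 U0 F0 P0.
rewrite !exprMn; set e := 16 ^+ 2 * L ^+ 2; set m := 17 ^+ 2.
have e0 : 0 <= e by rewrite mulr_ge0 ?sqr_ge0.
have m0 : 0 <= m by rewrite sqr_ge0.
move: e m e0 m0 => e m e0 m0; set W := U ^+ 2.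
have W0 : 0 <= W by rewrite sqr_ge0.
move=> h1 h2.
have h3 : (x + y) ^+ 2 <= 2 * x ^+ 2 + 2 * y ^+ 2 by have := sqr_ge0 (x - y); lra.
apply: le_trans h3 _.
apply: (@le_trans _ _ (2 * (Z * (2 * F + 2 * (e * W * V) + m * W) * P) + 2 * (e * W * (V * P)))).
  by apply: lerD; apply: ler_wpM2l.
rewrite -subr_ge0 (_ : _ - _ = P * (2 * Z * (2 * W + 2 * (e * V) * F + m * F) + 2 * (e * V) * F)); last by ring.
by rewrite !(mulr_ge0, addr_ge0).
Qed.

Lemma three4 (R : realFieldType) : 2^-1 + 2^-1 / 2 < 1 :> R.
Proof. lra. Qed.

Lemma lt34 (R : realFieldType) (a e : R) : a < 2^-1 + 2^-1 / 2 -> e <= 8^-1 -> a + e < 1.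
Proof. lra. Qed.

Lemma mol_out (R : realType) n (e r : R) (x z : 'rV[R]_n) :
  0 < e -> enorm x + e <= r -> r <= enorm z -> mol e (x - z) = 0.
Proof.
move=> e0 h1 h2; apply: mol_eq0 => //; have := enorm_subl z (- x).
by rewrite enormN -(enormN (z - x)) opprB; lra.
Qed.

(** * Duality estimate for weak solutions *)

Section Duality.
Variables (R : realType) (n : nat).
Local Notation V := 'rV[R]_n.
Implicit Types (w u f phi : V -> R) (x y z : V) (c C r lam Lam : R).

Lemma ball_pair_le L (D r r' : R) C phi (B : R) : mf L -> (forall x, `|L x| <= D) ->
  bcs C r phi -> r <= r' -> RI (fun x => chi r' x * L x ^+ 2) <= B ->
  `|RI (fun x => L x * phi x)| <= Num.sqrt (B * RI (fun x => phi x ^+ 2)).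
Proof.
move=> mL LD hb rr LB; have [mp pC p0] := hb; have mc := @mf_chi R n r'.
have iL := ig_chi_sqr r' mL LD.
have ip2 : ig (fun x => phi x ^+ 2) := ig_bcsM hb mp pC.
have P0 : 0 <= RI (fun x => phi x ^+ 2) by apply: RI_ge0 => x; exact: sqr_ge0.
have B0 : 0 <= B.
  by apply: le_trans LB; apply: RI_ge0 => x; rewrite mulr_ge0 ?chi_ge0 ?sqr_ge0.
have m1_ : mf (fun x => chi r' x * L x) by mm.
have e x : L x * phi x = chi r' x * L x * phi x.
  rewrite /chi; case: ltP => h; first by rewrite mul1r.
  by rewrite p0 ?mulr0 // (le_trans rr).
have [_ cs] := RI_CS m1_ mp (eq_ig (fun x => chi_sqr r' (L x) x) iL) ip2.
rewrite (eq_RI e) -ler_sqr ?nnegrE ?sqrtr_ge0 // real_normK ?num_real //.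
rewrite sqr_sqrtr ?mulr_ge0 //; apply: le_trans cs _; apply: ler_wpM2r => //.
by rewrite -(eq_RI (fun x => chi_sqr r' (L x) x)).
Qed.

Lemma mean_close (g rho : V -> R) (D e eps : R) z : mf g -> (forall x, `|g x| <= D) ->
  ig rho -> (forall t, 0 <= rho t) -> RI rho = 1 -> (forall t, e <= enorm t -> rho t = 0) ->
  (forall t, enorm t <= e -> `|g (z + t) - g z| <= eps) ->
  `|g z - RI (fun t => rho t * g (z + t))| <= eps.
Proof.
move=> mg gD irho rho0 Rrho rhoe gc; have mr := ig_mf irho.
have mgz : mf (fun t => g (z + t)).
  rewrite (_ : (fun t => _) = (fun t => g (t + z))); first exact: mf_shift.
  by apply/funext => t; rewrite addrC.
have ig1 : ig (fun t => rho t * g (z + t)).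
  apply: (ig_le _ (igZ D irho)) => [|t]; first by mm.
  by rewrite normrM (ger0_norm (rho0 _)) mulrC ler_wpM2r.
have ig2 : ig (fun t => g z * rho t) := igZ _ irho.
have RZ q : RI (fun t : V => q * rho t) = q by rewrite (RIZ _ irho) Rrho mulr1.
rewrite -{1}(RZ (g z)) -(RIB ig2 ig1) -[leRHS](RZ eps).
apply: (RI_absle (igB ig2 ig1) (igZ _ irho)) => t.
rewrite [rho t * _]mulrC -mulrBl normrM (ger0_norm (rho0 _)).
have [ht|ht] := leP (enorm t) e; first by apply: ler_wpM2r => //; rewrite distrC gc.
by rewrite rhoe ?mulr0 // ltW.
Qed.

Lemma RI_dct0 (f_ : nat -> V -> R) (g : V -> R) : (forall k, mf (f_ k)) -> ig g ->
  (forall k x, `|f_ k x| <= g x) -> (forall x, f_ ^~ x @ \oo --> (0 : R)) ->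
  (fun k => RI (f_ k)) @ \oo --> (0 : R).
Proof.
move=> mf_ igg hg f0.
have mE k : measurable_fun setT ((fun x => (f_ k x)%:E) : bT R n -> \bar R).
  by apply/measurable_EFinP; exact: mf_.
have [] := @dominated_convergence _ _ _ (leb R n) _ measurableT
  (fun k x => (f_ k x)%:E) (fun=> 0%E) (fun x => (g x)%:E) mE.
- exact: measurable_cst.
- by apply: aeW => x _; apply: cvg_EFin; [exact: nearW|exact: f0].
- exact: igg.
- by apply: aeW => x k _ /=; rewrite lee_fin.
move=> _ _; rewrite integral0 => h.
have h2 : (fun k => (\int[leb R n]_x (f_ k x)%:E)%E) @ \oo --> (0 : R)%:E := h.
exact: fine_cvg h2.
Qed.

Section FixedS.
Variable s : R.
Hypotheses (s1 : 1 <= s) (s2 : s < 2).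
Local Notation kC := (kapC R n).

(** The increment in x of the second difference is at most the minimum of 4C|t| and 8C m1(y), and
    dominated convergence does the rest. No rate is claimed; the modulus is used only in a limit. *)
Lemma Lk_modulus C r c K phi e : nice C r phi -> kern c s K -> 0 < e ->
  exists2 d : R, 0 < d & forall z t, enorm t <= d -> `|Lk K phi (z + t) - Lk K phi z| <= e.
Proof.
move=> hp hK e0; have [hb hL _] := hp; have C0 := bcs_ge0 hb; have [c0 mK _] := hK.
have [i1 _] := ig_m1K s1 s2 hK; have mm1 := @mf_m1 R n.
pose T k y := Num.min (4 * C * harmonic k) (8 * C * m1 y) * K y.
have h0 k : 0 <= harmonic k :> R by rewrite invr_ge0.
have T0 k y : 0 <= T k y.
  by rewrite mulr_ge0 ?(kern_ge0 y hK) // le_min !mulr_ge0 ?m1_ge0.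
have mT k : mf (T k).
  rewrite /T; have hm : mf (fun y => Num.min (4 * C * harmonic k) (8 * C * m1 y)).
    by apply: measurable_minr; mm.
  by mm.
have Tg k y : `|T k y| <= 8 * C * (m1 y * K y).
  by rewrite ger0_norm // mulrA ler_wpM2r ?(kern_ge0 y hK) // ge_min lexx orbT.
have Tc y : T ^~ y @ \oo --> (0 : R).
  have c1 : (fun k => 4 * C * harmonic k * K y) @ \oo --> (0 : R).
    have h : (fun k => harmonic k * (4 * C * K y)) @ \oo --> (0 * (4 * C * K y) : R).
      by apply: cvgMl; exact: cvg_harmonic.
    rewrite mul0r in h; rewrite (_ : (fun k => _) = (fun k => harmonic k * (4 * C * K y))) //.
    by apply/funext => k; rewrite mulrAC mulrC.
  apply: (squeeze_cvgr _ (cvg_cst 0) c1); apply: nearW => k.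
  by rewrite T0 /= /T ler_wpM2r ?(kern_ge0 y hK) // ge_min lexx.
have := RI_dct0 mT (igZ (8 * C) i1) Tg Tc.
move=> /cvgr_lt /(_ _ e0) [k _ /(_ k (leqnn k)) /= Tk].
exists (harmonic k); first by rewrite invr_gt0.
move=> z t ht; apply: le_trans (ltW Tk).
have ii x := ig_delta2K s1 s2 x hp hK.
have iT : ig (T k) := ig_le (mT k) (igZ (8 * C) i1) (Tg k).
rewrite /Lk -(RIB (ii (z + t)) (ii z)); apply: (RI_absle (igB (ii _) (ii _)) iT) => y.
rewrite -mulrBl normrM (ger0_norm (kern_ge0 y hK)); apply: ler_wpM2r; first exact: kern_ge0 hK.
rewrite le_min; apply/andP; split; last first.
  apply: le_trans (ler_normB _ _) _.
  have := nice_delta2 (z + t) y hp; have := nice_delta2 z y hp.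
  move: (`|delta2 _ _ _|) (`|delta2 _ _ _|) (m1 y) => a b m; lra.
apply: (@le_trans _ _ (4 * C * enorm t)); last by rewrite ler_wpM2l // mulr_ge0.
have := hL (z + y) t; have := hL (z - y) t; have := hL z t.
rewrite ![z + _ + t]addrAC /delta2 -[4 * C * _]mulrA; move: (C * enorm t) => q.
move: (phi (z + t)) (phi _) (phi _) (phi z) (phi _) (phi _) => a b d a' b' d'.
rewrite !ler_norml => /andP[? ?] /andP[? ?] /andP[? ?].
by apply/andP; split; lra.
Qed.

Variables (u f : V -> R).
Hypotheses (mu : mf u) (mf_ : mf f).
Hypothesis iu : ig (fun x => `|u x| * wt s x).
Hypothesis if2 : ig (fun x => chi 1 x * f x ^+ 2).
Let U := RI (fun x => `|u x| * wt s x).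
Let F := RI (fun x => chi 1 x * f x ^+ 2).
Let u1 x := u x * chi 4 x.
Let u2 x := u x * (1 - chi 4 x).

Let U_ge0 : 0 <= U.
Proof. by apply: RI_ge0 => x; rewrite mulr_ge0 // ltW // wt_gt0. Qed.

Let mchi r : mf (@chi R n r).
Proof. exact: mf_chi. Qed.

Lemma ig_uLk C r c K phi : nice C r phi -> r <= 1 -> kern c s K ->
  ig (fun x => u x * Lk K phi x).
Proof.
move=> hp r1 hK; have [hb _ _] := hp; have [mp pC _] := hb; have [c0 mK _] := hK.
have mL := mf_Lk mp mK; have LB x := Lk_le s1 s2 x hp hK.
have D0 : 0 <= 4 * C * (c * kC) := le_trans (normr_ge0 _) (LB 0).
have N0 : 0 <= RI (fun y => `|phi y|) by apply: RI_ge0.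
pose D := 17 * (4 * C * (c * kC)) + 16 * c * RI (fun y => `|phi y|).
apply: (ig_le _ (igZ D iu)) => [|x]; first by mm.
rewrite normrM mulrCA; apply: ler_wpM2l => //.
have w0 := ltW (wt_gt0 s x).
have [h|h] := leP 2 (enorm x).
  apply: le_trans (Lk_decay s1 s2 hp r1 hK h) _.
  rewrite (mulrAC (16 * c)) /D (mulrDl (17 * (4 * C * (c * kC)))) lerDr; apply: mulr_ge0 => //.
  exact: mulr_ge0 (ler0n _ _) D0.
apply: le_trans (LB x) _.
have h4 : 1 <= 17 * wt s x.
  by apply: (wt_near s1 s2); apply: le_trans (ltW h) _; rewrite ler_nat.
rewrite /D (mulrDl (17 * (4 * C * (c * kC)))) (mulrAC 17) ler_wpDr //.
  by apply: mulr_ge0 => //; apply: mulr_ge0 => //; exact: mulr_ge0.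
by rewrite ler_peMl.
Qed.

Lemma trunc_L1 : ig u1 /\ RI (fun x => `|u1 x|) <= 17 * U.
Proof.
have H x : `|u1 x| <= 17 * (`|u x| * wt s x).
  rewrite /u1 normrM mulrCA; apply: ler_wpM2l => //.
  rewrite /chi; case: ltP => h; first by rewrite normr1 (wt_near s1 s2) // ltW.
  by rewrite normr0 mulr_ge0 // ltW // wt_gt0.
have mc4 := mchi 4; have i : ig u1 by apply: (ig_le _ (igZ 17 iu) H); rewrite /u1; mm.
by split=> //; rewrite /U -(RIZ _ iu); apply: RI_le (ig_abs i) (igZ 17 iu) H.
Qed.

Let u1_supp x : 4 <= enorm x -> u1 x = 0.
Proof. by move=> h; rewrite /u1 /chi ltNge h mulr0. Qed.

Lemma tail_le C r c K phi : nice C r phi -> r <= 1 -> kern c s K ->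
  [/\ ig (fun x => u1 x * Lk K phi x),
   RI (fun x => u x * Lk K phi x) = RI (fun x => u1 x * Lk K phi x) + RI (fun x => u2 x * Lk K phi x) &
   `|RI (fun x => u2 x * Lk K phi x)| <= 16 * c * U * RI (fun x => `|phi x|)].
Proof.
move=> hp r1 hK; have iL := ig_uLk hp r1 hK.
have [hb _ _] := hp; have [mp pC _] := hb; have [c0 mK _] := hK.
have mL := mf_Lk mp mK; have mc4 := mchi 4.
have i1 : ig (fun x => u1 x * Lk K phi x).
  apply: (ig_le _ (ig_abs iL)) => [|x]; first by rewrite /u1; mm.
  by rewrite /u1 mulrAC normrM ler_piMr // ger0_norm ?chi_ge0 ?chi_le1.
have e x : u2 x * Lk K phi x = u x * Lk K phi x - u1 x * Lk K phi x.
  by rewrite /u2 /u1 mulrBr mulr1 mulrBl.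
have i2 : ig (fun x => u2 x * Lk K phi x).
  by apply: (eq_ig _ (igB iL i1)) => x; rewrite e.
split=> //.
  by rewrite (eq_RI e) (RIB iL i1) addrC subrK.
rewrite (_ : 16 * c * U * _ = 16 * c * RI (fun x => `|phi x|) * U); last by rewrite mulrAC.
rewrite /U -(RIZ _ iu); apply: (RI_absle i2 (igZ _ iu)) => x.
rewrite normrM mulrCA.
have [h|h] := ltP (enorm x) 4.
  rewrite /u2 /chi h subrr mulr0 normr0 mul0r mulr_ge0 // mulr_ge0 ?(ltW (wt_gt0 _ _)) //.
  by rewrite !mulr_ge0 // RI_ge0.
have -> : u2 x = u x by rewrite /u2 /chi ltNge h subr0 mulr1.
apply: ler_wpM2l => //; rewrite [leRHS]mulrAC; apply: (Lk_decay s1 s2 hp r1 hK).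
by apply: le_trans h; rewrite ler_nat.
Qed.

(** For |x| < 3/4 and e <= 1/8 the mollifier centred at x is a test function of the unit ball. L of
    the mollified function at x is the pairing of u1 with L of that mollifier, so the equation turns
    it into the mollified f, up to the tail of u. *)
Lemma moll_energy c K e : kern c s K ->
  (forall phi, test_fun 1 phi -> RI (fun x => u x * Lk K phi x) = RI (fun x => f x * phi x)) ->
  0 < e -> e <= 8^-1 ->
  RI (fun x => chi (2^-1 + 2^-1 / 2) x * Lk K (convol u1 (mol e)) x ^+ 2) <=
   2 * F + 2 * ((16 * c * U) ^+ 2 * RI (@chi R n 1)).
Proof.
move=> hK hsol e0 e8; have [iu1_ _] := trunc_L1; have [C hm] := nice_mol n e0.
have [irho Rrho] := RI_mol n e0; have [c0 mK _] := hK.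
have hv := conv_nice iu1_ u1_supp hm.
set v := convol u1 (mol e) in hv *.
pose h x := f x * chi 1 x.
have h2 x : chi 1 x * f x ^+ 2 = h x ^+ 2.
  by rewrite chi_sqr mulrC.
have ih2 : ig (fun x => h x ^+ 2) by exact: eq_ig h2 if2.
have mh : mf h by have mc := mchi 1; rewrite /h; mm.
have [ihr ich ich_le] := conv_sqr_le mh ih2 hm (fun x => mol_ge0 x e0) Rrho.
have ic1 := ig_chi (n := n) (1 : R).
have [hbv _ _] := hv; have [mv _ _] := hbv; have mLv := mf_Lk mv mK.
have LB x := Lk_le s1 s2 x hv hK.
have iL := ig_chi_sqr (2^-1 + 2^-1 / 2) mLv LB.
set T := 16 * c * U.
have T0 : 0 <= T by rewrite !mulr_ge0.
have key x : enorm x < 2^-1 + 2^-1 / 2 -> `|Lk K v x - convol h (mol e) x| <= T.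
  move=> hx; pose psi z := mol e (x - z).
  have xe : enorm x + e < 1 := lt34 hx e8.
  have tpsi : test_fun 1 psi := test_mol e0 xe.
  have [C' [r' [r'1 hpsi]]] := test_nice tpsi.
  have [j1 E1 B2] := tail_le hpsi (ltW r'1) hK.
  have [_ E0] := Lk_conv s1 s2 x iu1_ hm hK.
  have E2 : Lk K v x = RI (fun z => u1 z * Lk K psi z).
    by rewrite E0; apply: eq_RI => z; rewrite Lk_reflect.
  have E3 : convol h (mol e) x = RI (fun z => f z * psi z).
    apply: eq_RI => z; rewrite /h /psi -mulrA; congr (_ * _).
    rewrite /chi; case: ltP => hz; first by rewrite mul1r.
    by rewrite (mol_out e0 (ltW xe) hz) !mulr0.
  have N1 : RI (fun z => `|psi z|) = 1.
    rewrite -Rrho -(RI_reflect x irho); apply: eq_RI => z.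
    by rewrite ger0_norm // mol_ge0.
  rewrite E2 E3 -(hsol _ tpsi) E1 opprD addrA subrr sub0r normrN.
  by rewrite N1 mulr1 in B2.
have P x : chi (2^-1 + 2^-1 / 2) x * Lk K v x ^+ 2 <=
    2 * convol h (mol e) x ^+ 2 + 2 * (T ^+ 2 * chi 1 x).
  have := chi_ge0 1 x => q1; rewrite {1}/chi; case: ltP => hx; last first.
    rewrite mul0r; apply: addr_ge0; first exact: mulr_ge0 (ler0n _ _) (sqr_ge0 _).
    by apply: mulr_ge0 => //; exact: mulr_ge0 (sqr_ge0 _) q1.
  rewrite mul1r (_ : chi 1 x = 1); last first.
    by rewrite /chi (lt_trans hx (three4 R)).
  by rewrite mulr1; apply: sum2_le => //; exact: key.
have j2 := igZ 2 ich; have j3 := igZ (T ^+ 2) ic1.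
apply: le_trans (RI_le iL (igD j2 (igZ 2 j3)) P) _.
rewrite (RID j2 (igZ 2 j3)) (RIZ _ ich) (RIZ _ j3) (RIZ _ ic1).
apply: lerD => //; apply: ler_wpM2l => //; apply: le_trans ich_le _.
by rewrite /F (eq_RI h2).
Qed.

(** The mollified function is paired with L' phi by symmetry of L' and the uniform local bound [B].
    Going back to u1 moves the mollifier onto L' phi, whose modulus of continuity makes the error at
    most eps times the L^1 norm of u1. *)
Lemma moll_dual c' K' phi (B : R) : kern c' s K' -> test_fun 2^-1 phi ->
  (forall e, 0 < e -> e <= 8^-1 ->
    RI (fun x => chi 2^-1 x * Lk K' (convol u1 (mol e)) x ^+ 2) <= B) ->
  `|RI (fun x => u1 x * Lk K' phi x)| <= Num.sqrt (B * RI (fun x => phi x ^+ 2)).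
Proof.
move=> hK tphi hB; have [C [r [r2 hp]]] := test_nice tphi.
have r1 : r <= 1 by apply: le_trans (ltW r2) _; rewrite invf_le1 // ler1n.
have [hb _ _] := hp; have [mp pC p0] := hb; have [c0 mK _] := hK.
have [iu1_ _] := trunc_L1; have LB x := Lk_le s1 s2 x hp hK; have mL := mf_Lk mp mK.
have N0 : 0 <= RI (fun x => `|u1 x|) by apply: RI_ge0.
apply: (le_eps N0) => eps eps0.
have [d d0 hd] := Lk_modulus hp hK eps0.
pose e := Num.min d 8^-1.
have e0 : 0 < e by rewrite lt_min d0 invr_gt0 ltr0n.
have e8 : e <= 8^-1 by rewrite ge_min lexx orbT.
have ed : e <= d by rewrite ge_min lexx.
have [Cm hm] := nice_mol n e0; have [irho Rrho] := RI_mol n e0.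
have hv := conv_nice iu1_ u1_supp hm; have mol0 x := mol_ge0 (n := n) x e0.
have [_ /(_ _ _ mL LB) [i1 i2 E]] := conv_L1 iu1_ hm mol0 Rrho.
set v := convol u1 (mol e) in hv i1 E *.
have [hbv _ _] := hv; have [mv vC _] := hbv; have mLv := mf_Lk mv mK.
have LBv x := Lk_le s1 s2 x hv hK.
have A1 : `|RI (fun x => v x * Lk K' phi x)| <= Num.sqrt (B * RI (fun x => phi x ^+ 2)).
  by rewrite -(Lk_sym s1 s2 hv hp hK); exact: ball_pair_le mLv LBv hb (ltW r2) (hB e e0 e8).
have A2 : `|RI (fun x => u1 x * Lk K' phi x) - RI (fun x => v x * Lk K' phi x)| <= eps * RI (fun x => `|u1 x|).
  have i0 : ig (fun x => u1 x * Lk K' phi x).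
    by have [] := tail_le hp r1 hK.
  rewrite E -(RIB i0 i2) -(RIZ _ (ig_abs iu1_)).
  apply: (RI_absle (igB i0 i2) (igZ _ (ig_abs iu1_))) => z.
  rewrite -mulrBr normrM mulrC; apply: ler_wpM2r => //.
  exact: mean_close mL LB irho mol0 Rrho (fun t => @mol_eq0 R n e t e0)
    (fun t h => hd z t (le_trans h ed)).
rewrite -[RI (fun x => u1 x * _)](subrK (RI (fun x => v x * Lk K' phi x))) addrC.
by apply: le_trans (ler_normD _ _) _; exact: lerD.
Qed.

End FixedS.

Lemma dual_bound lam Lam : (0 < n)%N -> 0 < lam -> lam <= Lam ->
  exists2 Z : R, 0 <= Z & forall s K K' u f,
  1 <= s -> s < 2 -> kern Lam s K -> (forall y, lam * kap s y <= K y) -> kern Lam s K' ->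
  mf u -> mf f -> ig (fun x => `|u x| * wt s x) -> ig (fun x => chi 1 x * f x ^+ 2) ->
  (forall phi, test_fun 1 phi -> RI (fun x => u x * Lk K phi x) = RI (fun x => f x * phi x)) ->
  forall phi, test_fun 2^-1 phi ->
  RI (fun x => u x * Lk K' phi x) ^+ 2 <=
  Z * (RI (fun x => `|u x| * wt s x) ^+ 2 + RI (fun x => chi 1 x * f x ^+ 2)) *
  RI (fun x => phi x ^+ 2).
Proof.
move=> n0 l0 lL; have L0 : 0 < Lam := lt_le_trans l0 lL.
(* The first summand gives K' <= a K; the second makes [a] also an upper constant for K', as the far
   field in [apriori] requires. *)
pose a := Lam / lam + Lam.
have a0 : 0 <= a by rewrite addr_ge0 ?divr_ge0 ?ltW.
have [Z Z0 HZ] := apriori n0 (ltW L0) l0 a0.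
pose V1 := RI (@chi R n 1).
have V0 : 0 < V1 := vol_gt0 R n.
pose E := (16 * Lam) ^+ 2 * V1.
have E0 : 0 <= E by apply: mulr_ge0 (sqr_ge0 _) (ltW V0).
exists (2 * (Z * (2 + 2 * E + 17 ^+ 2)) + 2 * E).
  apply: addr_ge0; last by rewrite mulr_ge0.
  apply: mulr_ge0 => //; apply: mulr_ge0 => //.
  by apply: addr_ge0 => //; apply: addr_ge0 => //; rewrite mulr_ge0.
move=> s K K' u f s1 s2 hK hl hK' mu mf_ iu if2 hsol phi tphi.
set U := RI (fun x => `|u x| * _); set F := RI (fun x => chi 1 x * _).
have U0 : 0 <= U by apply: RI_ge0 => x; rewrite mulr_ge0 // ltW // wt_gt0.
have F0 : 0 <= F by apply: RI_ge0 => x; rewrite mulr_ge0 ?chi_ge0 ?sqr_ge0.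
have aK y : K' y <= a * K y.
  have [_ _ hk] := hK'; have /andP[_ h] := hk y; apply: le_trans h _.
  have K0 := kern_ge0 y hK; rewrite /a mulrDl ler_wpDr ?mulr_ge0 ?(ltW L0) //.
  by rewrite mulrAC ler_pdivlMr // -mulrA [kap s y * lam]mulrC ler_wpM2l ?hl // ltW.
have La : Lam <= a by rewrite lerDr divr_ge0 // ltW.
pose u1 x := u x * chi 4 x.
have [iu1 u1N] : ig u1 /\ RI (fun x => `|u1 x|) <= 17 * U := trunc_L1 s1 s2 mu iu.
have u1s x : 4 <= enorm x -> u1 x = 0 by move=> h; rewrite /u1 /chi ltNge h mulr0.
pose B := Z * (2 * F + 2 * ((16 * Lam * U) ^+ 2 * V1) + (17 * U) ^+ 2).
have B0 : 0 <= B.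
  apply: mulr_ge0 => //; apply: addr_ge0 (sqr_ge0 _); apply: addr_ge0; apply: mulr_ge0 => //.
  exact: mulr_ge0 (sqr_ge0 _) (ltW V0).
have hB e : 0 < e -> e <= 8^-1 -> RI (fun x => chi 2^-1 x * Lk K' (convol u1 (mol e)) x ^+ 2) <= B.
  move=> e0 e8; have [C hm] := nice_mol n e0; have [_ Rrho] := RI_mol n e0.
  have hv := conv_nice iu1 u1s hm.
  apply: le_trans (HZ _ _ _ _ _ _ _ s1 s2 hv hK hl hK' La aK) _.
  apply: ler_wpM2l => //; apply: lerD.
    exact: (moll_energy s1 s2 mu mf_ iu if2 hK hsol e0 e8).
  have [h _] := conv_L1 iu1 hm (fun x => mol_ge0 x e0) Rrho.
  rewrite lerXn2r ?nnegrE ?mulr_ge0 //; [exact: RI_ge0|exact: le_trans u1N].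
have [C [r [r2 hp]]] := test_nice tphi; have r1 : r <= 1 by lra.
have [hb _ _] := hp; have [mp pC p0] := hb.
have [_ -> tl] := tail_le s1 s2 mu iu hp r1 hK'.
have md := moll_dual s1 s2 mu iu hK' tphi hB.
have ip2 : ig (fun x => phi x ^+ 2) := ig_bcsM hb mp pC.
set P2 := RI (fun x => phi x ^+ 2) in md *.
have P20 : 0 <= P2 by apply: RI_ge0 => x; exact: sqr_ge0.
have N1 : RI (fun x => `|phi x|) ^+ 2 <= V1 * P2.
  have mc := mf_chi (n := n) (1 : R); have ic := ig_chi (n := n) (1 : R).
  have ma : mf (fun x => `|phi x|) by mm.
  have ec x : chi 1 x = chi 1 x ^+ 2 by rewrite /chi; case: (_ < _); rewrite ?expr1n ?expr0n.
  have ea x : phi x ^+ 2 = `|phi x| ^+ 2 by rewrite real_normK ?num_real.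
  have [_ ] := RI_CS mc ma (eq_ig ec ic) (eq_ig ea ip2).
  rewrite -(eq_RI ec) -(eq_RI ea); apply: le_trans.
  rewrite le_eqVlt; apply/orP; left; apply/eqP; congr (_ ^+ 2); apply: eq_RI => x.
  rewrite /chi; case: ltP => h; first by rewrite mul1r.
  by rewrite p0 ?normr0 ?mulr0 // (le_trans r1).
have S1 : RI (fun x => u1 x * Lk K' phi x) ^+ 2 <= B * P2.
  have := md; rewrite -ler_sqr ?nnegrE ?sqrtr_ge0 // real_normK ?num_real //.
  by rewrite sqr_sqrtr // mulr_ge0.
have S2 : RI (fun x => u x * (1 - chi 4 x) * Lk K' phi x) ^+ 2 <= (16 * Lam * U) ^+ 2 * (V1 * P2).
  rewrite -real_normK ?num_real //; apply: (@le_trans _ _ ((16 * Lam * U * RI (fun x => `|phi x|)) ^+ 2)).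
    by rewrite lerXn2r ?nnegrE // (le_trans _ tl).
  by rewrite exprMn; apply: ler_wpM2l => //; exact: sqr_ge0.
rewrite /B in S1; apply: dual_alg (ltW L0) Z0 (ltW V0) U0 F0 P20 S1 S2.
Qed.

End Duality.

Lemma cvg_sqr (R : realType) (a : nat -> R) (l : R) :
  a @ \oo --> l -> (fun k => a k ^+ 2) @ \oo --> l ^+ 2.
Proof. by move=> h; exact: (cvgM h h). Qed.

(** * Riesz representation on a space of test functions *)

Section Hilbert.
Variables (R : realType) (n : nat).
Local Notation V := 'rV[R]_n.
Implicit Types (f g phi psi : V -> R) (x : V).

(** The series of the d_k has finite integral by monotone convergence, hence a finite sum almost
    everywhere, which bounds each term. *)
Lemma ae_bounded (d : nat -> V -> R) (b : nat -> R) (M : R) :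
  (forall k, ig (d k)) -> (forall k x, 0 <= d k x) -> (forall k, RI (d k) <= b k) ->
  (forall N, \sum_(0 <= k < N) b k <= M) ->
  exists N0 : set (bT R n), [/\ measurable N0, leb R n N0 = 0%E &
    forall x, ~ N0 x -> exists B : R, forall k, d k x <= B].
Proof.
move=> id d0 db bM.
have mE k : measurable_fun setT ((fun x => (d k x)%:E) : bT R n -> \bar R).
  exact: measurable_int (id k).
have dE0 k (x : bT R n) : (0 <= (d k x)%:E)%E by rewrite lee_fin.
pose S : bT R n -> \bar R := fun x => (\sum_(k <oo) (d k x)%:E)%E.
have mS : measurable_fun setT S by apply: ge0_emeasurable_sum.
have S0 x : (0 <= S x)%E by apply: nneseries_ge0 => k _ _; rewrite lee_fin.
have intS : (\int[leb R n]_x S x <= M%:E)%E.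
  rewrite integral_nneseries //; apply: lime_le.
    by apply: is_cvg_nneseries => k _ _; apply: integral_ge0.
  apply: nearW => N.
  rewrite (eq_bigr (fun k => (RI (d k))%:E)); last by move=> k _; rewrite EFin_RI.
  by rewrite sumEFin lee_fin; apply: le_trans (bM N); exact: ler_sum.
have iS : (leb R n).-integrable setT S.
  apply/integrableP; split=> //.
  under eq_integral => x _ do rewrite gee0_abs //.
  by apply: le_lt_trans intS _; rewrite ltry.
have [N0 [mN0 N00 sub]] := integrable_ae measurableT iS.
exists N0; split=> // x nx.
have fS : S x \is a fin_num.
  apply: contrapT => h; apply: nx; apply: sub => /= h2.
  by apply: h; exact: h2.
exists (fine (S x)) => k; rewrite -lee_fin fineK //.
apply: le_trans (nneseries_lim_ge k.+1 _); last by move=> i _ _; rewrite lee_fin.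
by rewrite big_nat_recr //= leeDr // sume_ge0 // => i _; rewrite lee_fin.
Qed.

Lemma RI_ae f g (N0 : set (bT R n)) : measurable N0 -> leb R n N0 = 0%E -> mf g ->
  (forall x, ~ N0 x -> f x = g x) -> ig f -> ig g /\ RI g = RI f.
Proof.
move=> mN N00 mg fg iF; have mff := ig_mf iF.
have mE : measurable_fun setT ((fun x => (f x)%:E) : bT R n -> \bar R) by apply/measurable_EFinP.
have mgE : measurable_fun setT ((fun x => (g x)%:E) : bT R n -> \bar R) by apply/measurable_EFinP.
have mA (h : V -> R) : mf h -> measurable_fun setT ((fun x => `|h x|%:E) : bT R n -> \bar R).
  exact: measurable_normE.
have ae : ae_eq (leb R n) setT (fun x => (f x)%:E) (fun x => (g x)%:E).
  by exists N0; split=> // x /= h; apply: contrapT => nx; apply: h => _; rewrite fg.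
have aeA : ae_eq (leb R n) setT (fun x => `|f x|%:E) (fun x => `|g x|%:E).
  by exists N0; split=> // x /= h; apply: contrapT => nx; apply: h => _; rewrite fg.
split.
  apply: igP => //; rewrite -(ae_eq_integral _ _ measurableT (mA _ mff) (mA _ mg) aeA).
  by have /integrableP[_] := iF.
by rewrite /RI /Rintegral (ae_eq_integral _ _ measurableT mE mgE ae).
Qed.

Lemma cvg_geo (a : nat -> R) (M : R) : (forall k, `|a k.+1 - a k| <= M * 2^-1 ^+ k) ->
  cvg (a @ \oo).
Proof.
move=> h; have M0 : 0 <= M by have := le_trans (normr_ge0 _) (h 0%N); rewrite expr0 mulr1.
have c1 : cvg (series (telescope a) @ \oo).
  apply: normed_cvg; apply: (series_le_cvg (v_ := geometric M 2^-1)) => //.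
  - by move=> k /=; exact: normr_ge0.
  - by move=> k; rewrite /geometric /= mulr_ge0 // exprn_ge0 // invr_ge0.
  - apply: is_cvg_geometric_series; rewrite ger0_norm ?invr_ge0 //.
    by rewrite invf_lt1 // ltr1n.
have -> : a = (fun k => a 0%N + series (telescope a) k).
  by apply/funext => k; exact: eq_sum_telescope.
by apply: is_cvgD => //; exact: is_cvg_cst.
Qed.

Variables (T : (V -> R) -> Prop) (ell : (V -> R) -> R) (B : R).
Hypothesis T0 : T (fun=> 0).
Hypothesis TD : forall f g c, T f -> T g -> T (fun x => f x + c * g x).
Hypothesis TI : forall f, T f -> mf f /\ ig (fun x => f x ^+ 2).
Hypothesis ellD : forall f g c, T f -> T g ->
  ell (fun x => f x + c * g x) = ell f + c * ell g.
Hypothesis B0 : 0 <= B.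
Hypothesis ellB : forall f, T f -> ell f ^+ 2 <= B * RI (fun x => f x ^+ 2).

Let J f := RI (fun x => f x ^+ 2) - 2 * ell f.
(** Half the first variation of [J] at f in the direction g; its vanishing is the representation
    identity. *)
Let E f g := RI (fun x => f x * g x) - ell g.

Let igM f g : T f -> T g -> ig (fun x => f x * g x).
Proof. by move=> /TI[m1 i1] /TI[m2 i2]; have [] := RI_CS m1 m2 i1 i2. Qed.

Let J_var f g c : T f -> T g ->
  J (fun x => f x + c * g x) = J f + 2 * c * E f g + c ^+ 2 * RI (fun x => g x ^+ 2).
Proof.
move=> hf hg; have [_ i1] := TI hf; have [_ i2] := TI hg; have i3 := igM hf hg.
have e x : (f x + c * g x) ^+ 2 = f x ^+ 2 + 2 * c * (f x * g x) + c ^+ 2 * g x ^+ 2 by ring.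
have i4 := igD i1 (igZ (2 * c) i3).
rewrite /J /E (eq_RI e) (RID i4 (igZ _ i2)) (RID i1 (igZ _ i3)) (RIZ _ i3) (RIZ _ i2) ellD //.
move: (RI _) (RI _) (RI _) (ell f) (ell g) => p q r' a b.
by ring.
Qed.

Let J_lb f : T f -> - B <= J f.
Proof.
move=> hf; have h := ellB hf; rewrite /J; set P := RI _ in h *.
have P0 : 0 <= P by apply: RI_ge0 => x; exact: sqr_ge0.
have h2 : (2 * ell f) ^+ 2 <= (P + B) ^+ 2.
  have := sqr_ge0 (P - B); move: h; move: (ell f) => a; lra.
have : `|2 * ell f| <= `|P + B| by rewrite -ler_sqr ?nnegrE // !real_normK ?num_real.
rewrite (ger0_norm (addr_ge0 P0 B0)) => h3; have := le_trans (ler_norm _) h3.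
move: (2 * ell f) => a; lra.
Qed.

Let m := inf [set J f | f in T].

Let m_le f : T f -> m <= J f.
Proof.
move=> hf; apply: ge_inf; last by exists f.
by exists (- B) => _ [g hg <-]; exact: J_lb.
Qed.

Let near_min e : 0 < e -> exists f, T f /\ J f <= m + e.
Proof.
move=> e0; have hi : has_inf [set J f | f in T].
  split; first by exists (J (fun=> 0)); exists (fun=> 0).
  by exists (- B) => _ [g hg <-]; exact: J_lb.
by have [_ [f hf <-] lt] := inf_adherent e0 hi; exists f; split=> //; exact: ltW.
Qed.

(** J(f + t g) - m is a nonnegative quadratic polynomial of t whose constant term is at most e; this
    is its discriminant. *)
Let first_var f g e : T f -> T g -> J f <= m + e ->
  E f g ^+ 2 <= RI (fun x => g x ^+ 2) * e.
Proof.
move=> hf hg le; apply: discr_le; first by apply: RI_ge0 => x; exact: sqr_ge0.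
move=> t; have := m_le (TD t hf hg); rewrite J_var //.
move: (J f) (E f g) (RI _) le => a b p; lra.
Qed.

Let parallelogram f g e : T f -> T g -> J f <= m + e -> J g <= m + e ->
  RI (fun x => (g x - f x) ^+ 2) <= 4 * e.
Proof.
move=> hf hg lf lg; pose h x := g x + (-1) * f x.
have hh : T h := TD (-1) hg hf.
have e1 x : (g x - f x) ^+ 2 = h x ^+ 2 by rewrite /h mulN1r.
rewrite (eq_RI e1).
have eg : g = (fun x => f x + 1 * h x) by apply/funext => x; rewrite /h; ring.
have Jg : J g = J f + 2 * 1 * E f h + 1 ^+ 2 * RI (fun x => h x ^+ 2).
  by rewrite {1}eg J_var.
(* The midpoint of f and g is admissible, so its value of [J] is at least [m]. *)
have := m_le (TD 2^-1 hf hh); rewrite J_var // => hm.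
move: Jg hm lf lg; move: (J f) (J g) (E f h) (RI _) => a b c p ->; lra.
Qed.

(** The space [T] need not be closed in L^2, so no minimiser is sought inside it: the representative
    is an almost everywhere limit of near-minimisers and inherits the vanishing first variation. *)
Theorem riesz : exists g : V -> R, [/\ mf g, ig (fun x => g x ^+ 2),
  RI (fun x => g x ^+ 2) <= 2 * B &
  forall f, T f -> RI (fun x => g x * f x) = ell f].
Proof.
(* With 16^-k, the squared differences multiplied by 4^k still have summable integrals; almost
   everywhere they are bounded, so the differences decay like 2^-k. *)
pose ep k : R := 16^-1 ^+ k.
have ep0 k : 0 < ep k by rewrite exprn_gt0 // invr_gt0.
have epS j k : (k <= j)%N -> ep j <= ep k.
  by move=> kj; rewrite /ep ler_wiXn2l // ?invr_ge0 // invf_le1 // ler1n.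
have [phi hphi] := choice (fun k => near_min (ep0 k)).
have Tp k : T (phi k) by case: (hphi k).
have Jp k : J (phi k) <= m + ep k by case: (hphi k).
have mp k : mf (phi k) by case: (TI (Tp k)).
have close j k : (k <= j)%N -> RI (fun x => (phi j x - phi k x) ^+ 2) <= 4 * ep k.
  move=> kj; apply: parallelogram => //; apply: le_trans (Jp j) _.
  by rewrite lerD2l epS.
have icl j k : ig (fun x => (phi j x - phi k x) ^+ 2).
  have [_ h] := TI (TD (-1) (Tp j) (Tp k)).
  by apply: (eq_ig _ h) => x; rewrite mulN1r.
pose d k x := 4 ^+ k * (phi k.+1 x - phi k x) ^+ 2.
have id k : ig (d k) := igZ _ (icl k.+1 k).
have d0 k x : 0 <= d k x by rewrite mulr_ge0 ?sqr_ge0 // exprn_ge0.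
have db k : RI (d k) <= 4 * 2^-1 ^+ k.
  rewrite (RIZ _ (icl k.+1 k)); apply: le_trans (ler_wpM2l _ (close k.+1 k (leqnSn k))) _.
    by rewrite exprn_ge0.
  rewrite mulrCA ler_wpM2l // /ep -exprMn lerXn2r ?nnegrE ?mulr_ge0 ?invr_ge0 //.
  by rewrite ler_pdivrMr // ler_pdivlMl //; rewrite -natrM ler_nat.
have bM N : \sum_(0 <= k < N) 4 * 2^-1 ^+ k <= (8 : R).
  have -> : \sum_(0 <= k < N) 4 * 2^-1 ^+ k = 8 * (1 - 2^-1 ^+ N) :> R.
    elim: N => [|N IH]; first by rewrite big_geq // expr0 subrr mulr0.
    by rewrite big_nat_recr //= IH exprS; field.
  by rewrite ler_piMr // gerBl exprn_ge0 // invr_ge0.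
have [N0 [mN N00 hN]] := ae_bounded id d0 db bM.
(* Setting the sequence to 0 on the exceptional null set makes it converge everywhere, so that the
   limit is measurable. *)
pose pt k x := phi k x * \1_(~` N0) x.
have mI : mf (\1_(~` N0) : V -> R) by apply: measurable_indic; exact: measurableC.
have mpt k : mf (pt k) by have h := mp k; rewrite /pt; mm.
have ptE k x : ~ N0 x -> phi k x = pt k x.
  by move=> h; rewrite /pt indicE mem_set ?mulr1.
have cvgp x : cvg ((pt ^~ x) @ \oo).
  have [h|h] := pselect (N0 x).
    rewrite (_ : pt ^~ x = fun=> 0); first exact: is_cvg_cst.
    by apply/funext => k; rewrite /pt indicE memNset ?mulr0 //; exact: (fun q => q h).
  have [C hC] := hN x h; have C0 : 0 <= C := le_trans (d0 0%N x) (hC 0%N).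
  apply: (cvg_geo (M := Num.sqrt C)) => k; rewrite -!ptE //.
  rewrite -ler_sqr ?nnegrE ?mulr_ge0 ?sqrtr_ge0 ?exprn_ge0 ?invr_ge0 //.
  rewrite real_normK ?num_real // exprMn sqr_sqrtr // -exprM mulnC exprM exprVn.
  rewrite (_ : (2 : R) ^- 2 = 4^-1); last by rewrite -natrX.
  by rewrite exprVn ler_pdivlMr ?exprn_gt0 // mulrC; exact: hC.
have [g gc] : exists g : V -> R, forall x, pt ^~ x @ \oo --> g x.
  by exists (fun x => lim ((pt ^~ x) @ \oo)) => x; exact: cvgp.
have mg : mf g := @measurable_fun_cvg _ (bT R n) R setT pt g mpt (fun x _ => gc x).
have ae_pt (F : R -> V -> R) k : (forall h, mf h -> mf (fun x => F (h x) x)) ->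
    ig (fun x => F (phi k x) x) ->
    ig (fun x => F (pt k x) x) /\ RI (fun x => F (pt k x) x) = RI (fun x => F (phi k x) x).
  move=> mF iF; apply: (RI_ae mN N00 (mF _ (mpt k)) _ iF) => x nx.
  by rewrite ptE.
have gk k : ig (fun x => (g x - pt k x) ^+ 2) /\ RI (fun x => (g x - pt k x) ^+ 2) <= 4 * ep k.
  have mj j : mf (fun x => (pt (j + k)%N x - pt k x) ^+ 2).
    by have h1 := mpt (j + k)%N; have h2 := mpt k; mm.
  have hj j := RI_ae mN N00 (mj j) (fun x nx => congr1 (fun a => a ^+ 2)
     (congr2 (fun a b : R => a - b) (ptE (j + k)%N x nx) (ptE k x nx))) (icl (j + k)%N k).
  apply: (RI_fatou (f_ := fun j x => (pt (j + k)%N x - pt k x) ^+ 2)).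
  - by move=> j; case: (hj j).
  - by move=> j x; exact: sqr_ge0.
  - move=> x; apply: cvg_sqr; apply: cvgB; last exact: cvg_cst.
    by have := gc x; rewrite -(cvg_shiftn k).
  - by move=> j; have [_ ->] := hj j; apply: close; exact: leq_addl.
have mp2 k : ig (fun x => pt k x ^+ 2) /\ RI (fun x => pt k x ^+ 2) = RI (fun x => phi k x ^+ 2).
  have [_ i2] := TI (Tp k).
  apply: (RI_ae mN N00 _ _ i2) => [|x nx]; last by rewrite ptE.
  by have h := mpt k; mm.
(* Near-minimality in the direction of phi_k itself: with P its squared norm and a = ell(phi_k), (P
   - a)^2 <= P ep_k and a^2 <= B P, hence P^2 <= 2 P (B + ep_k). *)
have pB k : RI (fun x => phi k x ^+ 2) <= 2 * B + 2 * ep k.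
  have h1 := first_var (Tp k) (Tp k) (Jp k); have h2 := ellB (Tp k).
  have P0 : 0 <= RI (fun x => phi k x ^+ 2) by apply: RI_ge0 => x; exact: sqr_ge0.
  move: h1; rewrite /E (eq_RI (f := fun x => phi k x * phi k x) (g := fun x => phi k x ^+ 2)); last first.
    by move=> x; rewrite expr2.
  move: P0 h2; move: (RI _) (ell _) (ep k) (ep0 k) => P a e e0 P0 h2 h1.
  have [->|Pn] := eqVneq P 0; first by rewrite addr_ge0 // mulr_ge0 // ltW.
  have Pp : 0 < P by rewrite lt_neqAle eq_sym Pn.
  rewrite -(ler_pM2r Pp); have := sqr_ge0 (P - 2 * a); lra.
have gB K : ig (fun x => g x ^+ 2) /\ RI (fun x => g x ^+ 2) <= 2 * B + 2 * ep K.
  apply: (RI_fatou (f_ := fun j x => pt (j + K)%N x ^+ 2)).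
  - by move=> j; case: (mp2 (j + K)%N).
  - by move=> j x; exact: sqr_ge0.
  - by move=> x; apply: cvg_sqr; have := gc x; rewrite -(cvg_shiftn K).
  - move=> j; have [_ ->] := mp2 (j + K)%N; apply: le_trans (pB _) _.
    by rewrite lerD2l ler_wpM2l // epS // leq_addl.
have ep_small e : 0 < e -> exists k, ep k <= e.
  move=> e0; exists (Num.truncn e^-1).
  have := truncnS_gt e^-1; set k := Num.truncn _ => h.
  rewrite /ep exprVn -[leRHS]invrK lef_pV2 ?posrE ?exprn_gt0 ?invr_gt0 //.
  apply: le_trans (ltW h) _; rewrite -natrX ler_nat; exact: ltn_expl.
exists g; split=> //.
- by case: (gB 0%N).
- apply/ler_addgt0Pr => e e0; have [k hk] := ep_small (e / 2) (divr_gt0 e0 (ltr0n _ 2)).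
  have [_ h] := gB k; apply: le_trans h _; rewrite lerD2l.
  by rewrite mulrC -ler_pdivlMr.
move=> f hf; have [mf_ if2] := TI hf; have [ig2 _] := gB 0%N.
have [igf _] := RI_CS mg mf_ ig2 if2.
set P := RI (fun x => f x ^+ 2).
have P0 : 0 <= P by apply: RI_ge0 => x; exact: sqr_ge0.
have mM k : mf (fun x => pt k x * f x) by have h := mpt k; mm.
(* The defect splits into the pairing of g - phi_k with f, of square at most 4 ep_k P, and the first
   variation at phi_k, of square at most ep_k P; then 10 = 2 (4 + 1). *)
have bound k : (RI (fun x => g x * f x) - ell f) ^+ 2 <= 10 * P * ep k.
  have [i1 r1] := gk k; have mgk : mf (fun x => g x - pt k x) by have h := mpt k; mm.
  have [i2 r2] := RI_CS mgk mf_ i1 if2.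
  have [ipf Ep] := RI_ae mN N00 (mM k)
    (fun x nx => congr1 (fun a => a * f x) (ptE k x nx)) (igM (Tp k) hf).
  have h1 := first_var (Tp k) hf (Jp k).
  have s1 : RI (fun x => g x * f x) = RI (fun x => (g x - pt k x) * f x) + RI (fun x => phi k x * f x).
    rewrite -Ep -(RID i2 ipf); apply: eq_RI => x.
    by rewrite -mulrDl subrK.
  have r3 := le_trans r2 (ler_wpM2r P0 r1).
  move: h1 r3; rewrite s1 /E -/P; move: (RI _) (RI _) (ell f) => a b c h1 h2.
  have := sqr_ge0 (a - (b - c)); lra.
apply/eqP; rewrite -subr_eq0 -sqrf_eq0 eq_le sqr_ge0 andbT.
apply/ler_addgt0Pr => e e0; rewrite add0r.
have p : 0 < 10 * P + 1 by rewrite ltr_wpDl // mulr_ge0.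
have [k hk] := ep_small (e / (10 * P + 1)) (divr_gt0 e0 p).
apply: le_trans (bound k) _.
have h10 : 0 <= 10 * P by rewrite mulr_ge0.
apply: le_trans (ler_wpM2l h10 hk) _.
by rewrite mulrA ler_pdivrMr // mulrC ler_wpM2l ?ltW // ltrDl.
Qed.

End Hilbert.

(** * From the estimates to the statement *)

Section Assembly.
Variables (R : realType) (n : nat).
Local Notation V := 'rV[R]_n.
Implicit Types (K u f g h phi : V -> R) (x y : V) (s r : R).

Lemma indicE_chi r x : \1_(@Defs.ballE R n r) x = chi r x :> R.
Proof.
rewrite indicE /chi; congr ((_ : bool)%:R).
by apply/idP/idP => h; [have := set_mem h|apply: mem_set].
Qed.

(* Changing K at the origin does not affect L, while the bounds of the class
   only hold for y != 0; at y = 0 the power in [kap] has the junk value 0. *)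
Definition offzero K y : R := (0 < enorm y)%R%:R * K y.

Lemma offzero_kern lam Lam s K : 0 < lam -> lam <= Lam -> s < 2 ->
  classL0 lam Lam s K ->
  kern Lam s (offzero K) /\ forall y, 1 <= s -> lam * kap s y <= offzero K y.
Proof.
move=> l0 lL s2 [/borel_measP mK hK]; have L0 := le_trans (ltW l0) lL.
have mK' : mf K := mK.
have H y : 1 <= s -> lam * kap s y <= offzero K y.
  move=> s1; rewrite /offzero enorm_gt0; have [->|y0] := eqVneq y 0.
    by rewrite kap0 // mulr0 mul0r.
  by have [h _] := hK y y0; rewrite mul1r /kap /pw mulrCA mulrA.
split=> //; split=> //.
  by have h := @mf_enorm R n; rewrite /offzero; mm.
move=> y; rewrite /offzero enorm_gt0; have [->|y0] := eqVneq y 0.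
  by rewrite mul0r lexx mulr_ge0 // kap_ge0.
have [h1 h2] := hK y y0; rewrite mul1r; apply/andP; split.
  apply: le_trans h1; apply: mulr_ge0 (powR_ge0 _ _); apply: mulr_ge0 (ltW l0).
  by rewrite subr_ge0 ltW.
by apply: le_trans h2 _; rewrite /kap /pw [leRHS]mulrCA mulrA.
Qed.

Lemma Lop_offzero K phi x : Lop K phi x = Lop (offzero K) phi x.
Proof.
congr Defs.Rint; apply/funext => y; rewrite /offzero enorm_gt0.
have [->|y0] := eqVneq y 0; last by rewrite mul1r.
rewrite /delta2 addr0 subr0 (_ : _ - _ = 0) ?mul0r //.
by rewrite mulr_natl mulr2n subrr.
Qed.

Lemma Lk_lin s c C r C' r' K f g (a : R) x : 1 <= s -> s < 2 ->
  nice C r f -> nice C' r' g -> kern c s K ->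
  Lk K (fun x => f x + a * g x) x = Lk K f x + a * Lk K g x.
Proof.
move=> s1 s2 hf hg hK.
have i1 := ig_delta2K s1 s2 x hf hK; have i2 := ig_delta2K s1 s2 x hg hK.
rewrite /Lk -(RIZ a i2) -(RID i1 (igZ a i2)); apply: eq_RI => y.
by rewrite /delta2; ring.
Qed.

Lemma ig_test r h phi : mf h -> ig (fun x => chi r x * h x ^+ 2) -> test_fun r phi ->
  ig (fun x => h x * phi x).
Proof.
move=> mh ih tphi; have [C [rho [rr [hb _ _]]]] := test_nice tphi.
have [mp pC p0] := hb; have mcr := @mf_chi R n r.
have ip2 : ig (fun x => phi x ^+ 2) := ig_bcsM hb mp pC.
have e x := chi_sqr r (h x) x.
have m1 : mf (fun x => chi r x * h x) by mm.
have [ii _] := RI_CS m1 mp (eq_ig e ih) ip2.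
apply: (eq_ig _ ii) => x; rewrite /chi; case: ltP => hx; first by rewrite mul1r.
by rewrite p0 ?mulr0 // (le_trans (ltW rr)).
Qed.

End Assembly.

Theorem theorem4p3 (R : realType) (n : nat) (lambda Lambda sigma0 C1 : R) :
  (1 <= n)%N -> 0 < lambda -> lambda <= Lambda -> 1 < sigma0 -> sigma0 < 2 ->
  0 <= C1 ->
  exists C : R, 0 < C /\
    forall (sigma : R) (K K' u f : 'rV[R]_n -> R),
      sigma0 <= sigma -> sigma < 2 ->
      classL1 lambda Lambda sigma C1 K ->
      classL0 lambda Lambda sigma K' ->
      wL1 sigma u ->
      L2ball 1 f ->
      weak_sol 1 K u f ->
      exists g : 'rV[R]_n -> R,
        L2ball (2^-1) g /\
        represents (2^-1) K' u g /\
        L2ball_norm (2^-1) g <= C * (wL1_norm sigma u + L2ball_norm 1 f).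
Proof.
move=> n0 l0 lL s01 s02 C10.
have [Z Z0 HZ] := dual_bound n0 l0 lL.
(* [Z] is fixed before sigma and the kernels are given; the factor 2 comes from [riesz], and the
   summand 1 secures strict positivity. *)
exists (Num.sqrt (2 * Z) + 1); split; first by rewrite ltr_wpDl // sqrtr_ge0.
move=> s K K' u f s0s s2 [hK _] hK' [/borel_measP mu iu] [/borel_measP mf_ if2] hsol.
have s1 : 1 <= s := le_trans (ltW s01) s0s.
have {}mu : mf u := mu. have {}mf_ : mf f := mf_.
have [kK hl] := offzero_kern l0 lL s2 hK; have [kK' _] := offzero_kern l0 lL s2 hK'.
have {}hl y := hl y s1.
have {}iu : ig (fun x => `|u x| * wt s x).
  apply: ig_intRn iu => [|x]; last by rewrite mulr_ge0 // ltW // wt_gt0.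
  by have h : mf (wt s) := @mf_wt R n s; change (mf (fun y => `|u y| * wt s y)); mm.
have Eu : wL1_norm s u = RI (fun x => `|u x| * wt s x).
  by rewrite /wL1_norm /wL1_integrand (intRn_RI iu) // => x; rewrite mulr_ge0 // ltW // wt_gt0.
have e1 r (h : 'rV[R]_n -> R) : (fun x => (\1_(@Defs.ballE R n r) x * h x ^+ 2)%:E) =
    (fun x => (chi r x * h x ^+ 2)%:E).
  by apply/funext => x; rewrite indicE_chi.
have p1 r (h : 'rV[R]_n -> R) x : 0 <= chi r x * h x ^+ 2.
  by rewrite mulr_ge0 ?chi_ge0 ?sqr_ge0.
have mc r : mf (@chi R n r) := mf_chi r.
have {}if2 : ig (fun x => chi 1 x * f x ^+ 2).
  rewrite e1 in if2; apply: ig_intRn if2 => // .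
  by have h := mc 1; mm.
have EF : L2ball_norm 1 f = Num.sqrt (RI (fun x => chi 1 x * f x ^+ 2)).
  by rewrite /L2ball_norm e1 (intRn_RI if2).
(* Passes from [Rint] and [Lop] of the statement to [RI] and [Lk]; the decay of L phi against the
   weight supplies the integrability. *)
have EL Q r phi : kern Lambda s (offzero Q) -> r <= 1 -> test_fun r phi ->
    Defs.Rint (fun x => u x * Lop Q phi x) = RI (fun x => u x * Lk (offzero Q) phi x).
  move=> kQ r1 tphi; have [C [rho [rr hp]]] := test_nice tphi.
  have E x : u x * Lk (offzero Q) phi x = u x * Lop Q phi x.
    by rewrite Lop_offzero (LopE s1 s2 x hp kQ).
  have ii := ig_uLk s1 s2 mu iu hp (le_trans (ltW rr) r1) kQ.
  by rewrite -(funext E) Rint_RI.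
have sol phi : test_fun 1 phi -> RI (fun x => u x * Lk (offzero K) phi x) = RI (fun x => f x * phi x).
  move=> tphi; rewrite -(EL K 1 phi kK (lexx 1) tphi) (hsol _ tphi) Rint_RI //.
  exact: ig_test if2 tphi.
set U := RI (fun x => `|u x| * _) in Eu; set F := RI (fun x => chi 1 x * _) in EF.
have U0 : 0 <= U by apply: RI_ge0 => x; rewrite mulr_ge0 // ltW // wt_gt0.
have F0 : 0 <= F by apply: RI_ge0.
have h21 : (2^-1 : R) <= 1 by rewrite invf_le1 // ler1n.
have db := HZ s _ _ u f s1 s2 kK hl kK' mu mf_ iu if2 sol.
have B0 : 0 <= Z * (U ^+ 2 + F) by rewrite mulr_ge0 // addr_ge0 ?sqr_ge0.
have TI (phi : 'rV[R]_n -> R) : test_fun 2^-1 phi -> mf phi /\ ig (fun x => phi x ^+ 2).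
  move=> /test_nice[C [rho [_ [hb _ _]]]]; have [mp pC _] := hb.
  by split=> //; exact: ig_bcsM hb mp pC.
have ellD phi psi (c : R) : test_fun 2^-1 phi -> test_fun 2^-1 psi ->
    RI (fun x => u x * Lk (offzero K') (fun x => phi x + c * psi x) x) =
    RI (fun x => u x * Lk (offzero K') phi x) + c * RI (fun x => u x * Lk (offzero K') psi x).
  move=> /test_nice[C [rho [rr hp]]] /test_nice[C' [rho' [rr' hp']]].
  have i1 := ig_uLk s1 s2 mu iu hp (le_trans (ltW rr) h21) kK'.
  have i2 := ig_uLk s1 s2 mu iu hp' (le_trans (ltW rr') h21) kK'.
  rewrite -(RIZ c i2) -(RID i1 (igZ c i2)); apply: eq_RI => x.
  by rewrite (Lk_lin c x s1 s2 hp hp' kK') mulrDr mulrCA.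
have [g [mg ig2 gB hg]] := riesz (ell := fun phi => RI (fun x => u x * Lk (offzero K') phi x))
  (test0 n _) (fun f g c => test_lin c) TI ellD B0 db.
have icg : ig (fun x => chi 2^-1 x * g x ^+ 2).
  apply: (ig_le _ ig2) => [|x]; first by have h := mc 2^-1; mm.
  by rewrite normrM (ger0_norm (sqr_ge0 _)) ler_piMl ?sqr_ge0 // ger0_norm ?chi_ge0 ?chi_le1.
exists g; split; [split|split].
- exact/borel_measP.
- by rewrite e1 (intRn_RI icg) // ltry.
- move=> phi tphi; rewrite (EL K' _ phi kK' h21 tphi) -(hg _ tphi) Rint_RI //.
  exact: ig_test icg tphi.
rewrite Eu EF /L2ball_norm e1 (intRn_RI icg) //=.
apply: (@le_trans _ _ (Num.sqrt (2 * Z) * (U + Num.sqrt F))); last first.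
  by rewrite ler_wpM2r ?lerDl // addr_ge0 ?sqrtr_ge0.
have q0 : 0 <= Num.sqrt (2 * Z) * (U + Num.sqrt F).
  by rewrite mulr_ge0 ?sqrtr_ge0 // addr_ge0 ?sqrtr_ge0.
rewrite -[leRHS]ger0_norm // -sqrtr_sqr ler_wsqrtr // exprMn sqr_sqrtr ?mulr_ge0 //.
apply: (@le_trans _ _ (RI (fun x => g x ^+ 2))).
  apply: (RI_le icg ig2) => x; rewrite ler_piMl ?sqr_ge0 ?chi_le1 //.
apply: le_trans gB _; rewrite mulrA; apply: ler_wpM2l; first by rewrite mulr_ge0.
rewrite sqrrD sqr_sqrtr // lerD2r lerDl.
by rewrite mulrn_wge0 // mulr_ge0 ?sqrtr_ge0.
Qed.
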